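(* Let $(X,\mu,T)$ be an ergodic measure-preserving system. For $k\in\mathbb{N}$ let $Z_k\subset L^2(X,\mu)$ be the orthogonal complement of $\overline{\{f\in L^\infty(X,\mu):\|f\|_{U^{k+1}}=0\}}$ (closure in $L^2(X,\mu)$), and let $D_k\subset L^2(X,\mu)$ be the subspace induced by the distal factor $\mathcal{D}_k$ of order $k$ of $(X,\mu,T)$. Then $Z_k\subset D_k$ for every $k\in\mathbb{N}$.
   Context: Systems. A measure-preserving system is a triple $(X,\mu,\varphi)$ where $(X,\mu)$ is a probability space and $\varphi:X\to X$ is measurable, invertible with measurable inverse, and $\mu$-preserving. Its Koopman operator is $Tf:=f\circ\varphi$, and one writes $(X,\mu,T)$. The $\sigma$-algebra need not be countably generated. The system is ergodic if every measurable $A$ with $\varphi^{-1}A\subset A$ up to a null set has measure $0$ or $1$. Write $L^p(X)$ for $L^p(X,\mu)$. Factors. A system $(Y,\nu,S)$ is a (Markov) factor of $(X,\mu,T)$ if there is a positive linear operator $J:L^1(Y)\to L^1(X)$ with $J\mathbf 1=\mathbf 1$, $\int_X Jf\,d\mu=\int_Y f\,d\nu$ for all $f\in L^1(Y)$, $J$ multiplicative on $L^\infty(Y)$, and $JS=TJ$. The conditional expectation operator $E_Y:L^1(X)\to L^1(Y)$ is the extension of the adjoint of $J$. Functions $c\in L^\infty(Y)$ are identified with $Jc$, so that $cf$ makes sense for $f\in L^1(X)$. A subspace $\mathcal A\subset L^2(X)$ is induced by the factor $(Y,\nu,S)$ if $\mathcal A=JL^2(Y)$; equivalently, $\mathcal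 A=L^2(X,\Sigma',\mu)$ for the corresponding $\varphi$- and $\varphi^{-1}$-invariant sub-$\sigma$-algebra $\Sigma'$. Conditional almost periodicity. For a factor $(Y,\nu,S)$ and $f\in L^2(X)$ put $\|f\|_{L^2(X|Y)}:=(E_Y(|f|^2))^{1/2}$, and let $L^2(X|Y):=\{f\in L^2(X):\|f\|_{L^2(X|Y)}\in L^\infty(Y)\}$. A function $f\in L^2(X|Y)$ is conditionally almost periodic if for every $\varepsilon>0$ there are $m\in\mathbb{N}$ and $f_1,\dots,f_m\in L^2(X|Y)$ such that for every $n\in\mathbb{Z}$ there is $g\in\{c_1f_1+\dots+c_mf_m:\ c_i\in L^\infty(Y),\ \|c_i\|_{L^\infty(Y)}\le 1\}$ with $\big\|\|T^nf-g\|_{L^2(X|Y)}\big\|_{L^\infty(Y)}<\varepsilon$. $A(X|Y)$ denotes the space of all such $f$, and $\overline{A(X|Y)}$ its closure in $L^2(X)$. When $(Y,\nu,S)$ is ergodic, $\overline{A(X|Y)}$ is induced by a factor of $(X,\mu,T)$. Distal factors. For an ergodic system $(X,\mu,T)$ let $D_0:=\mathbb{C}\mathbf 1$ with $\mathcal{D}_0$ the one-point factor, and inductively, for $k\in\mathbb{N}$, let $D_k:=\overline{A(X|\mathcal{D}_{k-1})}$ and let $\mathcal{D}_k$ be the factor inducing $D_k$, called the distal factor of order $k$. Gowers-Host-Kra seminorms. For an ergodic system and $f\in L^\infty(X)$ define inductively $\|f\|_{U^1}:=\left|\int_X f\,d\mu\right|$ and $\|f\|_{U^{l+1}}^{2^{l+1}}:=\limsup_{N\to\infty}\frac1N\sum_{n=1}^N\|T^nf\cdot\overline{f}\|_{U^l}^{2^l}$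 for $l\in\mathbb{N}$. *)

(* Defs.v *)
From HB Require Import structures.
From mathcomp Require Import all_boot all_order all_algebra.
From mathcomp Require Import all_classical all_reals all_analysis.
From mathcomp Require Import complex.

Set Implicit Arguments.
Unset Strict Implicit.
Unset Printing Implicit Defensive.
Import Order.TTheory GRing.Theory Num.Theory.
Import numFieldNormedType.Exports.
Local Open Scope classical_set_scope.
Local Open Scope ring_scope.
Local Open Scope complex_scope.

(* Scalars are complex, in R[i].  Elements of L^p are represented by functions,
   identified when equal almost everywhere; the sets of functions below contain
   every measurable function that is a.e. equal to one of their members. *)

Record mpsystem (R : realType) := MPSystem {
  mps_disp : measure_display;
  mps_sort :> measurableType mps_disp;
  mps_mu : probability mps_sort R;
  mps_map : mps_sort -> mps_sort;
  mps_inv : mps_sort -> mps_sort;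
  mps_mapK : cancel mps_map mps_inv;
  mps_invK : cancel mps_inv mps_map;
  mps_map_measurable : measurable_fun setT mps_map;
  mps_inv_measurable : measurable_fun setT mps_inv;
  mps_preserving : forall A : set mps_sort, measurable A ->
    mps_mu (mps_map @^-1` A) = mps_mu A }.

Section lebesgue_spaces.
Context {R : realType} (X : mpsystem R).
Local Notation mu := (mps_mu X).
Local Notation phi := (@mps_map R X).
Implicit Types (f g : X -> R[i]) (p : \bar R).

Definition ergodic : Prop := forall A : set X, measurable A ->
  mu ((phi @^-1` A) `\` A) = 0%E -> mu A = 0%E \/ mu A = 1%E.

Definition cabs f : X -> R := fun x => ComplexField.Normc.normc (f x).

Definition cmeasurable f : Prop :=
  measurable_fun setT (fun x => complex.Re (f x)) /\
  measurable_fun setT (fun x => complex.Im (f x)).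

Definition cLnorm p f : \bar R := Lnorm mu p (EFin \o cabs f).

Definition cLp p : set (X -> R[i]) :=
  [set f | cmeasurable f /\ (cLnorm p f < +oo)%E].

Definition cae_eq f g : Prop := \forall x \ae mu, f x = g x.

Definition cintegral f : R[i] :=
  Rintegral mu setT (fun x => complex.Re (f x)) +i*
  Rintegral mu setT (fun x => complex.Im (f x)).

Definition cinner f g : R[i] := cintegral (fun x => f x * conjc (g x)).

Definition L2_closure (A : set (X -> R[i])) : set (X -> R[i]) :=
  [set f | cLp 2%:E f /\ forall eps : R, 0 < eps ->
    exists2 g, A g & (cLnorm 2%:E (fun x => f x - g x)%R < eps%:E)%E].

Definition L2_orthogonal (A : set (X -> R[i])) : set (X -> R[i]) :=
  [set f | cLp 2%:E f /\ forall g, A g -> cinner f g = 0].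

Definition mps_iter (n : int) : X -> X :=
  match n with
  | Posz m => iter m phi
  | Negz m => iter m.+1 (@mps_inv R X)
  end.

Definition koopman (n : int) f : X -> R[i] := f \o mps_iter n.

End lebesgue_spaces.

(* mf_op is the operator J : L^1(Y) -> L^1(X), given on representatives; its
   values outside L^1(Y) are irrelevant. *)
Record markov_factor (R : realType) (X : mpsystem R) := MarkovFactor {
  mf_sys :> mpsystem R;
  mf_op : (mf_sys -> R[i]) -> (X -> R[i]);
  mf_L1 : forall f, cLp 1%:E f -> cLp 1%:E (mf_op f);
  mf_ae : forall f g, cLp 1%:E f -> cLp 1%:E g -> cae_eq f g ->
    cae_eq (mf_op f) (mf_op g);
  mf_linear : forall (a : R[i]) f g, cLp 1%:E f -> cLp 1%:E g ->
    cae_eq (mf_op (fun y => a * f y + g y))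
           (fun x => a * mf_op f x + mf_op g x);
  mf_pos : forall f, cLp 1%:E f -> (\forall y \ae mps_mu mf_sys, 0 <= f y) ->
    \forall x \ae mps_mu X, 0 <= mf_op f x;
  mf_one : cae_eq (mf_op (fun=> 1)) (fun=> 1);
  mf_int : forall f, cLp 1%:E f -> cintegral (mf_op f) = cintegral f;
  mf_mul : forall f g, cLp +oo%E f -> cLp +oo%E g ->
    cae_eq (mf_op (fun y => f y * g y)) (fun x => mf_op f x * mf_op g x);
  mf_koopman : forall f, cLp 1%:E f ->
    cae_eq (mf_op (koopman 1 f)) (koopman 1 (mf_op f)) }.

Section relative_notions.
Context {R : realType} (X : mpsystem R) (Y : markov_factor X).
Local Notation J := (@mf_op R X Y).

Definition factor_space : set (X -> R[i]) :=
  [set f | cLp 2%:E f /\ exists2 h : Y -> R[i], cLp 2%:E h & cae_eq f (J h)].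

Definition induces (A : set (X -> R[i])) : Prop := A = factor_space.

(* Since J commutes with complex conjugation, being the adjoint of J amounts
   to the following duality with respect to the bilinear pairing; it determines
   the value up to a null set. *)
Definition is_cond_expectation (f : X -> R[i]) (g : Y -> R[i]) : Prop :=
  cLp 1%:E g /\ forall c : Y -> R[i], cLp +oo%E c ->
    cintegral (fun y => c y * g y) = cintegral (fun x => J c x * f x).

Definition cond_expectation (f : X -> R[i]) : Y -> R[i] :=
  xget (fun=> 0) [set g | is_cond_expectation f g].

(* the function ||f||_{L^2(X|Y)} = (E_Y(|f|^2))^{1/2} on Y *)
Definition cond_norm (f : X -> R[i]) : Y -> R[i] := fun y =>
  (Num.sqrt (complex.Re
    (cond_expectation (fun x => ((cabs f x) ^+ 2)%:C) y)))%:C.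

Definition cond_L2 : set (X -> R[i]) :=
  [set f | cLp 2%:E f /\ cLp +oo%E (cond_norm f)].

Definition cond_ap : set (X -> R[i]) :=
  [set f | cond_L2 f /\ forall eps : R, 0 < eps ->
    exists (m : nat) (fs : 'I_m -> X -> R[i]),
      (forall i, cond_L2 (fs i)) /\
      forall n : int, exists c : 'I_m -> Y -> R[i],
        (forall i, cLp +oo%E (c i) /\ (cLnorm +oo%E (c i) <= 1)%E) /\
        (cLnorm +oo%E (cond_norm (fun x =>
           koopman n f x - \sum_(i < m) J (c i) x * fs i x)%R) < eps%:E)%E].

End relative_notions.

Section distal_and_ghk.
Context {R : realType} (X : mpsystem R).

Definition L2_constants : set (X -> R[i]) :=
  [set f | cLp 2%:E f /\ exists a : R[i], cae_eq f (fun=> a)].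

(* A factor inducing a given subspace is unique up to isomorphism, so "the"
   distal factor of order k is rendered as a predicate on Markov factors.  The
   factors inducing C1 are those isomorphic to the one-point system. *)
Fixpoint distal_factor (k : nat) (Y : markov_factor X) : Prop :=
  match k with
  | 0 => induces Y L2_constants
  | k'.+1 => exists2 W : markov_factor X, distal_factor k' W &
               induces Y (L2_closure (cond_ap W))
  end.

(* Index shift: ghk_seminorm l is the seminorm U^{l+1}. *)
Fixpoint ghk_seminorm (l : nat) (f : X -> R[i]) : R :=
  match l with
  | 0 => ComplexField.Normc.normc (cintegral f)
  | l'.+1 =>
      (limn_sup (fun N : nat => N%:R^-1 * \sum_(1 <= n < N.+1)
         ghk_seminorm l' (fun x => koopman n f x * conjc (f x)) ^+ (2 ^ l'.+1)))
      `^ ((2 ^ l'.+2)%:R^-1)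
  end.

Definition ghk_space (k : nat) : set (X -> R[i]) :=
  L2_orthogonal (L2_closure [set f | cLp +oo%E f /\ ghk_seminorm k f = 0]).

End distal_and_ghk.

Arguments ghk_space {R} X k.
Arguments L2_constants {R} X.

(* Main.v *)
Require Import Defs.
From HB Require Import structures.
From mathcomp Require Import all_boot all_order all_algebra.
From mathcomp Require Import all_classical all_reals all_analysis.
From mathcomp Require Import complex ring lra.
From mathcomp Require Import measurable_realfun ess_sup_inf.

Set Implicit Arguments.
Unset Strict Implicit.
Unset Printing Implicit Defensive.
Import Order.TTheory GRing.Theory Num.Theory.
Import numFieldNormedType.Exports.
Local Open Scope classical_set_scope.
Local Open Scope ring_scope.

(* Fix a factor Y with conditional expectation E, and a bounded real h.  Among
   the convex combinations of the rank-one kernels T^n h (x)_Y T^n h, those whose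
   Hilbert-Schmidt norm is nearly minimal form a Cauchy sequence and are nearly
   shift-invariant.  Hence, if K_m is such a sequence and f is bounded, K_m f
   converges to some F, and the kernels are so uniformly close on a set of
   positive measure in Y that, by ergodicity, F is conditionally almost
   periodic.  If h is orthogonal to A(X|Y), taking f = h shows that the minimal
   norm is 0, which amounts to
     1/N sum_(n <= N) int_Y E(T^n h f)^2 -> 0   for every bounded f.
   Writing f = g + h with g the projection of f on D_{k+1}, and Y = D_k, an
   induction on k now gives, for |f| <= 1,
     |f|_{U^{k+1}} ^ 2^{k+1} <= 2^k |E(f | D_k)|_2 ^ 2.
   So a bounded v with E(v | D_k) = 0 is orthogonal to Z_k; applied to the
   residual v of a truncation t of f in Z_k, this gives |v|_2 <= |f - t|_2, so
   the projections of the truncations of f converge to f. *)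

(** The sigma-algebra need not be countably generated and [J] comes without a point map, so neither
    a disintegration over Y nor a relative product is at hand. A kernel is therefore only a finite
    weighted list, and its fibrewise geometry is read off the functions E(T^i h T^j h) on Y: the
    inner product of the rank-one kernels of T^i h and T^j h is E(T^i h T^j h)^2. Nonnegativity of
    the resulting quadratic form is the Schur product theorem for almost every Gram matrix. No limit
    kernel is formed either: the parallelogram law among convex combinations takes the place of
    completeness, and only the functions K_m f converge. When h is orthogonal to A(X|Y), the squared
    norm of K_m is an average of integrals int h (T^n K_m) h, each close to int h K_m h, which tends
    to int h F = 0. One convex combination of small norm then controls the Cesaro means, since
    averaging over finitely many shifts changes them by O(1/N). The factor 2^k comes from (a + b)^2
    <= 2 a^2 + 2 b^2, used once per order to separate the projected part of T^n f from its
    residual. *)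

(** * Bounded measurable real functions and their integrals *)

(** Boundedness is required everywhere, not almost everywhere: products, powers and shifts then stay
    in the class without exceptional sets, and every member is integrable. *)
Definition bm {d} {T : measurableType d} {R : realType} (f : T -> R) : Prop :=
  measurable_fun setT f /\ exists M, forall x, `|f x| <= M.

Section bounded_measurable.
Context d (T : measurableType d) (R : realType).
Implicit Types (f g : T -> R).

Lemma bm_cst (a : R) : bm (fun _ : T => a).
Proof. by split; [exact: measurable_cst | exists `|a|]. Qed.

Lemma bmD f g : bm f -> bm g -> bm (fun x => f x + g x).
Proof.
move=> [mf [M fM]] [mg [N gN]]; split; first exact: measurable_funD.
by exists (M + N) => x; apply: le_trans (ler_normD _ _) _; rewrite lerD.
Qed.

Lemma bmN f : bm f -> bm (fun x => - f x).
Proof.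
move=> [mf [M fM]]; split; first exact: measurableT_comp.
by exists M => x; rewrite normrN.
Qed.

Lemma bmM f g : bm f -> bm g -> bm (fun x => f x * g x).
Proof.
move=> [mf [M fM]] [mg [N gN]]; split; first exact: measurable_funM.
by exists (M * N) => x; rewrite normrM ler_pM.
Qed.

Lemma bmX f n : bm f -> bm (fun x => f x ^+ n).
Proof.
move=> [mf [M fM]]; split; first exact: measurable_funX.
by exists (M ^+ n) => x; rewrite normrX lerXn2r ?nnegrE // (le_trans _ (fM x)).
Qed.

Lemma bm_norm f : bm f -> bm (fun x => `|f x|).
Proof.
move=> [mf [M fM]]; split; first exact: measurableT_comp.
by exists M => x; rewrite normr_id.
Qed.

Lemma bm_max f g : bm f -> bm g -> bm (fun x => Num.max (f x) (g x)).
Proof.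
move=> [mf [M fM]] [mg [N gN]]; split; first exact: measurable_maxr.
exists (M + N) => x.
have := fM x; have := gN x; have := normr_ge0 (f x); have := normr_ge0 (g x).
by rewrite /Num.max; case: ifP => _; lra.
Qed.

Lemma bm_indic (A : set T) : measurable A -> bm (\1_A : T -> R).
Proof.
move=> mA; split; first exact: measurable_indic.
by exists 1 => x; rewrite indicE; case: (_ \in _); rewrite /= ?normr1 ?normr0.
Qed.

Lemma bm_sum (I : Type) (s : seq I) (F : I -> T -> R) :
  (forall i, bm (F i)) -> bm (fun x => \sum_(i <- s) F i x).
Proof.
move=> bF; elim: s => [|i s IH].
  rewrite (_ : (fun x => _) = fun=> 0); first exact: bm_cst.
  by apply/funext => x; rewrite big_nil.
rewrite (_ : (fun x => _) = fun x => F i x + \sum_(j <- s) F j x).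
  exact: bmD.
by apply/funext => x; rewrite big_cons.
Qed.

End bounded_measurable.

Lemma bm_comp d (T : measurableType d) d' (T' : measurableType d')
    (R : realType) (f : T' -> R) (p : T -> T') :
  measurable_fun setT p -> bm f -> bm (fun x => f (p x)).
Proof.
move=> mp [mf [M fM]]; split; first exact: measurableT_comp mf mp.
by exists M => x.
Qed.

Ltac bmt := repeat (first [assumption | match goal with
  | |- bm (fun x => @?f x + @?g x) => apply: bmD
  | |- bm (fun x => - @?f x) => apply: bmN
  | |- bm (fun x => @?f x * @?g x) => apply: bmM
  | |- bm (fun x => @?f x ^+ _) => apply: bmX
  | |- bm (fun x => `|@?f x|) => apply: bm_norm
  | |- bm (fun _ => ?a) => exact: bm_cst
  | |- bm (\1_ _) => apply: bm_indic
  end]).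

Section bounded_integral.
Context d (T : measurableType d) (R : realType) (P : probability T R).
Implicit Types (f g : T -> R).

Local Notation "'I[ f ]" := (Rintegral P setT f) (at level 10, f at level 99).

Lemma bm_integrable f : bm f -> P.-integrable setT (EFin \o f).
Proof.
move=> [mf [M fM]]; apply: measurable_bounded_integrable => //.
  exact: le_lt_trans (probability_le1 P measurableT) (ltry _).
exists M; split; first exact: num_real.
by move=> N MN x _ /=; rewrite (le_trans (fM x)) // ltW.
Qed.

Lemma int_cst (a : R) : 'I[fun _ => a] = a.
Proof. by rewrite Rintegral_cst //= probability_setT mulr1. Qed.

Lemma intD f g : bm f -> bm g -> 'I[fun x => f x + g x] = 'I[f] + 'I[g].
Proof. by move=> *; apply: RintegralD => //; exact: bm_integrable. Qed.

Lemma intB f g : bm f -> bm g -> 'I[fun x => f x - g x] = 'I[f] - 'I[g].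
Proof. by move=> *; apply: RintegralB => //; exact: bm_integrable. Qed.

Lemma intZ f (a : R) : bm f -> 'I[fun x => a * f x] = a * 'I[f].
Proof. by move=> *; apply: RintegralZl => //; exact: bm_integrable. Qed.

Lemma int_sum (I : Type) (s : seq I) (F : I -> T -> R) :
  (forall i, bm (F i)) ->
  'I[fun x => \sum_(i <- s) F i x] = \sum_(i <- s) 'I[F i].
Proof.
move=> bF; elim: s => [|i s IH].
  rewrite big_nil -[RHS](int_cst 0).
  by apply: eq_Rintegral => x _; rewrite big_nil.
rewrite big_cons -IH -intD //; last exact: bm_sum.
by apply: eq_Rintegral => x _; rewrite big_cons.
Qed.

Lemma int_ae_eq f g : bm f -> bm g -> (\forall x \ae P, f x = g x) ->
  'I[f] = 'I[g].
Proof.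
move=> [mf _] [mg _] fg; congr fine; apply: ae_eq_integral => //.
- exact/measurable_EFinP.
- exact/measurable_EFinP.
- by apply: filterS fg => x -> _.
Qed.

Lemma le_int f g : bm f -> bm g -> (forall x, f x <= g x) -> 'I[f] <= 'I[g].
Proof. by move=> *; apply: le_Rintegral => //; exact: bm_integrable. Qed.

Lemma le_int_ae f g : bm f -> bm g -> (\forall x \ae P, f x <= g x) ->
  'I[f] <= 'I[g].
Proof.
move=> bf bg fg; rewrite (_ : 'I[g] = 'I[fun x => Num.max (f x) (g x)]).
  by apply: le_int => //; [exact: bm_max | move=> x; rewrite le_max lexx].
apply: int_ae_eq => //; first exact: bm_max.
by apply: filterS fg => x fgx; rewrite max_r.
Qed.

Lemma int_ge0_ae f : bm f -> (\forall x \ae P, 0 <= f x) -> 0 <= 'I[f].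
Proof.
move=> bf f0; rewrite -(int_cst 0); apply: le_int_ae => //; exact: bm_cst.
Qed.

Lemma int_ge0 f : (forall x, 0 <= f x) -> 0 <= 'I[f].
Proof. by move=> f0; apply: Rintegral_ge0. Qed.

(** Nonnegativity of the variance of [f]. *)
Lemma sqr_int_le f : bm f -> 'I[f] ^+ 2 <= 'I[fun x => f x ^+ 2].
Proof.
move=> bf; have : 0 <= 'I[fun x => (f x - 'I[f]) ^+ 2].
  by apply: int_ge0 => x; exact: sqr_ge0.
rewrite (_ : 'I[fun x => _] =
  'I[fun x => (f x ^+ 2 + (- (2 * 'I[f])) * f x) + 'I[f] ^+ 2]); last first.
  by apply: eq_Rintegral => x _; ring.
rewrite intD ?intD ?intZ ?int_cst; bmt.
by rewrite -subr_ge0 => /le_trans; apply; rewrite le_eqVlt; apply/orP; left;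
  apply/eqP; ring.
Qed.

Lemma int_indic (A : set T) : measurable A -> 'I[\1_A] = fine (P A).
Proof. by move=> mA; rewrite /Rintegral integral_indic // setIT. Qed.

Lemma int_eq0 f : bm f -> (\forall x \ae P, 0 <= f x) -> 'I[f] = 0 ->
  \forall x \ae P, f x = 0.
Proof.
move=> bf f0 If; have mf := measurable_int _ (bm_integrable bf).
have : (\int[P]_x `|(EFin \o f) x| = 0)%E.
  rewrite (_ : (\int[P]_x `|(EFin \o f) x|)%E = (\int[P]_x (f x)%:E)%E).
    rewrite -[LHS]fineK; first by rewrite -/(Rintegral P setT f) If.
    exact: integrable_fin_num (bm_integrable bf).
  apply: ae_eq_integral => //.
    exact: measurableT_comp.
  by apply: filterS f0 => x fx _ /=; rewrite ger0_norm.
move/(ae_eq_integral_abs P measurableT mf).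
by apply: filterS => x /(_ I) [].
Qed.

(** The test function is the positive part of [f - g], for which the hypothesis says that its square
    has nonpositive integral. *)
Lemma ae_le_test f g : bm f -> bm g ->
  (forall c, bm c -> (forall x, 0 <= c x) ->
     'I[fun x => c x * f x] <= 'I[fun x => c x * g x]) ->
  \forall x \ae P, f x <= g x.
Proof.
move=> bf bg h; pose c x := Num.max (f x - g x) 0.
have bc : bm c by apply: bm_max; bmt.
have c0 x : 0 <= c x by rewrite /c le_max lexx orbT.
have cE x : c x * f x - c x * g x = c x ^+ 2.
  rewrite -mulrBr expr2 /c /Num.max; case: ifPn; last by [].
  by rewrite !mul0r.
have : \forall x \ae P, c x ^+ 2 = 0.
  apply: int_eq0; [bmt | by apply: nearW => x; exact: sqr_ge0|].
  apply/eqP; rewrite eq_le; apply/andP; split; last first.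
    by apply: int_ge0 => x; exact: sqr_ge0.
  rewrite -(@eq_Rintegral _ _ _ P setT (fun x => c x ^+ 2)
    (fun x => c x * f x - c x * g x)); last by move=> x _; rewrite cE.
  by rewrite intB ?subr_le0; [apply: h | bmt | bmt].
apply: filterS => x /eqP; rewrite sqrf_eq0 => /eqP cx.
by rewrite -subr_le0 -cx /c le_max lexx.
Qed.

Lemma ae_eq_test f g : bm f -> bm g ->
  (forall c, bm c -> (forall x, 0 <= c x) ->
     'I[fun x => c x * f x] = 'I[fun x => c x * g x]) ->
  \forall x \ae P, f x = g x.
Proof.
move=> bf bg h; apply: filterS2 (_ : \forall x \ae P, f x <= g x)
   (_ : \forall x \ae P, g x <= f x).
- by move=> x fg gf; apply/eqP; rewrite eq_le fg.
- by apply: ae_le_test => // c bc c0; rewrite h.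
- by apply: ae_le_test => // c bc c0; rewrite h.
Qed.

Lemma int_dominated (u : nat -> T -> R) f (M : R) :
  (forall n, bm (u n)) -> bm f -> (forall n x, `|u n x| <= M) ->
  (\forall x \ae P, u ^~ x @ \oo --> f x) ->
  (fun n => 'I[u n]) @ \oo --> 'I[f].
Proof.
move=> bu bf uM uf.
have [] := @dominated_convergence _ _ _ P setT measurableT
   (fun n => EFin \o u n) (EFin \o f) (fun=> M%:E).
- by move=> n; apply/measurable_EFinP; case: (bu n).
- by apply/measurable_EFinP; case: bf.
- by apply: filterS uf => x ux _; apply: cvg_EFin => //; exact: nearW.
- by apply: (bm_integrable (bm_cst T M)).
- by apply: nearW => x n _ /=; rewrite lee_fin.
move=> _ _ /= h; have ffin := integrable_fin_num measurableT (bm_integrable bf).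
rewrite /Rintegral.
apply: (@fine_cvg _ _ _ _ (fun n => \int[P]_x ((u n x)%:E))%E).
by rewrite fineK.
Qed.

Lemma int_markov f (t : R) : bm f -> (\forall x \ae P, 0 <= f x) -> 0 < t ->
  fine (P [set x | t < f x]) <= t^-1 * 'I[f].
Proof.
move=> bf f0 t0; have mA : measurable [set x | t < f x].
  rewrite -[X in measurable X]setTI.
  have -> : [set x | t < f x] = f @^-1` `]t, +oo[.
    by apply/seteqP; split => x /=; rewrite in_itv /= andbT.
  by apply: bf.1.
rewrite -int_indic // -intZ //; apply: le_int_ae; bmt.
apply: filterS f0 => x fx.
rewrite indicE; case: (boolP (x \in _)) => [|_] /=.
  by rewrite inE /= => tf; rewrite ler_pdivlMl // mulr1 ltW.
by rewrite mulr_ge0 // invr_ge0 ltW.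
Qed.

End bounded_integral.

Section countable_ae.
Context d (T : measurableType d) (R : realType) (P : probability T R).

Lemma ae_forall_count (C : countType) (Q : C -> T -> Prop) :
  (forall t, \forall y \ae P, Q t y) -> \forall y \ae P, forall t, Q t y.
Proof.
move=> h; have : \forall y \ae P, forall n : nat,
    if unpickle n is Some t then Q t y else True.
  by apply: ae_foralln => n; case: unpickle => [t|]; [exact: h | exact: nearW].
by apply: filterS => y hy t; have := hy (pickle t); rewrite pickleK.
Qed.

(** Induction along the list unites only finitely many null sets, whatever the index type. *)
Lemma ae_forall_in (I : Type) (s : seq I) (Q : I -> T -> Prop) :
  (forall t, \forall y \ae P, Q t y) ->
  \forall y \ae P, forall t, List.In t s -> Q t y.
Proof.
move=> h; elim: s => [|t s IH]; first exact: nearW.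
by apply: filterS2 (h t) IH => y ht hs t' [<-|/hs].
Qed.

End countable_ae.

(** * Almost everywhere convergence *)

Section bounded_convergence.
Context d (T : measurableType d) (R : realType) (P : probability T R).

(** By Cauchy-Schwarz the increments are at most [|K| * 2^-n] in L^1, so the sum of their absolute
    values is integrable, hence finite almost everywhere. *)
Lemma ae_cvg_of_summable_increments (u : nat -> T -> R) (K : R) :
  (forall n, bm (u n)) ->
  (forall n, Rintegral P setT (fun x => (u n.+1 x - u n x) ^+ 2) <=
     K ^+ 2 * (4^-1) ^+ n) ->
  \forall x \ae P, cvgn (u ^~ x).
Proof.
move=> bu du; pose e n x : R := `|u n.+1 x - u n x|.
have be n : bm (e n) by rewrite /e; bmt; apply: bu.
have Ie n : Rintegral P setT (e n) <= `|K| * (2^-1) ^+ n.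
  rewrite -(@ler_pXn2r _ 2) ?nnegrE ?mulr_ge0 ?exprn_ge0 //; last first.
    by apply: int_ge0 => x; exact: normr_ge0.
  apply: le_trans (sqr_int_le P (be n)) _.
  rewrite (_ : (`|K| * _) ^+ 2 = K ^+ 2 * (4^-1) ^+ n); last first.
    rewrite exprMn real_normK ?num_real // exprAC; congr (_ * _ ^+ n).
    by rewrite expr2; field.
  apply: le_trans (du n); rewrite le_eqVlt; apply/orP; left; apply/eqP.
  by apply: eq_Rintegral => x _; rewrite /e real_normK ?num_real.
pose s x : \bar R := (\sum_(n <oo) (e n x)%:E)%E.
have ms : measurable_fun setT s.
  apply: (@ge0_emeasurable_sum _ _ _ _ (fun n x => (e n x)%:E) xpredT) => //.
  - by move=> n x _ _; rewrite lee_fin normr_ge0.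
  - by move=> n _; apply/measurable_EFinP; case: (be n).
have s0 x : (0 <= s x)%E by apply: nneseries_ge0 => n _ _; rewrite lee_fin normr_ge0.
have is_ : P.-integrable setT s.
  apply/integrableP; split => //.
  rewrite (eq_integral s); last by move=> x _; rewrite gee0_abs.
  rewrite integral_nneseries //; last 2 first.
  - by move=> n; apply/measurable_EFinP; case: (be n).
  - by move=> n x _; rewrite lee_fin normr_ge0.
  apply: (@le_lt_trans _ _ (\sum_(n <oo) (`|K| * (2^-1) ^+ n)%:E)%E).
    apply: lee_nneseries => [n _ _|n _]; first by apply: integral_ge0 => x _; rewrite lee_fin normr_ge0.
    have -> : (\int[P]_x (e n x)%:E)%E = (Rintegral P setT (e n))%:E.
      by rewrite fineK //; exact: integrable_fin_num (bm_integrable P (be n)).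
    by rewrite lee_fin.
  have h : @series R (fun n => `|K| * (2^-1) ^+ n) @ \oo --> `|K| * 2.
    have -> : `|K| * 2 = `|K| / (1 - 2^-1) by congr (_ * _); field.
    apply: cvg_geometric_series; rewrite ger0_norm; lra.
  have -> : (\sum_(n <oo) (`|K| * (2^-1) ^+ n)%:E = (`|K| * 2)%:E)%E.
    apply/cvg_lim => //.
    rewrite (_ : (fun n => _) = EFin \o series (fun n => `|K| * 2^-1 ^+ n)).
      by apply: cvg_EFin => //; exact: nearW.
    by apply/funext => n /=; rewrite /series /= -sumEFin.
  exact: ltry.
have := integrable_ae measurableT is_.
apply: filterS => x /(_ I) sx.
have : cvgn (series (telescope (u ^~ x))).
  apply: normed_cvg; apply: nondecreasing_is_cvgn.
    by apply: nondecreasing_series => n _ _; exact: normr_ge0.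
  exists (fine (s x)) => _ [n _ <-].
  rewrite -lee_fin fineK // /series /= -sumEFin /s.
  by apply: nneseries_lim_ge => k _ _; rewrite lee_fin normr_ge0.
rewrite telescopeK => cx.
have -> : u ^~ x = (fun n => [sequence u n x - u 0%N x]_n n + u 0%N x).
  by apply/funext => n /=; rewrite subrK.
apply: is_cvgD => //; exact: is_cvg_cst.
Qed.

(** The limit is the limsup cut at [- M] and [M]: this leaves it alone wherever the sequence
    converges and makes the bound hold everywhere. *)
Lemma bounded_limit (u : nat -> T -> R) (M : R) :
  (forall n, bm (u n)) -> (forall n x, `|u n x| <= M) ->
  (\forall x \ae P, cvgn (u ^~ x)) ->
  exists F, [/\ bm F, forall x, `|F x| <= M &
    \forall x \ae P, u ^~ x @ \oo --> F x].
Proof.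
move=> bu uM cu; pose F x : R := limn_sup (u ^~ x).
have mF : measurable_fun setT F.
  apply: measurable_fun_limn_sup.
  - by move=> x _; exists M => _ [n _ <-]; apply: le_trans (ler_norm _) (uM n x).
  - move=> x _; exists (- M) => _ [n _ <-].
    by have := uM n x; rewrite ler_norml => /andP[].
  - by move=> n; case: (bu n).
have M0 (x : T) : 0 <= M := le_trans (normr_ge0 _) (uM 0%N x).
pose G x : R := Num.max (- M) (Num.min M (F x)).
have GM x : `|G x| <= M.
  rewrite ler_norml /G le_max lexx /= ge_max ge_min lexx /= andbT.
  by rewrite (le_trans _ (M0 x)) // oppr_le0 (M0 x).
have mG : measurable_fun setT G.
  apply: measurable_maxr; first exact: measurable_cst.
  by apply: measurable_minr => //; exact: measurable_cst.
exists G; split => //; first by split => //; exists M.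
apply: filterS cu => x cx; have xF : u ^~ x @ \oo --> F x.
  by rewrite /F (cvg_limn_supE cx).
have FM : F x <= M.
  rewrite /F (cvg_limn_supE cx); apply: limr_le => //; apply: nearW => n.
  exact: le_trans (ler_norm _) (uM n x).
have MF : - M <= F x.
  rewrite /F (cvg_limn_supE cx); apply: limr_ge => //; apply: nearW => n.
  by have := uM n x; rewrite ler_norml => /andP[].
by rewrite (_ : G x = F x) // /G min_r ?max_r.
Qed.

End bounded_convergence.

(** * Iterates of an invertible measure-preserving map *)

Section iterates.
Context (R : realType) (X : mpsystem R).
Local Notation mu := (mps_mu X).

Lemma mps_iterS (n : int) (x : X) : mps_iter (n + 1) x = mps_map (mps_iter n x).
Proof.
case: n => [n|[|n]]; first by rewrite -PoszD addn1.
  by rewrite (_ : Negz 0 + 1 = 0) //= mps_invK.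
rewrite (_ : Negz n.+1 + 1 = Negz n); last by rewrite !NegzE -addn1 PoszD; ring.
by rewrite [mps_iter (Negz n.+1) x]/= mps_invK.
Qed.

Lemma mps_iterN1 (n : int) (x : X) : mps_iter (n - 1) x = mps_inv (mps_iter n x).
Proof. by rewrite -[n in RHS](subrK 1) mps_iterS mps_mapK. Qed.

Lemma mps_iterD (m n : int) (x : X) :
  mps_iter (m + n) x = mps_iter m (mps_iter n x).
Proof.
elim: m => [|m IH|m IH]; first by rewrite add0r.
  by rewrite -addn1 PoszD addrAC mps_iterS IH mps_iterS.
rewrite -addn1 PoszD opprD addrAC mps_iterN1 IH.
by rewrite mps_iterN1.
Qed.

Lemma mps_iter_measurable (n : int) : measurable_fun setT (@mps_iter R X n).
Proof.
elim: n => [|n IH|n IH]; first exact: measurable_id.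
  rewrite (_ : mps_iter _ = @mps_map R X \o mps_iter n).
    exact: measurableT_comp (@mps_map_measurable R X) IH.
  by apply/funext => x; rewrite -addn1 PoszD mps_iterS.
rewrite (_ : mps_iter _ = @mps_inv R X \o mps_iter (- n%:Z)).
  exact: measurableT_comp (@mps_inv_measurable R X) IH.
by apply/funext => x; rewrite -addn1 PoszD opprD mps_iterN1.
Qed.

Lemma mps_iter_preimage_measurable (n : int) (A : set X) : measurable A ->
  measurable (@mps_iter R X n @^-1` A).
Proof. by move=> mA; rewrite -[X in measurable X]setTI; exact: mps_iter_measurable. Qed.

Lemma mps_iter_preserving (n : int) (A : set X) : measurable A ->
  mu (mps_iter n @^-1` A) = mu A.
Proof.
have inv B : measurable B -> mu (@mps_inv R X @^-1` B) = mu B.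
  move=> mB; have mB' : measurable (@mps_inv R X @^-1` B).
    by rewrite -[X in measurable X]setTI; exact: mps_inv_measurable.
  rewrite -(mps_preserving mB'); congr (mu _).
  by apply/seteqP; split => x /=; rewrite mps_mapK.
elim: n A => [|n IH|n IH] A mA; first by [].
  rewrite -[RHS](mps_preserving mA).
  rewrite -(IH (@mps_map R X @^-1` A)); last first.
    by rewrite -[X in measurable X]setTI; exact: mps_map_measurable.
  congr (mu _); apply/seteqP; split => x /=; rewrite -addn1 PoszD mps_iterS //.
rewrite -[RHS](inv A mA) -(IH (@mps_inv R X @^-1` A)); last first.
  by rewrite -[X in measurable X]setTI; exact: mps_inv_measurable.
congr (mu _).
apply/seteqP; split => x; rewrite /preimage /mkset -addn1 PoszD opprD mps_iterN1 //.
Qed.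

Lemma ae_iter (n : int) (Q : X -> Prop) :
  (\forall x \ae mu, Q x) -> \forall x \ae mu, Q (mps_iter n x).
Proof.
case=> N [mN N0 NQ]; exists (mps_iter n @^-1` N); split.
- exact: mps_iter_preimage_measurable.
- by rewrite /= mps_iter_preserving.
- by move=> x /= nQ; apply: NQ.
Qed.

Lemma bm_iter (n : int) (f : X -> R) : bm f -> bm (fun x => f (mps_iter n x)).
Proof. exact/bm_comp/mps_iter_measurable. Qed.

Lemma int_iter (n : int) (f : X -> R) : bm f ->
  Rintegral mu setT (fun x => f (mps_iter n x)) = Rintegral mu setT f.
Proof.
move=> bf; rewrite /Rintegral; congr fine.
have := @integral_pushforward _ _ _ _ R (@mps_iter R X n) (mps_iter_measurable n)
  mu setT (EFin \o f).
rewrite preimage_setT => <- //; last 2 first.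
- by apply/measurable_EFinP; case: bf.
- exact: bm_integrable (bm_iter n bf).
apply: eq_measure_integral => /= [|_ A mA _]; first exact: mps_iter_measurable.
exact: (mps_iter_preserving n mA).
Qed.

End iterates.

(** * The Schur product theorem *)

Section schur_product.
Context (R : realType).
Implicit Types (M N : nat -> nat -> R) (c : nat -> R).

(** Only the entries with indices below [d] count, so one infinite matrix serves all sizes in an
    induction on [d]. *)
Definition psd (d : nat) M : Prop :=
  forall c, 0 <= \sum_(i < d) \sum_(j < d) c i * c j * M i j.

Lemma psd_recr d M c : (forall i j, M i j = M j i) ->
  \sum_(i < d.+1) \sum_(j < d.+1) c i * c j * M i j =
  \sum_(i < d) \sum_(j < d) c i * c j * M i j +
  2 * c d * (\sum_(i < d) c i * M i d) + c d ^+ 2 * M d d.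
Proof.
move=> sM; rewrite big_ord_recr /=.
under eq_bigr do rewrite big_ord_recr /=.
rewrite big_split /= big_ord_recr /=.
rewrite (_ : \sum_(i < d) c i * c d * M i d = c d * \sum_(i < d) c i * M i d);
  last by rewrite big_distrr; apply: eq_bigr => i _ /=; ring.
rewrite (_ : \sum_(i < d) c d * c i * M d i = c d * \sum_(i < d) c i * M i d);
  last by rewrite big_distrr; apply: eq_bigr => i _ /=; rewrite (sM d); ring.
ring.
Qed.

Lemma psdW d M : (forall i j, M i j = M j i) -> psd d.+1 M -> psd d M.
Proof.
move=> sM pM c; pose e i : R := if i == d then 0 else c i; have := pM e.
rewrite psd_recr // /e /= eqxx expr2 !(mulr0, mul0r, addr0).
congr (_ <= _); apply: eq_bigr => i _; apply: eq_bigr => j _.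
by rewrite !ltn_eqF.
Qed.

(** At [t = - (a + 1) / b] the affine function would equal -1. *)
Lemma linear_ge0_eq0 (a b : R) : (forall t, 0 <= a + t * b) -> b = 0.
Proof.
move=> h; apply/eqP; apply: contraT => b0.
by have := h (- (a + 1) / b); rewrite divfK //; lra.
Qed.

Lemma sum_delta d i (F : nat -> R) : (i < d)%N ->
  \sum_(k < d) (k == i :> nat)%:R * F k = F i.
Proof.
move=> lid; rewrite (bigD1 (Ordinal lid)) //= eqxx mul1r big1 ?addr0 // => k ki.
by rewrite (_ : (k == i :> nat) = false) ?mul0r //; exact: negbTE.
Qed.

(** The vector with entry 1 at [i] and [t / 2] at [d] gives [M i i + t * M i d >= 0] for every
    [t]. *)
Lemma psd_last_eq0 d M : (forall i j, M i j = M j i) -> psd d.+1 M ->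
  M d d = 0 -> forall i, (i < d)%N -> M i d = 0.
Proof.
move=> sM pM Mdd i lid; apply: (@linear_ge0_eq0 (M i i)) => t.
pose e j : R := if j == d then t / 2 else (j == i)%:R; have := pM e.
have eE (k : 'I_d) : e k = (k == i :> nat)%:R by rewrite /e ltn_eqF.
rewrite psd_recr // Mdd mulr0 addr0 {3}/e eqxx.
under eq_bigr => k _.
  under eq_bigr => j _ do rewrite !eE -mulrA.
  rewrite -mulr_sumr (sum_delta (M k) lid); over.
rewrite (sum_delta (M^~ i) lid).
under eq_bigr do rewrite eE.
by rewrite (sum_delta (M^~ d) lid) mulrCA divff ?pnatr_eq0 // mulr1.
Qed.

(* Induction on [d], splitting off the Schur complement of the last diagonal
   entry: the removed rank-one part only rescales the weights of [N]. *)
Lemma schur_product d M N : (forall i j, M i j = M j i) ->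
  (forall i j, N i j = N j i) -> psd d M -> psd d N ->
  psd d (fun i j => M i j * N i j).
Proof.
move=> + sN; elim: d M => [|d IH] M sM pM pN c; first by rewrite big_ord0.
have sMN i j : M i j * N i j = M j i * N j i by rewrite sM sN.
have pN' := psdW sN pN.
have Mdd_ge0 : 0 <= M d d.
  pose e i : R := (i == d)%:R; have := pM e; rewrite psd_recr // /e /= eqxx.
  rewrite !big1; first by rewrite mulr0 !add0r expr1n mul1r.
    by move=> i _; rewrite ltn_eqF // mul0r.
  by move=> i _; rewrite big1 // => j _; rewrite ltn_eqF // !mul0r.
case: (eqVneq (M d d) 0) => [Mdd|Mdd].
  rewrite (psd_recr d c sMN) Mdd mul0r mulr0 addr0.
  rewrite [X in _ + _ * X]big1; last first.
    by move=> i _; rewrite psd_last_eq0 // mul0r mulr0.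
  by rewrite mulr0 addr0; apply: IH => //; exact: psdW.
pose M' i j := M i j - M i d * M j d / M d d.
have pM' : psd d M'.
  move=> e; pose s := \sum_(i < d) e i * M i d.
  (* Completing the square: among all extensions of [e], this last entry minimises the form of [M],
     and the minimum is the form of [M'] at [e]. *)
  pose e' i : R := if i == d then - s / M d d else e i; have := pM e'.
  rewrite psd_recr // /e' /= eqxx.
  rewrite (_ : \sum_(i < d) _ * M i d = s); last first.
    by apply: eq_bigr => i _; rewrite ltn_eqF.
  rewrite (_ : \sum_(i < d) \sum_(j < d) e i * e j * M' i j =
     \sum_(i < d) \sum_(j < d) e i * e j * M i j - s ^+ 2 / M d d).
    set S := (X in X + _ + _); set S' := (X in _ -> _ <= X - _).
    rewrite (_ : S = S'); last first.
      by apply: eq_bigr => i _; apply: eq_bigr => j _; rewrite !ltn_eqF.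
    by congr (_ <= _); field.
  rewrite expr2 /s mulr_suml mulr_suml -sumrB; apply: eq_bigr => i _.
  rewrite mulr_sumr mulr_suml -sumrB; apply: eq_bigr => j _.
  by rewrite /M'; field.
have -> : \sum_(i < d.+1) \sum_(j < d.+1) c i * c j * (M i j * N i j) =
    \sum_(i < d) \sum_(j < d) c i * c j * (M' i j * N i j) +
    \sum_(i < d.+1) \sum_(j < d.+1) (c i * M i d) * (c j * M j d) * N i j / M d d.
  rewrite [X in _ = X + _](_ : _ = \sum_(i < d.+1) \sum_(j < d.+1) c i * c j *
     (M' i j * N i j)); last first.
    rewrite (@psd_recr d (fun i j => M' i j * N i j) c); last first.
      by move=> i j; rewrite sN /M' sM; ring.
    rewrite (_ : M' d d = 0); last by rewrite /M'; field.
    rewrite mul0r mulr0 addr0 [X in _ + _ * X]big1 ?mulr0 ?addr0 //.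
    by move=> i _; rewrite (_ : M' i d = 0) ?mul0r ?mulr0 // /M'; field.
  rewrite -big_split; apply: eq_bigr => i _; rewrite -big_split.
  by apply: eq_bigr => j _; rewrite /M' /=; field.
apply: addr_ge0.
  by apply: IH => // i j; rewrite /M' sM; ring.
under eq_bigr do rewrite -mulr_suml.
rewrite -mulr_suml divr_ge0 //.
exact: (pN (fun i => c i * M i d)).
Qed.

Lemma floor_approx (x : R) :
  (fun n : nat => (Num.floor (n.+1%:R * x))%:~R / n.+1%:R : R) @ \oo --> x.
Proof.
apply/cvgrPdist_le => /= e e0; near=> n.
have n0 : 0 < n.+1%:R :> R by rewrite ltr0n.
have /andP[h1 h2] : (Num.floor (n.+1%:R * x))%:~R <= n.+1%:R * x <
    (Num.floor (n.+1%:R * x))%:~R + 1.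
  by have := floor_itv (n.+1%:R * x); rewrite intrD.
set z : R := _%:~R in h1 h2 *.
have h3 : n.+1%:R^-1 <= e.
  by apply: ltW; near: n; exact: (near_infty_natSinv_lt (PosNum e0)).
rewrite (_ : x - z / n.+1%:R = (n.+1%:R * x - z) * n.+1%:R^-1); last by field; lra.
have n1 : 0 < n.+1%:R^-1 :> R by rewrite invr_gt0.
rewrite normrM (ger0_norm (ltW n1)) ger0_norm ?subr_ge0 //.
by apply: le_trans h3; rewrite -[leRHS]mul1r ler_pM2r //; lra.
Unshelve. all: by end_near. Qed.

Lemma cvg_sum_ord d (f : nat -> nat -> R) (l : nat -> R) :
  (forall i, f i @ \oo --> l i) ->
  (fun n => \sum_(i < d) f i n) @ \oo --> \sum_(i < d) l i.
Proof.
move=> fl; elim: d => [|d IH].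
  under eq_fun do rewrite big_ord0.
  by rewrite big_ord0; exact: cvg_cst.
under eq_fun do rewrite big_ord_recr.
by rewrite big_ord_recr; exact: cvgD.
Qed.

(** A real vector is a limit of integer vectors divided by [n + 1]. Integer vectors are countable,
    which is what lets positivity of conditional Gram matrices hold outside a single null set. *)
Lemma psd_int d M :
  (forall z : nat -> int,
     0 <= \sum_(i < d) \sum_(j < d) (z i)%:~R * (z j)%:~R * M i j) ->
  psd d M.
Proof.
move=> h c; pose a (n i : nat) : R := (Num.floor (n.+1%:R * c i))%:~R / n.+1%:R.
have lim : (fun n => \sum_(i < d) \sum_(j < d) a n i * a n j * M i j) @ \oo -->
    \sum_(i < d) \sum_(j < d) c i * c j * M i j.
  apply: (@cvg_sum_ord d (fun i n => \sum_(j < d) a n i * a n j * M i j)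
    (fun i => \sum_(j < d) c i * c j * M i j)) => i.
  apply: (@cvg_sum_ord d (fun j n => a n i * a n j * M i j)
    (fun j => c i * c j * M i j)) => j.
  by apply: cvgM; [apply: cvgM; exact: floor_approx | exact: cvg_cst].
rewrite -(cvg_lim _ lim) //; apply: limr_ge.
  apply/cvg_ex; exists (\sum_(i < d) \sum_(j < d) c i * c j * M i j).
  exact: lim.
apply: nearW => n; have n0 : 0 < n.+1%:R :> R by rewrite ltr0n.
rewrite (_ : \sum_(i < d) _ = (\sum_(i < d) \sum_(j < d)
   (Num.floor (n.+1%:R * c i))%:~R * (Num.floor (n.+1%:R * c j))%:~R * M i j)
   / n.+1%:R ^+ 2).
  rewrite divr_ge0 ?sqr_ge0 //.
  exact: (h (fun i => Num.floor (n.+1%:R * c i))).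
rewrite mulr_suml; apply: eq_bigr => i _; rewrite mulr_suml.
by apply: eq_bigr => j _; rewrite /a; field; lra.
Qed.

End schur_product.

(** * Densities of functionals bounded in the L^1 norm *)

Import HBNNSimple.

Section functional_charge.
Context d (T : measurableType d) (R : realType) (P : probability T R).
Context (L : (T -> R) -> R) (M : R).
Context (Llin : forall a f g, bm f -> bm g ->
  L (fun x => a * f x + g x) = a * L f + L g).
Context (Lbound : forall f, bm f -> `|L f| <= M * Rintegral P setT (fun x => `|f x|)).

Lemma functional_eq0 f : bm f -> (\forall x \ae P, f x = 0) -> L f = 0.
Proof.
move=> bf f0; apply/eqP; rewrite -normr_le0; apply: le_trans (Lbound bf) _.
rewrite (_ : Rintegral _ _ _ = 0) ?mulr0 // -(int_cst P 0).
by apply: int_ae_eq; bmt; apply: filterS f0 => x ->; rewrite normr0.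
Qed.

Lemma functional0 : L (fun=> 0) = 0.
Proof. by apply: functional_eq0; [exact: bm_cst | exact: nearW]. Qed.

Lemma functionalD f g : bm f -> bm g -> L (fun x => f x + g x) = L f + L g.
Proof.
move=> bf bg; rewrite -[in RHS](mul1r (L f)) -Llin //.
by congr L; apply/funext => x; rewrite mul1r.
Qed.

Lemma functionalZ a f : bm f -> L (fun x => a * f x) = a * L f.
Proof.
move=> bf; rewrite -[RHS]addr0 -functional0 -Llin //; last exact: bm_cst.
by congr L; apply/funext => x; rewrite addr0.
Qed.

Lemma functionalB f g : bm f -> bm g -> L (fun x => f x - g x) = L f - L g.
Proof.
move=> bf bg; rewrite functionalD //; last bmt.
by congr (_ + _); rewrite -mulN1r -functionalZ //; congr L; apply/funext => x;
  rewrite mulN1r.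
Qed.

Lemma functional_sum (n : nat) (F : nat -> T -> R) : (forall i, bm (F i)) ->
  L (fun x => \sum_(i < n) F i x) = \sum_(i < n) L (F i).
Proof.
move=> bF; elim: n => [|n IH].
  rewrite big_ord0 (_ : (fun x => _) = fun=> 0) ?functional0 //.
  by apply/funext => x; rewrite big_ord0.
rewrite big_ord_recr /= -IH -functionalD //; last exact: bm_sum.
by congr L; apply/funext => x; rewrite big_ord_recr.
Qed.

Lemma functional_cvg (u : nat -> T -> R) f K : (forall n, bm (u n)) -> bm f ->
  (forall n x, `|u n x| <= K) -> (\forall x \ae P, u ^~ x @ \oo --> f x) ->
  (fun n => L (u n)) @ \oo --> L f.
Proof.
move=> bu bf uK uf.
have h : (fun n => M * Rintegral P setT (fun x => `|u n x - f x|)) @ \oo --> (0 : R).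
  rewrite -[X in _ --> X](mulr0 M); apply: cvgM; first exact: cvg_cst.
  rewrite -(int_cst P 0); case: (bf) => _ [K' fK'].
  apply: (@int_dominated _ _ _ _ _ _ (K + K')).
  - by move=> n; bmt; apply: bu.
  - exact: bm_cst.
  - move=> n x; rewrite normr_id; apply: le_trans (ler_normB _ _) _.
    by rewrite lerD.
  - apply: filterS uf => x ux; rewrite -(normr0 R) -(subrr (f x)).
    by apply: cvg_norm; apply: cvgB => //; exact: cvg_cst.
apply/cvgrPdist_le => e e0; move/cvgr0Pnorm_le: h => /(_ e e0).
apply: filterS => n; apply: le_trans; rewrite distrC -functionalB //.
apply: le_trans (Lbound _) _; first by bmt; apply: bu.
exact: ler_norm.
Qed.

Definition functional_charge (A : set T) : \bar R := (L \1_A)%:E.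

Let charge0 : functional_charge set0 = 0%E.
Proof. by rewrite /functional_charge indic0 functional0. Qed.

Let charge_fin A : measurable A -> functional_charge A \is a fin_num.
Proof. by []. Qed.

Let charge_sigma_additive : semi_sigma_additive functional_charge.
Proof.
move=> F mF tF mU; rewrite /functional_charge.
under eq_fun do rewrite sumEFin.
apply: cvg_EFin; first exact: nearW.
rewrite (_ : _ \o _ = (fun n => L (fun x => \sum_(i < n) \1_(F i) x))); last first.
  apply/funext => n /=; rewrite (functional_sum n (F := fun i => \1_(F i))).
    by rewrite big_mkord.
  by move=> i; exact: bm_indic.
have sumE n x : \sum_(i < n) (\1_(F i) x : R) = \1_(\big[setU/set0]_(i < n) F i) x.
  rewrite -bigcup_mkord indicE.
  case: (boolP (x \in _)) => [|xF]; rewrite ?inE /=.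
    move=> [i /= lin Fx]; rewrite (bigD1 (Ordinal lin)) //= indicE mem_set //.
    rewrite big1 ?addr0 // => j /eqP ji; rewrite indicE memNset // => Fjx.
    by apply: ji; apply: val_inj => /=; apply: (tF j i) => //; exists x.
  rewrite big1 // => i _; rewrite indicE memNset // => Fx.
  by move: xF; rewrite notin_setE; apply; exists i => //=.
apply: (@functional_cvg _ _ 1).
- by move=> n; apply: bm_sum => i; exact: bm_indic.
- exact: bm_indic.
- by move=> n x; rewrite sumE indicE; case: (_ \in _); rewrite ?normr1 ?normr0.
- apply: nearW => x; apply: cvg_near_cst.
  rewrite indicE; case: (boolP (x \in _)) => [|xF]; rewrite ?inE /=.
    move=> [i _ Fx]; near=> n; rewrite sumE indicE mem_set //.
    rewrite -bigcup_mkord; exists i => //=; near: n; exact: nbhs_infty_gt.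
  apply: nearW => n; rewrite sumE indicE memNset // -bigcup_mkord => -[i _ Fx].
  by move: xF; rewrite notin_setE; apply; exists i.
Unshelve. all: by end_near. Qed.

HB.instance Definition _ := isCharge.Build _ _ _ functional_charge
  charge0 charge_fin charge_sigma_additive.

Lemma functional_charge_dominated : functional_charge `<< P.
Proof.
apply/null_content_dominatesP => A mA PA; rewrite /functional_charge.
rewrite functional_eq0 //; first exact: bm_indic.
exists A; split => // x /= h; apply: contrapT => Ax; apply: h.
by rewrite indicE memNset.
Qed.

(** Radon-Nikodym for the charge [functional_charge]. The formula passes from indicators to simple
    functions, to nonnegative bounded functions by monotone approximation and [functional_cvg], and
    to all of them by adding a constant. *)
Lemma functional_density : exists g : T -> R,
  [/\ bm g, forall x, `|g x| <= M &
      forall c, bm c -> L c = Rintegral P setT (fun x => c x * g x)].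
Proof.
have dom := functional_charge_dominated.
pose g0 : T -> R := fine \o (Radon_Nikodym functional_charge P).
have g0E x : (Radon_Nikodym functional_charge P) x = (g0 x)%:E.
  by rewrite fineK //; exact: Radon_Nikodym_fin_num.
have ig0 : P.-integrable setT (EFin \o g0).
  apply: eq_integrable (Radon_Nikodym_integrable dom) => //.
have mg0 : measurable_fun setT g0 by apply/measurable_EFinP; exact: measurable_int ig0.
have LE A : measurable A -> (L \1_A)%:E = (\int[P]_(x in A) (g0 x)%:E)%E.
  move=> mA; have := Radon_Nikodym_integral dom mA.
  rewrite /= /functional_charge => ->; apply: eq_integral => x _; exact: g0E.
have M0 : 0 <= M.
  have := Lbound (bm_cst T 1); rewrite normr1 int_cst mulr1.
  exact: le_trans.
have LA A K : measurable A -> (forall x, A x -> `|g0 x| <= K) ->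
    bm (fun x => \1_A x * g0 x) /\
    L \1_A = Rintegral P setT (fun x => \1_A x * g0 x).
  move=> mA AK; split.
    split; first by apply: measurable_funM => //; exact: measurable_indic.
    exists `|K| => x; rewrite indicE.
    case: (boolP (x \in A)) => [|_]; rewrite ?inE /=.
      by move=> /AK h; rewrite mul1r (le_trans h) // ler_norm.
    by rewrite mul0r normr0.
  apply: (@EFin_inj R); rewrite LE // /Rintegral.
  rewrite [LHS]integral_mkcond fineK; last first.
    apply: (integrable_fin_num measurableT).
    apply: (@le_integrable _ _ _ P setT measurableT _ (EFin \o g0)) => //.
      by apply/measurable_EFinP; apply: measurable_funM => //; exact: measurable_indic.
    move=> x _ /=; rewrite lee_fin indicE normrM.
    by case: (_ \in _); rewrite ?normr1 ?normr0 ?mul1r ?mul0r.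
  apply: eq_integral => x _; rewrite patchE indicE.
  by case: (_ \in _); rewrite ?mul1r ?mul0r.
(* The density is only known to be integrable, so [g0 <= M] and [- g0 <= M] are tested on sets where
   [|g0| <= k], on which everything is bounded; [k] then runs through the naturals. *)
have side (s : R) : (s = 1 \/ s = -1) ->
    forall k : nat, \forall x \ae P, s * g0 x <= M \/ k%:R < `|g0 x|.
  move=> s1 k; have s2 : s * s = 1 by case: s1 => ->; rewrite ?mulrNN mul1r.
  pose A := [set x | M < s * g0 x] `&` [set x | `|g0 x| <= k%:R].
  have mA : measurable A.
    apply: measurableI; rewrite -[X in measurable X]setTI.
      have -> : [set x | M < s * g0 x] = (fun x => s * g0 x) @^-1` `]M, +oo[.
        by apply/seteqP; split => x /=; rewrite in_itv /= andbT.
      have m : measurable_fun setT (fun x => s * g0 x).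
        by apply: measurable_funM => //; exact: measurable_cst.
      exact: m.
    have -> : [set x | `|g0 x| <= k%:R] = (fun x => `|g0 x|) @^-1` `]-oo, k%:R].
      by apply/seteqP; split => x /=; rewrite in_itv.
    have m : measurable_fun setT (fun x => `|g0 x|) by exact: measurableT_comp.
    exact: m.
  have [bA LAE] : _ := LA A k%:R mA (fun x => @proj2 _ _).
  have b1A : bm (\1_A : T -> R) by exact: bm_indic.
  have : \forall x \ae P, s * (\1_A x * g0 x) - M * \1_A x = 0.
    apply: int_eq0; first by bmt.
      apply: nearW => x; rewrite indicE.
      case: (boolP (x \in A)) => [|_]; rewrite ?inE /=; last by rewrite !(mul0r, mulr0) subrr.
      by move=> [h _]; rewrite mul1r mulr1 subr_ge0 ltW.
    apply/eqP; rewrite eq_le; apply/andP; split; last first.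
      apply: int_ge0 => x; rewrite indicE.
      case: (boolP (x \in A)) => [|_]; rewrite ?inE /=; last by rewrite !(mul0r, mulr0) subrr.
      by move=> [h _]; rewrite mul1r mulr1 subr_ge0 ltW.
    rewrite intB ?intZ; bmt; rewrite -LAE subr_le0.
    apply: le_trans (ler_norm _) _; rewrite normrM (_ : `|s| = 1) ?mul1r; last first.
      by case: s1 => ->; rewrite ?normrN normr1.
    apply: le_trans (Lbound b1A) _; rewrite le_eqVlt; apply/orP; left; apply/eqP.
    congr (_ * _); apply: eq_Rintegral => x _.
    by rewrite indicE; case: (_ \in _); rewrite ?normr1 ?normr0.
  apply: filterS => x; rewrite indicE; case: (boolP (x \in A)) => [|xA _]; rewrite ?inE /=.
    by move=> [h _]; rewrite mul1r mulr1 => h'; left; rewrite -subr_le0 h'.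
  move: xA; rewrite notin_setE => xA; have [h|h] := leP (s * g0 x) M; first by left.
  by right; rewrite ltNge; apply/negP => h'; apply: xA.
have g0M : \forall x \ae P, `|g0 x| <= M.
  have : \forall x \ae P, forall k : nat,
      (1 * g0 x <= M \/ k%:R < `|g0 x|) /\ (-1 * g0 x <= M \/ k%:R < `|g0 x|).
    apply: ae_foralln => k.
    by apply: filterS2 (side 1 (or_introl erefl) k) (side (-1) (or_intror erefl) k).
  apply: filterS => x /(_ (Num.truncn `|g0 x|).+1) [].
  have h := truncnS_gt `|g0 x|.
  rewrite mul1r mulN1r => -[h1|/lt_trans /(_ h)]; last by rewrite ltxx.
  move=> [h2|/lt_trans /(_ h)]; last by rewrite ltxx.
  by rewrite ler_norml h1 lerNl h2.
pose g x : R := Num.max (- M) (Num.min M (g0 x)).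
have gM x : `|g x| <= M.
  rewrite ler_norml /g le_max lexx /= ge_max ge_min lexx /= andbT.
  by rewrite (le_trans _ M0) // oppr_le0.
have mg : measurable_fun setT g.
  apply: measurable_maxr; first exact: measurable_cst.
  by apply: measurable_minr => //; exact: measurable_cst.
have bg : bm g by split => //; exists M.
have gE : \forall x \ae P, g0 x = g x.
  apply: filterS g0M => x; rewrite ler_norml => /andP[h1 h2].
  by rewrite /g min_r ?max_r.
have L1 A : measurable A -> L \1_A = Rintegral P setT (fun x => \1_A x * g x).
  move=> mA; apply: (@EFin_inj R); rewrite LE // /Rintegral fineK; last first.
    apply: (integrable_fin_num measurableT).
    by apply: (@bm_integrable _ _ _ P (fun x => \1_A x * g x)); bmt.
  rewrite [LHS]integral_mkcond; apply: ae_eq_integral => //.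
  - by apply/(measurable_restrictT _ _).1 => //; apply/measurable_EFinP/measurable_funTS.
  - apply/measurable_EFinP; apply: measurable_funM => //; exact: measurable_indic.
  apply: filterS gE => x h _; rewrite patchE indicE h.
  by case: (_ \in _); rewrite ?mul1r ?mul0r.
have Lpos c : bm c -> (forall x, 0 <= c x) ->
    L c = Rintegral P setT (fun x => c x * g x).
  move=> bc c0; case: (bc) => mc [K cK].
  have mc' : measurable_fun setT (EFin \o c) by exact/measurable_EFinP.
  pose u n : T -> R := nnsfun_approx measurableT mc' n.
  have uc x : u ^~ x @ \oo --> c x.
    apply: (@fine_cvg _ _ _ _ (fun n => (u n x)%:E)).
    by apply: (cvg_nnsfun_approx measurableT mc') => // y _; rewrite lee_fin.
  have u0 n x : 0 <= u n x by exact: fun_ge0.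
  have uK n x : `|u n x| <= K.
    rewrite ger0_norm // (le_trans _ (cK x)) // ger0_norm // -lee_fin.
    rewrite /u nnsfun_approxE; apply: le_approx => // y _; rewrite lee_fin //.
  have bu n : bm (u n) by split; [exact: measurable_funPT | exists K].
  have Lu n : L (u n) = Rintegral P setT (fun x => u n x * g x).
    rewrite /u; set f := nnsfun_approx _ _ n; pose s : seq R := finmap.enum_fset (fset_set (f @` setT)).
    have mpre a : measurable (f @^-1` [set a]) by [].
    have fE x : f x = \sum_(i < size s) (s`_i * \1_(f @^-1` [set s`_i]) x).
      exact: fimfunEord.
    have bi i : bm (fun x => s`_i * \1_(f @^-1` [set s`_i]) x : R).
      by bmt.
    transitivity (L (fun x => \sum_(i < size s) (s`_i * \1_(f @^-1` [set s`_i]) x))).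
      by congr L; apply/funext.
    rewrite (functional_sum _ (F := fun i x => s`_i * \1_(f @^-1` [set s`_i]) x)) //.
    transitivity (\sum_(i < size s) Rintegral P setT
       (fun x => s`_i * (\1_(f @^-1` [set s`_i]) x * g x))).
      apply: eq_bigr => i _; rewrite functionalZ; last exact: bm_indic.
      by rewrite L1 // intZ //; bmt.
    rewrite -(int_sum P (index_enum _) (F := fun i x => s`_(val i) *
       (\1_(f @^-1` [set s`_(val i)]) x * g x))); last first.
      by move=> i; bmt.
    apply: eq_Rintegral => x _; rewrite fE mulr_suml.
    by apply: eq_bigr => i _; rewrite mulrA.
  have h1 := functional_cvg bu bc uK (aeW _ uc).
  have h2 : (fun n => Rintegral P setT (fun x => u n x * g x)) @ \oo -->
      Rintegral P setT (fun x => c x * g x).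
    apply: (@int_dominated _ _ _ _ _ _ (K * M)).
    - by move=> n; bmt.
    - by bmt.
    - by move=> n x; rewrite normrM ler_pM.
    - by apply: nearW => x; apply: cvgM => //; exact: cvg_cst.
  have Lu' : (fun n => L (u n)) = fun n => Rintegral P setT (fun x => u n x * g x).
    by apply/funext.
  by rewrite Lu' in h1; rewrite -(cvg_lim _ h1) // -(cvg_lim _ h2).
exists g; split => // c bc; case: (bc) => mc [K cK].
have -> : L c = L (fun x => c x + K) - L (fun=> K).
  by rewrite -functionalB; bmt; congr L; apply/funext => x; rewrite addrK.
rewrite Lpos; last 2 first.
- by bmt.
- by move=> x; have := cK x; rewrite ler_norml => /andP[]; lra.
have K0 (x : T) : 0 <= K := le_trans (normr_ge0 _) (cK x).
rewrite (_ : L (fun=> K) = Rintegral P setT (fun x => K * g x)); last first.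
  apply: (Lpos (fun=> K)); [exact: bm_cst | by move=> x; exact: K0 x].
rewrite -intB; bmt; apply: eq_Rintegral => x _; ring.
Qed.

End functional_charge.

(** * Complex functions through their real and imaginary parts *)

Definition rc {T : Type} {R : realType} (f : T -> R) : T -> R[i] :=
  fun x => (f x)%:C%C.

Definition cbm {d} {T : measurableType d} {R : realType} (f : T -> R[i]) : Prop :=
  bm (fun x => complex.Re (f x)) /\ bm (fun x => complex.Im (f x)).

Section complex_functions.
Context (R : realType) (X : mpsystem R).
Local Notation mu := (mps_mu X).
Implicit Types (f g : X -> R[i]) (c : X -> R).

Lemma mps_inhabited : exists x : X, True.
Proof.
apply: contrapT => h; have : mu setT = 1%E by exact: probability_setT.
rewrite (_ : setT = set0) ?measure0; last first.
  by apply/seteqP; split => x //= _; apply: h; exists x.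
by move=> /eqP; rewrite eqe eq_sym oner_eq0.
Qed.

Lemma mps_mu_gt0 : (0 < mu setT)%E.
Proof. by have -> : mu setT = 1%E by exact: probability_setT. Qed.

(** The supremum is a bound that lies below every other bound, so one representative cut at it
    inherits all bounds of [c] simultaneously. *)
Lemma bm_sup c : bm c ->
  (forall x, `|c x| <= sup (range (fun x => `|c x|))) /\
  (forall M, (forall x, `|c x| <= M) -> sup (range (fun x => `|c x|)) <= M).
Proof.
move=> [_ [K cK]]; have [x0 _] := mps_inhabited; split.
  move=> x; apply: ub_le_sup; last by exists x.
  by exists K => _ [y _ <-].
move=> M cM; apply: ge_sup; first by exists `|c x0|, x0.
by move=> _ [y _ <-].
Qed.

Lemma cabsE f x :
  cabs f x = Num.sqrt (complex.Re (f x) ^+ 2 + complex.Im (f x) ^+ 2).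
Proof. by rewrite /cabs /ComplexField.Normc.normc; case: (f x). Qed.

Lemma cabs_ge0 f x : 0 <= cabs f x.
Proof. by rewrite cabsE sqrtr_ge0. Qed.

Lemma sqr_cabs f x :
  cabs f x ^+ 2 = complex.Re (f x) ^+ 2 + complex.Im (f x) ^+ 2.
Proof. by rewrite cabsE sqr_sqrtr // addr_ge0 ?sqr_ge0. Qed.

Lemma normr_Re_le_cabs f x : `|complex.Re (f x)| <= cabs f x.
Proof.
by rewrite cabsE -sqrtr_sqr ler_sqrt ?addr_ge0 ?sqr_ge0 // lerDl sqr_ge0.
Qed.

Lemma normr_Im_le_cabs f x : `|complex.Im (f x)| <= cabs f x.
Proof.
by rewrite cabsE -sqrtr_sqr ler_sqrt ?addr_ge0 ?sqr_ge0 // lerDr sqr_ge0.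
Qed.

Lemma cabs_le f x : cabs f x <= `|complex.Re (f x)| + `|complex.Im (f x)|.
Proof.
have h : 0 <= `|complex.Re (f x)| + `|complex.Im (f x)| by rewrite addr_ge0.
rewrite -(ger0_norm h) -sqrtr_sqr cabsE ler_sqrt ?sqr_ge0 //.
rewrite sqrrD !real_normK ?num_real // addrAC lerDl mulrn_wge0 // mulr_ge0 //.
Qed.

Lemma cabs_rc c x : cabs (rc c) x = `|c x|.
Proof. by rewrite cabsE /= expr0n addr0 sqrtr_sqr. Qed.

Lemma measurable_cabs f : cmeasurable f -> measurable_fun setT (cabs f).
Proof.
move=> [mr mi]; rewrite (_ : cabs f = (fun x => Num.sqrt
  (complex.Re (f x) ^+ 2 + complex.Im (f x) ^+ 2))); last first.
  by apply/funext => x; rewrite cabsE.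
apply: measurableT_comp.
  by apply: continuous_measurable_fun; exact: sqrt_continuous.
by apply: measurable_funD; exact: measurable_funX.
Qed.

Lemma bm_cabs f : cbm f -> bm (cabs f).
Proof.
move=> [[mr [K fK]] [mi [K' fK']]]; split; first exact: measurable_cabs.
exists (K + K') => x; rewrite ger0_norm ?cabs_ge0 //.
by apply: le_trans (cabs_le f x) _; rewrite lerD.
Qed.

Lemma bm_Lnorm (p : \bar R) c : (1 <= p)%E -> bm c ->
  (Lnorm mu p (EFin \o c) < +oo)%E.
Proof.
move=> p1 bc; have [mc [K cK]] := bc.
have hy : c \in Lfun mu +oo%E.
  apply/andP; split; first by rewrite inE /=.
  rewrite inE /finLfun /mkset /finite_norm unlock mps_mu_gt0.
  apply: le_lt_trans (ltry K); apply/ess_supP; apply: nearW => x /=.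
  by rewrite lee_fin.
have muT : mu setT \is a fin_num by have -> : mu setT = 1%E by exact: probability_setT.
have /andP[_] := Lfun_subset p1 (leey 1%E) muT (leey p) hy.
by rewrite inE.
Qed.

Lemma cbm_cLp (p : \bar R) f : (1 <= p)%E -> cbm f -> cLp p f.
Proof.
move=> p1 bf; split; first by split; [case: bf => -[] | case: bf => _ []].
exact: bm_Lnorm p1 (bm_cabs bf).
Qed.

Lemma cbm_rc c : bm c -> cbm (rc c).
Proof. by move=> bc; split => //=; exact: bm_cst. Qed.

Lemma cLp1_integrable f : cLp 1%:E f ->
  mu.-integrable setT (EFin \o (fun x => complex.Re (f x))) /\
  mu.-integrable setT (EFin \o (fun x => complex.Im (f x))).
Proof.
move=> [[mr mi]]; rewrite /cLnorm Lnorm1 => h.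
have ia : mu.-integrable setT (EFin \o cabs f).
  by apply/integrableP; split => //; apply/measurable_EFinP; exact: measurable_cabs.
split; apply: (le_integrable measurableT) ia => //.
- exact/measurable_EFinP.
- move=> x _ /=; rewrite lee_fin (ger0_norm (cabs_ge0 f x)).
  exact: normr_Re_le_cabs.
- exact/measurable_EFinP.
- move=> x _ /=; rewrite lee_fin (ger0_norm (cabs_ge0 f x)).
  exact: normr_Im_le_cabs.
Qed.

(** Large values are replaced by 0, so that [f - truncate f K] is at each point [f] or 0 and hence
    dominated by [f]. *)
Definition truncate (f : X -> R[i]) (K : R) (x : X) : R[i] :=
  if cabs f x <= K then f x else 0.

Lemma cbm_truncate f K : cmeasurable f -> cbm (truncate f K).
Proof.
move=> [mr mi]; have mf := measurable_cabs (conj mr mi).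
pose A := [set x | cabs f x <= K].
have mA : measurable A.
  rewrite -[X in measurable X]setTI.
  have -> : A = (cabs f) @^-1` `]-oo, K].
    by apply/seteqP; split => x /=; rewrite in_itv.
  exact: mf.
have bnd (F : R[i] -> R) : F 0 = 0 -> measurable_fun setT (fun x => F (f x)) ->
    (forall x, `|F (f x)| <= cabs f x) -> bm (fun x => F (truncate f K x)).
  move=> F0 mF FK; rewrite (_ : (fun x => _) = (fun x => \1_A x * F (f x))).
    split; first by apply: measurable_funM => //; exact: measurable_indic.
    exists `|K| => x; rewrite indicE.
    case: (boolP (x \in A)) => [|_]; rewrite ?inE /=; last by rewrite mul0r normr0.
    by move=> h; rewrite mul1r (le_trans (FK x)) // (le_trans h) // ler_norm.
  apply/funext => x; rewrite indicE /truncate.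
  by case: (boolP (x \in A)) => [|/negP]; rewrite inE /A /= => /[dup] h;
    [rewrite mul1r h | move=> /negP/negbTE ->; rewrite mul0r].
split; apply: bnd => //; first exact: normr_Re_le_cabs.
exact: normr_Im_le_cabs.
Qed.

(** Truncation at the essential supremum alters [f] on a null set only. *)
Lemma cLpy_cbm f : cLp +oo%E f -> exists2 g, cbm g & cae_eq f g.
Proof.
move=> [mf nf]; have n0 : (0 <= cLnorm +oo f)%E by exact: Lnorm_ge0.
have nfin : cLnorm +oo f \is a fin_num by rewrite ge0_fin_numE.
exists (truncate f (fine (cLnorm +oo f))); first exact: cbm_truncate.
have := ess_sup_ge mu (abse \o (EFin \o cabs f)).
apply: filterS => x /=; rewrite ger0_norm ?cabs_ge0 // => h.
rewrite /truncate -lee_fin fineK // (le_trans h) //.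
by rewrite /cLnorm unlock mps_mu_gt0.
Qed.

Lemma cintegral_rc c : bm c -> cintegral (rc c) = (Rintegral mu setT c)%:C%C.
Proof. by move=> bc; rewrite /cintegral /= int_cst. Qed.

End complex_functions.

(** * Factor maps and conditional expectations of bounded functions *)

Section real_factor.
Context (R : realType) (X : mpsystem R) (Y : markov_factor X).
Local Notation mu := (mps_mu X).
Local Notation nu := (mps_mu Y).
Local Notation J := (@mf_op R X Y).
Implicit Types (c e : Y -> R) (u v : X -> R).

Lemma rc_cLp1 c : bm c -> cLp 1%:E (rc c).
Proof. by move=> bc; apply: cbm_cLp => //; exact: cbm_rc. Qed.

Lemma mf_op_rc_affine c (a b : R) : bm c ->
  \forall x \ae mu, J (rc (fun y => a * c y + b)) x = a%:C%C * J (rc c) x + b%:C%C.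
Proof.
move=> bc.
have L1 : cLp 1%:E (rc (fun=> 1 : R) : Y -> R[i]) by apply: rc_cLp1; exact: bm_cst.
have h1 := @mf_linear _ _ Y a%:C%C (rc c) (rc (fun=> b)) (rc_cLp1 bc)
  (rc_cLp1 (bm_cst _ b)).
(* Linearity comes in the form [a * f + g], so the constant [b] is written as [(b - 1) * 1 + 1] to
   reach [mf_one]. *)
have h2 := @mf_linear _ _ Y (b - 1)%:C%C _ _ L1 L1.
apply: filterS3 h1 h2 (mf_one Y) => x h1 h2 h3.
rewrite (_ : rc _ = (fun y => a%:C%C * rc c y + rc (fun=> b) y)); last first.
  by apply/funext => y; rewrite /rc; simpc; congr (Complex _ _); ring.
rewrite h1; congr (_ + _).
rewrite (_ : rc (fun=> b) = (fun y => (b - 1)%:C%C * rc (fun=> 1) y + rc (fun=> 1) y));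
  last first.
  by apply/funext => y; rewrite /rc; simpc; congr (Complex _ _); ring.
by rewrite h2 h3; simpc; congr (Complex _ _); ring.
Qed.

Lemma mf_op_rc_ge0 c : bm c -> (\forall y \ae nu, 0 <= c y) ->
  \forall x \ae mu, 0 <= J (rc c) x.
Proof.
move=> bc c0; apply: mf_pos; first exact: rc_cLp1.
by apply: filterS c0 => y h; rewrite /rc lecR.
Qed.

(** Positivity of [J] at [K + c] and [K - c]; a nonnegative complex number is real, so the imaginary
    part vanishes as well. *)
Lemma mf_op_rc_bounded c (K : R) : bm c -> (forall y, `|c y| <= K) ->
  \forall x \ae mu, complex.Im (J (rc c) x) = 0 /\ `|complex.Re (J (rc c) x)| <= K.
Proof.
move=> bc cK.
have h1 := @mf_op_rc_ge0 (fun y => 1 * c y + K) ltac:(bmt)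
  (aeW _ (fun y => _)).
have h2 := @mf_op_rc_ge0 (fun y => - 1 * c y + K) ltac:(bmt)
  (aeW _ (fun y => _)).
have {}h1 : \forall x \ae mu, 0 <= J (rc (fun y => 1 * c y + K)) x.
  by apply: h1 => y; have := cK y; rewrite ler_norml => /andP[]; lra.
have {}h2 : \forall x \ae mu, 0 <= J (rc (fun y => - 1 * c y + K)) x.
  by apply: h2 => y; have := cK y; rewrite ler_norml => /andP[]; lra.
have e1 := mf_op_rc_affine 1 K bc; have e2 := mf_op_rc_affine (-1) K bc.
have h : \forall x \ae mu, 0 <= 1%:C%C * J (rc c) x + K%:C%C by
  apply: filterS2 h1 e1 => x ? <-.
apply: filterS3 h h2 e2 => x h h2 e2.
rewrite e2 in h2; move: h h2; case: (J (rc c) x) => a b; simpc.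
move=> /andP[/eqP h h'] /andP[_ h''] /=; split => //.
by rewrite ler_norml; apply/andP; split; lra.
Qed.

Lemma real_lift_exists c : bm c -> exists w : X -> R,
  [/\ bm w, forall K, (forall y, `|c y| <= K) -> forall x, `|w x| <= K &
      \forall x \ae mu, J (rc c) x = (w x)%:C%C].
Proof.
move=> bc; have [cK supK] := bm_sup bc; set K := sup _ in cK supK.
have [y0 _] := mps_inhabited Y.
have K0 : 0 <= K by apply: le_trans (cK y0).
have [[mr _] _] := mf_L1 (rc_cLp1 bc).
pose w x : R := Num.max (- K) (Num.min K (complex.Re (J (rc c) x))).
have wK x : `|w x| <= K.
  rewrite ler_norml /w le_max lexx /= ge_max ge_min lexx /= andbT.
  by rewrite (le_trans _ K0) // oppr_le0.
exists w; split.
- split; last by exists K.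
  apply: measurable_maxr; first exact: measurable_cst.
  by apply: measurable_minr => //; exact: measurable_cst.
- by move=> K' /supK h x; exact: le_trans (wK x) h.
apply: filterS (mf_op_rc_bounded bc cK) => x; rewrite /w.
case: (J (rc c) x) => a b /= [-> /[!ler_norml] /andP[h1 h2]].
by rewrite min_r ?max_r.
Qed.

(* [lift] is the operator J on bounded real functions, with representatives
   chosen bounded everywhere. *)
Definition lift c : X -> R := xget (fun=> 0) [set w | [/\ bm w,
  forall K, (forall y, `|c y| <= K) -> forall x, `|w x| <= K &
  \forall x \ae mu, J (rc c) x = (w x)%:C%C]].

Lemma liftP c : bm c -> [/\ bm (lift c),
  forall K, (forall y, `|c y| <= K) -> forall x, `|lift c x| <= K &
  \forall x \ae mu, J (rc c) x = (lift c x)%:C%C].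
Proof.
by move=> bc; apply: (@xgetPex _ (fun=> 0) _ (real_lift_exists bc)).
Qed.

Lemma bm_lift c : bm c -> bm (lift c). Proof. by case/liftP. Qed.

Lemma lift_bound c K : bm c -> (forall y, `|c y| <= K) ->
  forall x, `|lift c x| <= K.
Proof. by move=> /liftP[_ h _]; exact: h. Qed.

Lemma liftE c : bm c -> \forall x \ae mu, J (rc c) x = (lift c x)%:C%C.
Proof. by case/liftP. Qed.

Lemma lift_lin a c e : bm c -> bm e ->
  \forall x \ae mu, lift (fun y => a * c y + e y) x = a * lift c x + lift e x.
Proof.
move=> bc be; near=> x.
have h1 : J (rc c) x = (lift c x)%:C%C by near: x; exact: liftE.
have h2 : J (rc e) x = (lift e x)%:C%C by near: x; exact: liftE.
have h3 : J (rc (fun y => a * c y + e y)) x = (lift (fun y => a * c y + e y) x)%:C%C.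
  by near: x; apply: liftE; bmt.
have h4 : J (fun y => a%:C%C * rc c y + rc e y) x = a%:C%C * J (rc c) x + J (rc e) x.
  by near: x; apply: mf_linear; exact: rc_cLp1.
apply: (@complexI R); rewrite -h3.
rewrite (_ : rc _ = (fun y => a%:C%C * rc c y + rc e y)); last first.
  by apply/funext => y; rewrite /rc; simpc.
by rewrite h4 h1 h2; simpc.
Unshelve. all: by end_near. Qed.

Lemma liftM c e : bm c -> bm e ->
  \forall x \ae mu, lift (fun y => c y * e y) x = lift c x * lift e x.
Proof.
move=> bc be; near=> x.
have h1 : J (rc c) x = (lift c x)%:C%C by near: x; exact: liftE.
have h2 : J (rc e) x = (lift e x)%:C%C by near: x; exact: liftE.
have h3 : J (rc (fun y => c y * e y)) x = (lift (fun y => c y * e y) x)%:C%C.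
  by near: x; apply: liftE; bmt.
have h4 : J (fun y => rc c y * rc e y) x = J (rc c) x * J (rc e) x.
  near: x; apply: mf_mul; apply: cbm_cLp; rewrite ?leey //; exact: cbm_rc.
apply: (@complexI R); rewrite -h3.
rewrite (_ : rc _ = (fun y => rc c y * rc e y)); last first.
  by apply/funext => y; rewrite /rc; simpc.
by rewrite h4 h1 h2; simpc.
Unshelve. all: by end_near. Qed.

Lemma lift_ge0 c : bm c -> (\forall y \ae nu, 0 <= c y) ->
  \forall x \ae mu, 0 <= lift c x.
Proof.
move=> bc c0; apply: filterS2 (liftE bc) (mf_op_rc_ge0 bc c0) => x ->.
by rewrite lecR.
Qed.

Lemma lift_cst a : \forall x \ae mu, lift (fun=> a) x = a.
Proof.
have b1 : bm (fun _ : Y => 1 : R) by exact: bm_cst.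
have h := mf_op_rc_affine 0 a b1.
apply: filterS2 h (liftE (bm_cst _ a)) => x; simpc.
by move=> -> /(congr1 (@complex.Re R)) /= /esym.
Qed.

Lemma liftZ a c : bm c -> \forall x \ae mu, lift (fun y => a * c y) x = a * lift c x.
Proof.
move=> bc; have b0 : bm (fun _ : Y => 0 : R) by exact: bm_cst.
apply: filterS2 (lift_lin a bc b0) (lift_cst 0) => x.
rewrite (_ : (fun y => _ + _) = (fun y => a * c y)); last first.
  by apply/funext => y; rewrite addr0.
by move=> -> ->; rewrite addr0.
Qed.

Lemma liftB c e : bm c -> bm e ->
  \forall x \ae mu, lift (fun y => c y - e y) x = lift c x - lift e x.
Proof.
move=> bc be; apply: filterS (lift_lin (-1) be bc) => x.
rewrite (_ : (fun y => _ * _ + _) = (fun y => c y - e y)); last first.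
  by apply/funext => y; rewrite mulN1r addrC.
by move=> ->; rewrite mulN1r addrC.
Qed.

Lemma le_lift c e : bm c -> bm e -> (\forall y \ae nu, c y <= e y) ->
  \forall x \ae mu, lift c x <= lift e x.
Proof.
move=> bc be ce; have bB : bm (fun y => e y - c y) by bmt.
have h : \forall y \ae nu, 0 <= e y - c y.
  by apply: filterS ce => y; rewrite subr_ge0.
apply: filterS2 (lift_ge0 bB h) (liftB be bc) => x + e1.
by rewrite e1 subr_ge0.
Qed.

Lemma lift_ext c e : bm c -> bm e -> (\forall y \ae nu, c y = e y) ->
  \forall x \ae mu, lift c x = lift e x.
Proof.
move=> bc be ce.
have h1 : \forall x \ae mu, lift c x <= lift e x.
  by apply: le_lift => //; apply: filterS ce => y ->.
have h2 : \forall x \ae mu, lift e x <= lift c x.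
  by apply: le_lift => //; apply: filterS ce => y ->.
by apply: filterS2 h1 h2 => x h1 h2; apply/eqP; rewrite eq_le h1.
Qed.

Lemma norm_lift_le c : bm c ->
  \forall x \ae mu, `|lift c x| <= lift (fun y => `|c y|) x.
Proof.
move=> bc; have bn : bm (fun y => `|c y|) by bmt.
have h1 : \forall x \ae mu, lift c x <= lift (fun y => `|c y|) x.
  by apply: le_lift => //; apply: nearW => y; exact: ler_norm.
have h2 : \forall x \ae mu, lift (fun y => -1 * c y) x <= lift (fun y => `|c y|) x.
  apply: le_lift => //; first by bmt.
  by apply: nearW => y; rewrite mulN1r lerNl; apply: lerNnormlW.
apply: filterS3 h1 h2 (liftZ (-1) bc) => x h1 + e; rewrite e => h2.
by rewrite ler_norml; apply/andP; split; lra.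
Qed.

Lemma int_lift c : bm c -> Rintegral mu setT (lift c) = Rintegral nu setT c.
Proof.
move=> bc; have := mf_int (rc_cLp1 bc); rewrite cintegral_rc //.
move=> /(congr1 (@complex.Re R)) /= <-; congr fine; apply: ae_eq_integral => //.
- by apply/measurable_EFinP; case: (bm_lift bc).
- by apply/measurable_EFinP; have [[]] := mf_L1 (rc_cLp1 bc).
- by apply: filterS (liftE bc) => x ->.
Qed.

Lemma lift_iter1 c : bm c -> \forall x \ae mu,
  lift (fun y => c (mps_iter 1 y)) x = lift c (mps_iter 1 x).
Proof.
move=> bc; near=> x.
have h1 : J (rc c) (mps_iter 1 x) = (lift c (mps_iter 1 x))%:C%C.
  by near: x; apply: (ae_iter 1 (Q := fun x => J (rc c) x = (lift c x)%:C%C)); exact: liftE.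
have h2 : J (rc (fun y => c (mps_iter 1 y))) x = (lift (fun y => c (mps_iter 1 y)) x)%:C%C.
  by near: x; apply: liftE; exact: bm_iter.
have h3 : J (koopman 1 (rc c)) x = koopman 1 (J (rc c)) x.
  by near: x; apply: mf_koopman; exact: rc_cLp1.
by apply: (@complexI R); rewrite -h2 -h1; exact: h3.
Unshelve. all: by end_near. Qed.

Lemma lift_iter (n : int) c : bm c ->
  \forall x \ae mu, lift (fun y => c (mps_iter n y)) x = lift c (mps_iter n x).
Proof.
(* For the inverse: the commutation with T is applied to [e] composed with the inverse map, and
   evaluated at the preimage of [x]. *)
have Sm1 e : bm e -> \forall x \ae mu,
    lift (fun y => e (mps_iter (-1) y)) x = lift e (mps_iter (-1) x).
  move=> be; apply: filterS (ae_iter (-1) (lift_iter1 (bm_iter (-1) be))) => x.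
  rewrite -mps_iterD subrr => <-; congr (lift _ _).
  by apply/funext => y; rewrite -mps_iterD.
have step (m k : int) : (forall e, bm e -> \forall x \ae mu,
      lift (fun y => e (mps_iter m y)) x = lift e (mps_iter m x)) ->
    (forall e, bm e -> \forall x \ae mu,
      lift (fun y => e (mps_iter k y)) x = lift e (mps_iter k x)) ->
    forall e, bm e -> \forall x \ae mu,
      lift (fun y => e (mps_iter (k + m) y)) x = lift e (mps_iter (k + m) x).
  move=> hm hk e be.
  apply: filterS2 (hm _ (bm_iter k be)) (ae_iter m (hk e be)) => x h h'.
  rewrite mps_iterD -h' -h; congr (lift _ x).
  by apply/funext => y; rewrite mps_iterD.
elim: n c => [|n IH|n IH] c bc; first exact: nearW.
  by rewrite -addn1 PoszD addrC; apply: step => //; exact: lift_iter1.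
by rewrite -addn1 PoszD opprD addrC; apply: step.
Qed.

(** The functional taking [c] to the integral of [lift c * u] is bounded by [K] times the integral
    of [|c|], as [|J c| <= J |c|] and [J] preserves integrals. The conditional expectation is its
    density. *)
Lemma condexp_exists u : bm u -> exists g : Y -> R,
  [/\ bm g, forall K, (forall x, `|u x| <= K) -> forall y, `|g y| <= K &
      forall c, bm c -> Rintegral mu setT (fun x => lift c x * u x) =
                        Rintegral nu setT (fun y => c y * g y)].
Proof.
move=> bu; have [uK supK] := bm_sup bu; set K := sup _ in uK supK.
pose L c := Rintegral mu setT (fun x => lift c x * u x).
have Llin a c e : bm c -> bm e -> L (fun y => a * c y + e y) = a * L c + L e.
  move=> bc be; have [bc' be'] := (bm_lift bc, bm_lift be).
  rewrite /L -intZ -?intD; bmt; apply: int_ae_eq; bmt.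
    by apply: bm_lift; bmt.
  apply: filterS (lift_lin a bc be) => x ->; ring.
have Lb c : bm c -> `|L c| <= K * Rintegral nu setT (fun y => `|c y|).
  move=> bc; have bc' := bm_lift bc; have bn : bm (fun y => `|c y|) by bmt.
  have bl := bm_lift bn.
  rewrite /L -int_lift // -intZ //.
  apply: le_trans (le_normr_Rintegral _ _) _ => //.
    by apply: (@bm_integrable _ _ _ _ (fun x => lift c x * u x)); bmt.
  apply: le_int_ae; bmt; apply: filterS (norm_lift_le bc) => x h.
  by rewrite normrM mulrC ler_pM.
have [g [bg gK gE]] := functional_density Llin Lb.
by exists g; split => // K' /supK h y; exact: le_trans (gK y) h.
Qed.

(** The real counterpart of [cond_expectation], with a representative that obeys every uniform bound
    of [u]; the two are compared in [cond_expectation_ae]. *)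
Definition condexp u : Y -> R := xget (fun=> 0) [set g | [/\ bm g,
  forall K, (forall x, `|u x| <= K) -> forall y, `|g y| <= K &
  forall c, bm c -> Rintegral mu setT (fun x => lift c x * u x) =
                    Rintegral nu setT (fun y => c y * g y)]].

Lemma condexpP u : bm u -> [/\ bm (condexp u),
  forall K, (forall x, `|u x| <= K) -> forall y, `|condexp u y| <= K &
  forall c, bm c -> Rintegral mu setT (fun x => lift c x * u x) =
                    Rintegral nu setT (fun y => c y * condexp u y)].
Proof.
by move=> bu; apply: (@xgetPex _ (fun=> 0) _ (condexp_exists bu)).
Qed.

Lemma bm_condexp u : bm u -> bm (condexp u). Proof. by case/condexpP. Qed.

Lemma condexp_bound u K : bm u -> (forall x, `|u x| <= K) ->
  forall y, `|condexp u y| <= K.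
Proof. by move=> /condexpP[_ h _]; exact: h. Qed.

Lemma int_condexpM u c : bm u -> bm c ->
  Rintegral mu setT (fun x => lift c x * u x) =
  Rintegral nu setT (fun y => c y * condexp u y).
Proof. by move=> /condexpP[_ _ h]; exact: h. Qed.

Lemma condexp_unique u g : bm u -> bm g ->
  (forall c, bm c -> (forall y, 0 <= c y) ->
    Rintegral mu setT (fun x => lift c x * u x) =
    Rintegral nu setT (fun y => c y * g y)) ->
  \forall y \ae nu, condexp u y = g y.
Proof.
move=> bu bg h; have bE := bm_condexp bu.
by apply: ae_eq_test => // c bc c0; rewrite -int_condexpM // h.
Qed.

Lemma int_condexp u : bm u ->
  Rintegral nu setT (condexp u) = Rintegral mu setT u.
Proof.
move=> bu; have b1 : bm (fun _ : Y => 1 : R) by exact: bm_cst.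
have := int_condexpM bu b1; have bl := bm_lift b1.
rewrite (_ : (fun y => 1 * condexp u y) = condexp u); last first.
  by apply/funext => y; rewrite mul1r.
move=> <-; apply: int_ae_eq => //; first by bmt.
by apply: filterS (lift_cst 1) => x ->; rewrite mul1r.
Qed.

Lemma condexp_lin a u v : bm u -> bm v ->
  \forall y \ae nu, condexp (fun x => a * u x + v x) y =
    a * condexp u y + condexp v y.
Proof.
move=> bu bv; have [bEu bEv] := (bm_condexp bu, bm_condexp bv).
apply: condexp_unique; bmt => c bc _; have bl := bm_lift bc.
rewrite (_ : (fun x => lift c x * _) =
   (fun x => a * (lift c x * u x) + lift c x * v x)); last first.
  by apply/funext => x; ring.
rewrite (_ : (fun y => c y * _) =
   (fun y => a * (c y * condexp u y) + c y * condexp v y)); last first.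
  by apply/funext => y; ring.
rewrite !intD; bmt; rewrite !intZ; bmt; by rewrite !int_condexpM.
Qed.

Lemma condexp_ext u v : bm u -> bm v -> (\forall x \ae mu, u x = v x) ->
  \forall y \ae nu, condexp u y = condexp v y.
Proof.
move=> bu bv uv; have bEv := bm_condexp bv.
apply: condexp_unique => // c bc _; have bl := bm_lift bc.
rewrite -int_condexpM //; apply: int_ae_eq; bmt.
by apply: filterS uv => x ->.
Qed.

Lemma condexp_ge0 u : bm u -> (\forall x \ae mu, 0 <= u x) ->
  \forall y \ae nu, 0 <= condexp u y.
Proof.
move=> bu u0; have bE := bm_condexp bu.
apply: ae_le_test => //; first exact: bm_cst.
move=> c bc c0; rewrite -int_condexpM //; have bl := bm_lift bc.
rewrite (_ : (fun y => c y * 0) = fun=> 0); last first.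
  by apply/funext => y; rewrite mulr0.
rewrite int_cst; apply: int_ge0_ae; bmt.
apply: filterS2 u0 (lift_ge0 bc (aeW _ c0)) => x h1 h2; exact: mulr_ge0.
Qed.

Lemma condexp_lift c u : bm c -> bm u ->
  \forall y \ae nu, condexp (fun x => lift c x * u x) y = c y * condexp u y.
Proof.
move=> bc bu; have [bE bl] := (bm_condexp bu, bm_lift bc).
apply: condexp_unique; bmt => e be _; have bl' := bm_lift be.
have bec : bm (fun y => e y * c y) by bmt.
have bl'' := bm_lift bec.
transitivity (Rintegral mu setT (fun x => lift (fun y => e y * c y) x * u x)).
  apply: int_ae_eq; bmt.
  by apply: filterS (liftM be bc) => x ->; rewrite mulrA.
rewrite int_condexpM //; apply: eq_Rintegral => y _; ring.
Qed.

Lemma condexp_iter (n : int) u : bm u ->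
  \forall y \ae nu, condexp (fun x => u (mps_iter n x)) y =
    condexp u (mps_iter n y).
Proof.
move=> bu; have bE := bm_condexp bu; apply: condexp_unique.
- exact: bm_iter.
- exact: bm_iter.
move=> c bc _; have bl := bm_lift bc; have bcn := bm_iter (- n) bc.
have bln := bm_lift bcn.
have := int_condexpM bu bcn.
rewrite -(int_iter (- n) (f := fun y => c y * condexp u (mps_iter n y))); last first.
  by bmt; exact: bm_iter.
rewrite (_ : (fun y => c (mps_iter (- n) y) * condexp u (mps_iter n (mps_iter (- n) y)))
   = (fun y => c (mps_iter (- n) y) * condexp u y)); last first.
  by apply/funext => y; rewrite -mps_iterD subrr.
move=> <-.
rewrite -(int_iter (- n) (f := fun x => lift c x * u (mps_iter n x))); last first.
  by bmt; exact: bm_iter.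
apply: int_ae_eq; bmt.
- exact: (bm_iter (- n) bl).
- exact: (bm_iter (- n) (bm_iter n bu)).
- apply: filterS (lift_iter (- n) bc) => x ->.
  by rewrite -mps_iterD subrr.
Qed.

Lemma condexpK c : bm c -> \forall y \ae nu, condexp (lift c) y = c y.
Proof.
move=> bc; have bl := bm_lift bc; apply: condexp_unique => // e be _.
have bec : bm (fun y => e y * c y) by bmt.
rewrite -int_lift //; have [b1 b2] := (bm_lift bec, bm_lift be).
by apply: int_ae_eq; bmt; apply: filterS (liftM be bc) => x ->.
Qed.

Lemma condexpZ a u : bm u ->
  \forall y \ae nu, condexp (fun x => a * u x) y = a * condexp u y.
Proof.
move=> bu; have bE := bm_condexp bu; apply: condexp_unique; bmt => c bc _.
have bl := bm_lift bc.
rewrite (_ : (fun x => _) = (fun x => a * (lift c x * u x))); last first.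
  by apply/funext => x; ring.
rewrite intZ; bmt; rewrite int_condexpM // -intZ; bmt.
by apply: eq_Rintegral => y _; ring.
Qed.

Lemma condexpD u v : bm u -> bm v ->
  \forall y \ae nu, condexp (fun x => u x + v x) y = condexp u y + condexp v y.
Proof.
move=> bu bv; apply: filterS (condexp_lin 1 bu bv) => y.
rewrite (_ : (fun x => _ * _ + _) = (fun x => u x + v x)); last first.
  by apply/funext => x; rewrite mul1r.
by move=> ->; rewrite mul1r.
Qed.

Lemma condexp_sum (I : Type) (s : seq I) (F : I -> X -> R) : (forall i, bm (F i)) ->
  \forall y \ae nu, condexp (fun x => \sum_(i <- s) F i x) y =
    \sum_(i <- s) condexp (F i) y.
Proof.
move=> bF; elim: s => [|i s IH].
  have b0 : bm (fun _ : X => 0 : R) by exact: bm_cst.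
  apply: filterS (condexpZ 0 b0) => y; rewrite !mul0r big_nil => h.
  by rewrite (_ : (fun x => _) = fun=> 0) //; apply/funext => x; rewrite big_nil.
have bs : bm (fun x => \sum_(j <- s) F j x) by exact: bm_sum.
apply: filterS2 IH (condexpD (bF i) bs) => y.
rewrite (_ : (fun x => _ + _) = fun x => \sum_(j <- i :: s) F j x); last first.
  by apply/funext => x; rewrite big_cons.
by rewrite big_cons => -> ->.
Qed.

(** Conditional Jensen, from [E((u - J E u)^2) >= 0] and [E(J c u) = c E(u)]. *)
Lemma sqr_condexp_le u : bm u ->
  \forall y \ae nu, condexp u y ^+ 2 <= condexp (fun x => u x ^+ 2) y.
Proof.
move=> bu; have bE := bm_condexp bu; have bl := bm_lift bE.
have b1 : bm (fun x => u x ^+ 2) by bmt.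
have b2 : bm (fun x => lift (condexp u) x * u x) by bmt.
have b3 : bm (fun x => lift (condexp u) x * lift (condexp u) x) by bmt.
have b23 : bm (fun x => -2 * (lift (condexp u) x * u x) +
  lift (condexp u) x * lift (condexp u) x) by bmt.
have := @condexp_ge0 (fun x => u x ^+ 2 + (-2 * (lift (condexp u) x * u x) +
   lift (condexp u) x * lift (condexp u) x)) ltac:(bmt) (aeW _ (fun x => _)).
move=> h; near=> y.
have e1 : condexp (fun x => lift (condexp u) x * u x) y = condexp u y * condexp u y.
  by near: y; exact: condexp_lift.
have e2 : condexp (fun x => lift (condexp u) x * lift (condexp u) x) y =
    condexp u y * condexp (lift (condexp u)) y.
  by near: y; exact: condexp_lift.
have e3 : condexp (lift (condexp u)) y = condexp u y.
  by near: y; exact: condexpK.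
have e4 : condexp (fun x => -2 * (lift (condexp u) x * u x) +
   lift (condexp u) x * lift (condexp u) x) y =
   -2 * condexp (fun x => lift (condexp u) x * u x) y +
   condexp (fun x => lift (condexp u) x * lift (condexp u) x) y.
  near: y; exact: (condexp_lin _ b2 b3).
have e5 : condexp (fun x => u x ^+ 2 + (-2 * (lift (condexp u) x * u x) +
   lift (condexp u) x * lift (condexp u) x)) y =
   condexp (fun x => u x ^+ 2) y + condexp (fun x => -2 * (lift (condexp u) x * u x) +
   lift (condexp u) x * lift (condexp u) x) y.
  near: y; exact: (condexpD b1 b23).
have : 0 <= condexp (fun x => u x ^+ 2 + (-2 * (lift (condexp u) x * u x) +
   lift (condexp u) x * lift (condexp u) x)) y.
  near: y; apply: h => x.
  by rewrite (_ : _ + _ = (u x - lift (condexp u) x) ^+ 2) ?sqr_ge0 //; ring.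
rewrite e5 e4 e1 e2 e3 => h'; rewrite -subr_ge0; apply: le_trans h' _.
by rewrite le_eqVlt; apply/orP; left; apply/eqP; ring.
Unshelve. all: by end_near. Qed.

End real_factor.

(** * Hilbert-Schmidt kernels *)

Section forms.
Context (R : realType) (I : Type).
Implicit Types (M : I -> I -> R) (s t : seq (R * I)).

(** Lists represent finitely supported weights, with concatenation as addition; an index may occur
    several times, which keeps the form bilinear for an arbitrary index type. *)
Definition form M s t : R :=
  \sum_(p <- s) \sum_(q <- t) p.1 * q.1 * M p.2 q.2.

Lemma form_catl M s1 s2 t : form M (s1 ++ s2) t = form M s1 t + form M s2 t.
Proof. by rewrite /form big_cat. Qed.

Lemma formC M s t : (forall i j, M i j = M j i) -> form M s t = form M t s.
Proof.
move=> sM; rewrite /form exchange_big; apply: eq_bigr => p _.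
by apply: eq_bigr => q _; rewrite sM; ring.
Qed.

Lemma form_catr M s t1 t2 : form M s (t1 ++ t2) = form M s t1 + form M s t2.
Proof.
rewrite /form -big_split; apply: eq_bigr => p _ /=; exact: big_cat.
Qed.

Definition scale_weights (a : R) s : seq (R * I) := [seq (a * p.1, p.2) | p <- s].

Lemma form_scalel M a s t : form M (scale_weights a s) t = a * form M s t.
Proof.
rewrite /form big_map mulr_sumr; apply: eq_bigr => p _ /=.
by rewrite mulr_sumr; apply: eq_bigr => q _; ring.
Qed.

Lemma form_scaler M a s t : form M s (scale_weights a t) = a * form M s t.
Proof.
rewrite /form mulr_sumr; apply: eq_bigr => p _; rewrite big_map mulr_sumr.
by apply: eq_bigr => q _ /=; ring.
Qed.

End forms.

Section kernels.
Context (R : realType) (X : mpsystem R) (Y : markov_factor X).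
Local Notation mu := (mps_mu X).
Local Notation nu := (mps_mu Y).
Local Notation E := (@condexp R X Y).
Local Notation lift := (@lift R X Y).

(* A list [s] of weighted indices stands for the kernel
   [sum a_i u_i (x) u_i] on the relative product of X with itself over Y;
   [gram_sq] gives the fibrewise inner products of its terms, so that
   [kernel_sq] is its squared fibrewise Hilbert-Schmidt norm, and [kernel_op]
   is the associated conditional Hilbert-Schmidt operator. *)
Definition gram_sq (I : Type) (u : I -> X -> R) (i j : I) (y : Y) : R :=
  E (fun x => u i x * u j x) y ^+ 2.

Definition kernel_sq I (u : I -> X -> R) (s : seq (R * I)) (y : Y) : R :=
  form (fun i j => gram_sq u i j y) s s.

Definition kernel_op I (u : I -> X -> R) (s : seq (R * I)) (f : X -> R) (x : X) : R :=
  \sum_(p <- s) p.1 * (u p.2 x * lift (E (fun x => u p.2 x * f x)) x).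

Lemma gram_sqC I (u : I -> X -> R) i j y : gram_sq u i j y = gram_sq u j i y.
Proof.
by rewrite /gram_sq; congr (E _ y ^+ 2); apply/funext => x; rewrite mulrC.
Qed.

Lemma bm_gram_sq I (u : I -> X -> R) i j : (forall i, bm (u i)) ->
  bm (gram_sq u i j).
Proof. by move=> bu; apply: bmX; apply: bm_condexp; bmt; exact: bu. Qed.

Lemma bm_form I (u : I -> X -> R) s t : (forall i, bm (u i)) ->
  bm (fun y => form (fun i j => gram_sq u i j y) s t).
Proof.
move=> bu; apply: bm_sum => p; apply: bm_sum => q.
by bmt; exact: bm_gram_sq.
Qed.

Lemma bm_kernel_sq I (u : I -> X -> R) s : (forall i, bm (u i)) ->
  bm (kernel_sq u s).
Proof. exact: bm_form. Qed.

Lemma bm_kernel_op I (u : I -> X -> R) s f : (forall i, bm (u i)) -> bm f ->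
  bm (kernel_op u s f).
Proof.
move=> bu bf; apply: bm_sum => p; bmt; first exact: bu.
by apply: bm_lift; apply: bm_condexp; bmt; exact: bu.
Qed.

(** For each integer vector the form is [E] of a square, hence nonnegative off a null set; the
    countably many vectors share one null set, and [psd_int] passes to real ones. *)
Lemma condexp_gram_psd (d : nat) (v : nat -> X -> R) : (forall k, bm (v k)) ->
  \forall y \ae nu, psd d (fun k l => E (fun x => v k x * v l x) y).
Proof.
move=> bv.
have bvv k l : bm (fun x => v k x * v l x) by bmt; exact: bv.
have : \forall y \ae nu, forall t : seq int,
    0 <= \sum_(k < d) \sum_(l < d) (t`_k)%:~R * (t`_l)%:~R *
      E (fun x => v k x * v l x) y.
  apply: ae_forall_count => t.
  have bsum : bm (fun x => (\sum_(k < d) (t`_k)%:~R * v k x) ^+ 2).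
    by apply: bmX; apply: bm_sum => k; bmt; exact: bv.
  have bterm (p : 'I_d * 'I_d) : bm (fun x => (t`_p.1)%:~R * (t`_p.2)%:~R *
      (v p.1 x * v p.2 x)) by bmt; exact: bv.
  have e1 := condexp_sum Y (index_enum _) bterm.
  have e2 : \forall y \ae nu, forall p : 'I_d * 'I_d,
      E (fun x => (t`_p.1)%:~R * (t`_p.2)%:~R * (v p.1 x * v p.2 x)) y =
      (t`_p.1)%:~R * (t`_p.2)%:~R * E (fun x => v p.1 x * v p.2 x) y.
    by apply: ae_forall_count => p; exact: condexpZ.
  have e3 := condexp_ge0 Y bsum (aeW _ (fun x => sqr_ge0 _)).
  apply: filterS3 e1 e2 e3 => y e1 e2.
  rewrite (_ : (fun x => _ ^+ 2) = (fun x => \sum_(p : 'I_d * 'I_d)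
     (t`_p.1)%:~R * (t`_p.2)%:~R * (v p.1 x * v p.2 x))); last first.
    apply/funext => x; rewrite expr2 mulr_suml.
    rewrite -(pair_bigA _ (fun k l : 'I_d => (t`_k)%:~R * (t`_l)%:~R *
      (v k x * v l x))) /=.
    apply: eq_bigr => k _; rewrite mulr_sumr; apply: eq_bigr => l _; ring.
  rewrite e1 pair_bigA /=; under eq_bigr do rewrite e2.
  by [].
apply: filterS => y hy; apply: psd_int => z.
have := hy (mkseq z d); congr (_ <= _).
by apply: eq_bigr => k _; apply: eq_bigr => l _; rewrite !nth_mkseq.
Qed.

(** The entries are squares of those of a conditional Gram matrix, so the Schur product theorem
    applies to that matrix and itself. Numbering the positions of the list takes care of repeated
    indices. *)
Lemma kernel_sq_ge0 I (u : I -> X -> R) s : (forall i, bm (u i)) ->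
  \forall y \ae nu, 0 <= kernel_sq u s y.
Proof.
case: s => [|p0 s0] bu; first by apply: nearW => y; rewrite /kernel_sq /form big_nil.
set s := _ :: _; pose v k := u (nth p0 s k).2.
apply: filterS (@condexp_gram_psd (size s) v (fun k => bu _)) => y pM.
have sM k l : E (fun x => v k x * v l x) y = E (fun x => v l x * v k x) y.
  by congr (E _ y); apply/funext => x; rewrite mulrC.
have := schur_product sM sM pM pM (fun k => (nth p0 s k).1).
rewrite /kernel_sq /form (big_nth p0) big_mkord; congr (_ <= _).
apply: eq_bigr => k _; rewrite (big_nth p0) big_mkord.
by apply: eq_bigr => l _; rewrite /gram_sq expr2.
Qed.

Lemma condexp_kernel_op I (u : I -> X -> R) s f w : (forall i, bm (u i)) ->
  bm f -> bm w -> \forall y \ae nu, E (fun x => w x * kernel_op u s f x) y =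
    \sum_(p <- s) p.1 * (E (fun x => u p.2 x * f x) y * E (fun x => u p.2 x * w x) y).
Proof.
move=> bu bf bw.
have bE i : bm (E (fun x => u i x * f x)).
  by apply: bm_condexp; bmt; exact: bu.
have bL i := bm_lift (bE i).
elim: s => [|p s IH].
  apply: filterS (condexpZ Y 0 bw) => y.
  rewrite (_ : (fun x => 0 * w x) = (fun x => w x * kernel_op u [::] f x)).
    by rewrite mul0r big_nil.
  by apply/funext => x; rewrite /kernel_op big_nil mulr0 mul0r.
have bk := bm_kernel_op s bu bf.
have b1 : bm (fun x => lift (E (fun x => u p.2 x * f x)) x * (u p.2 x * w x)).
  by bmt; [exact: bL | exact: bu].
have b2 : bm (fun x => w x * kernel_op u s f x) by bmt.
have b3 : bm (fun x => u p.2 x * w x) by bmt; exact: bu.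
apply: filterS3 IH (condexp_lin Y p.1 b1 b2) (condexp_lift (bE p.2) b3) => y IH.
rewrite (_ : (fun x => _ + _) = (fun x => w x * kernel_op u (p :: s) f x)).
  by move=> -> ->; rewrite big_cons IH.
by apply/funext => x; rewrite /kernel_op big_cons; ring.
Qed.

(** With [w = K f], [a = E(w f)], [b = E(w^2)] and [c = E(f^2)], the fibrewise inner product of K
    with the symmetrised kernel [(w (x) f + f (x) w) / 2] is [b], and the squared norm of the latter
    is [(b c + a^2) / 2], at most [b] because [|f| <= 1]. Hence [0 <= |K|^2 - 2 b + b]. *)
Lemma kernel_op_sq_le I (u : I -> X -> R) s f : (forall i, bm (u i)) ->
  bm f -> (forall x, `|f x| <= 1) ->
  \forall y \ae nu, E (fun x => kernel_op u s f x ^+ 2) y <= kernel_sq u s y.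
Proof.
move=> bu bf f1; set w := kernel_op u s f.
have bw : bm w by exact: bm_kernel_op.
pose u' (i : I + bool) : X -> R := match i with
  | inl i => u i | inr true => fun x => w x + f x | inr false => fun x => w x - f x end.
have bu' i : bm (u' i) by case: i => [i|[]]; rewrite /u'; bmt; exact: bu.
pose s1 : seq (R * (I + bool)) := [seq (p.1, inl p.2) | p <- s].
(* Kernels are combinations of squares [v (x) v], so minus the symmetrised [w (x) f] is polarised
   through [w + f] and [w - f]. *)
pose s2 : seq (R * (I + bool)) := [:: (- 4^-1, inr true); (4^-1, inr false)].
have buw i : bm (fun x => u i x * w x) by bmt; exact: bu.
have buf i : bm (fun x => u i x * f x) by bmt; exact: bu.
have bw2 : bm (fun x => w x ^+ 2) by bmt.
have bf2 : bm (fun x => f x ^+ 2) by bmt.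
have bwf : bm (fun x => w x * f x) by bmt.
have bwf2 : bm (fun x => (w x * f x) ^+ 2) by bmt.
have b1 : bm (fun x => 2 * (w x * f x) + w x ^+ 2) by bmt.
have b2 : bm (fun x => -2 * (w x * f x) + w x ^+ 2) by bmt.
pose b := E (fun x => w x ^+ 2); pose a := E (fun x => w x * f x).
pose c := E (fun x => f x ^+ 2).
have G11 : \forall y \ae nu,
    E (fun x => u' (inr true) x * u' (inr true) x) y = 2 * a y + b y + c y.
  apply: filterS2 (condexp_lin Y 2 bwf bw2) (condexpD Y b1 bf2) => y <- <-.
  by congr (E _ y); apply/funext => x /=; ring.
have G22 : \forall y \ae nu,
    E (fun x => u' (inr false) x * u' (inr false) x) y = -2 * a y + b y + c y.
  apply: filterS2 (condexp_lin Y (-2) bwf bw2) (condexpD Y b2 bf2) => y <- <-.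
  by congr (E _ y); apply/funext => x /=; ring.
have G12 : \forall y \ae nu,
    E (fun x => u' (inr true) x * u' (inr false) x) y = -1 * c y + b y.
  apply: filterS (condexp_lin Y (-1) bf2 bw2) => y <-.
  by congr (E _ y); apply/funext => x /=; ring.
have gI0 (p : R * I) : \forall y \ae nu,
    (E (fun x => u' (inl p.2) x * u' (inr true) x) y =
      E (fun x => u p.2 x * w x) y + E (fun x => u p.2 x * f x) y) /\
    (E (fun x => u' (inl p.2) x * u' (inr false) x) y =
      -1 * E (fun x => u p.2 x * f x) y + E (fun x => u p.2 x * w x) y).
  apply: filterS2 (condexpD Y (buw p.2) (buf p.2))
    (condexp_lin Y (-1) (buf p.2) (buw p.2)) => y h1 h2; split.
    by rewrite -h1; congr (E _ y); apply/funext => x /=; ring.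
  by rewrite -h2; congr (E _ y); apply/funext => x /=; ring.
near=> y.
have Q0 : 0 <= kernel_sq u' (s1 ++ s2) y by near: y; exact: kernel_sq_ge0.
have wE : b y = \sum_(p <- s) p.1 *
    (E (fun x => u p.2 x * f x) y * E (fun x => u p.2 x * w x) y).
  have -> : b y = E (fun x => w x * kernel_op u s f x) y.
    by rewrite /b; congr (E _ y); apply/funext => x; rewrite expr2.
  by near: y; exact: condexp_kernel_op.
have c1 : c y <= 1.
  have : `|c y| <= 1 by apply: condexp_bound => // x; rewrite normrX exprn_ile1.
  exact: le_trans (ler_norm _).
have b0 : 0 <= b y by near: y; apply: condexp_ge0 => //; apply: nearW => x; exact: sqr_ge0.
have ab : a y ^+ 2 <= b y.
  have h1 : a y ^+ 2 <= E (fun x => (w x * f x) ^+ 2) y.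
    by near: y; exact: sqr_condexp_le.
  have bd : bm (fun x => w x ^+ 2 + -1 * (w x * f x) ^+ 2) by bmt.
  have h2 : 0 <= E (fun x => -1 * (w x * f x) ^+ 2 + w x ^+ 2) y.
    near: y; apply: condexp_ge0; first by bmt.
    apply: nearW => x; rewrite mulN1r addrC subr_ge0 exprMn -[leRHS]mulr1.
    by rewrite ler_wpM2l ?sqr_ge0 // (le_trans (ler_norm _)) // normrX exprn_ile1.
  have h3 : E (fun x => -1 * (w x * f x) ^+ 2 + w x ^+ 2) y =
      -1 * E (fun x => (w x * f x) ^+ 2) y + b y.
    near: y; exact: (condexp_lin Y (-1) bwf2 bw2).
  by move: h2; rewrite h3 mulN1r; lra.
have g11 : E (fun x => u' (inr true) x * u' (inr true) x) y = 2 * a y + b y + c y.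
  by near: y; exact: G11.
have g22 : E (fun x => u' (inr false) x * u' (inr false) x) y = -2 * a y + b y + c y.
  by near: y; exact: G22.
have g12 : E (fun x => u' (inr true) x * u' (inr false) x) y = -1 * c y + b y.
  by near: y; exact: G12.
have gI (p : R * I) : List.In p s ->
    (E (fun x => u' (inl p.2) x * u' (inr true) x) y =
      E (fun x => u p.2 x * w x) y + E (fun x => u p.2 x * f x) y) /\
    (E (fun x => u' (inl p.2) x * u' (inr false) x) y =
      -1 * E (fun x => u p.2 x * f x) y + E (fun x => u p.2 x * w x) y).
  by move: p; near: y; apply: ae_forall_in => p; exact: gI0.
have QE : kernel_sq u' (s1 ++ s2) y =
    kernel_sq u s y - 2 * b y + 16^-1 * ((2 * a y + b y + c y) ^+ 2 +
      (-2 * a y + b y + c y) ^+ 2 - 2 * (-1 * c y + b y) ^+ 2).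
  rewrite /kernel_sq form_catl !form_catr (formC s2 s1 (fun i j => gram_sqC u' i j y)).
  have -> : form (fun i j => gram_sq u' i j y) s1 s1 =
      form (fun i j => gram_sq u i j y) s s.
    rewrite /form big_map; apply: eq_bigr => p _; by rewrite big_map.
  have -> : form (fun i j => gram_sq u' i j y) s1 s2 = - b y.
    rewrite /form big_map wE -sumrN.
    have h (q : R * I) : List.In q s ->
       \sum_(r <- s2) (q.1, @inl I bool q.2).1 * r.1 * gram_sq u' (q.1, @inl I bool q.2).2 r.2 y =
       - (q.1 * (E (fun x => u q.2 x * f x) y * E (fun x => u q.2 x * w x) y)).
      move=> qs; have [h1 h2] := gI q qs.
      rewrite !big_cons big_nil /gram_sq h1 h2 /=; by field.
    elim: (s) h => [|q s0 IH] h; first by rewrite !big_nil.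
    rewrite big_cons [RHS]big_cons; congr (_ + _); first by apply: h; left.
    by apply: IH => r rs; apply: h; right.
  have -> : form (fun i j => gram_sq u' i j y) s2 s2 =
     16^-1 * ((2 * a y + b y + c y) ^+ 2 +
      (-2 * a y + b y + c y) ^+ 2 - 2 * (-1 * c y + b y) ^+ 2).
    rewrite /form !big_cons !big_nil /= (gram_sqC u' (inr false) (inr true)).
    by rewrite /gram_sq g11 g22 g12; field.
  ring.
have {}QE : kernel_sq u' (s1 ++ s2) y =
    kernel_sq u s y - 2 * b y + 2^-1 * (b y * c y + a y ^+ 2) by rewrite QE; field.
have bc : b y * c y <= b y by rewrite -[leRHS]mulr1 ler_wpM2l.
move: Q0; rewrite QE -/(b y); lra.
Unshelve. all: by end_near. Qed.

End kernels.

Section form_identities.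
Context (R : realType) (I : Type) (M : I -> I -> R).
Context (MC : forall i j, M i j = M j i).
Implicit Types s t r : seq (R * I).

Definition kernel_sub s t : seq (R * I) := s ++ scale_weights (-1) t.

Definition kernel_mid s t : seq (R * I) :=
  scale_weights 2^-1 s ++ scale_weights 2^-1 t.

Lemma form_parallelogram s t : form M (kernel_sub s t) (kernel_sub s t) =
  2 * form M s s + 2 * form M t t - 4 * form M (kernel_mid s t) (kernel_mid s t).
Proof.
rewrite /kernel_sub /kernel_mid !form_catl !form_catr !form_scalel !form_scaler.
by rewrite (formC t s MC); field.
Qed.

(** The parallelogram law for [s - r] and [r - t], whose sum is [s - t]. With nonnegativity it
    replaces the triangle inequality at the price of a factor 2, and no square roots of fibrewise
    norms arise. *)
Lemma form_sub_trans s r t :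
  2 * form M (kernel_sub s r) (kernel_sub s r) +
  2 * form M (kernel_sub r t) (kernel_sub r t) -
  form M (kernel_sub s t) (kernel_sub s t) =
  form M (s ++ t ++ scale_weights (-2) r) (s ++ t ++ scale_weights (-2) r).
Proof.
rewrite /kernel_sub !(form_catl, form_catr, form_scalel, form_scaler).
by rewrite (formC t s MC) (formC r s MC) (formC r t MC); ring.
Qed.

End form_identities.

Section convex_kernels.
Context (R : realType) (I : Type).
Implicit Types s t : seq (R * I).

Definition convex_weights s : Prop :=
  (forall p, List.In p s -> 0 <= p.1) /\ \sum_(p <- s) p.1 = 1.

Lemma convex_weights_mid s t : convex_weights s -> convex_weights t ->
  convex_weights (kernel_mid s t).
Proof.
have pos (r : seq (R * I)) : (forall p, List.In p r -> 0 <= p.1) ->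
    forall p, List.In p (scale_weights 2^-1 r) -> 0 <= p.1.
  elim: r => [//|p r IH] h q [<-|qr] /=.
    by rewrite mulr_ge0 // ?invr_ge0 //; apply: h; left.
  by apply: IH qr => p' hp'; apply: h; right.
move=> [ps es] [pt et]; split.
  by move=> p hp; case: (List.in_app_or _ _ _ hp) => {}hp; [exact: pos ps _ hp | exact: pos pt _ hp].
by rewrite big_cat !big_map /= -!mulr_sumr es et; field.
Qed.

Lemma sum_weights_le s (F : I -> R) (K : R) : convex_weights s ->
  (forall i, F i <= K) -> \sum_(p <- s) p.1 * F p.2 <= K.
Proof.
move=> [ps es] FK; rewrite -[leRHS]mul1r -es mulr_suml.
elim: s ps {es} => [|p s IH] ps; first by rewrite !big_nil.
rewrite !big_cons lerD ?ler_wpM2l //; first by apply: ps; left.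
by apply: IH => q qs; apply: ps; right.
Qed.

Lemma convex_weight_le1 s p : convex_weights s -> List.In p s -> `|p.1| <= 1.
Proof.
move=> [ps <-] ps'; rewrite ger0_norm; last exact: ps.
elim: s ps ps' => [//|q s IH] ps [->|ps']; rewrite big_cons.
  rewrite lerDl; have : forall r, List.In r s -> 0 <= r.1 by move=> r rs; apply: ps; right.
  elim: (s) => [|r s0 IH0] h; first by rewrite big_nil.
  by rewrite big_cons addr_ge0 //; [apply: h; left | apply: IH0 => r' ?; apply: h; right].
have h : p.1 <= \sum_(r <- s) r.1 by apply: IH ps' => r rs; apply: ps; right.
by rewrite (le_trans h) // lerDr; apply: ps; left.
Qed.

End convex_kernels.

(** * Convex combinations of kernels along an orbit *)

Section orbit_kernels.
Context (R : realType) (X : mpsystem R) (Y : markov_factor X).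
Context (h : X -> R) (bh : bm h) (h1 : forall x, `|h x| <= 1).
Local Notation mu := (mps_mu X).
Local Notation nu := (mps_mu Y).
Local Notation E := (@condexp R X Y).
Local Notation lift := (@lift R X Y).
Implicit Types (s t r : seq (R * int)) (f : X -> R).

Definition orbit_fun (j : int) (x : X) : R := h (mps_iter j x).
Local Notation u := orbit_fun.
Local Notation Q := (kernel_sq u).
Local Notation op := (kernel_op Y u).
Local Notation form_u s t y := (form (fun i j => gram_sq u i j y) s t).

Lemma bm_orbit j : bm (u j). Proof. exact: bm_iter. Qed.
Local Notation bu := bm_orbit.

Lemma orbit_le1 j x : `|u j x| <= 1. Proof. exact: h1. Qed.

Lemma orbit_iter j n x : u j (mps_iter n x) = u (j + n) x.
Proof. by rewrite /orbit_fun mps_iterD. Qed.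

(** The action of T^n on both tensor factors, since the j-th orbit function composed with T^n is the
    (j + n)-th. *)
Definition shift_kernel (n : int) s : seq (R * int) := [seq (p.1, p.2 + n) | p <- s].

Lemma convex_weights_shift n s : convex_weights s -> convex_weights (shift_kernel n s).
Proof.
move=> [ps es]; split; last by rewrite big_map.
elim: s ps {es} => [//|p s IH] ps q [<-|qs] /=; first by apply: ps; left.
by apply: IH qs => r rs; apply: ps; right.
Qed.

Lemma gram_sq_shift n i j :
  \forall y \ae nu, gram_sq u (i + n) (j + n) y = gram_sq (Y := Y) u i j (mps_iter n y).
Proof.
have b : bm (fun x => u i x * u j x) by bmt; exact: bu.
apply: filterS (condexp_iter Y n b) => y; rewrite /gram_sq => <-.
by congr (E _ y ^+ 2); apply/funext => x; rewrite !orbit_iter.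
Qed.

Lemma form_shift n s t : \forall y \ae nu,
  form_u (shift_kernel n s) (shift_kernel n t) y = form_u s t (mps_iter n y).
Proof.
have : \forall y \ae nu, forall i : int * int,
    gram_sq u (i.1 + n) (i.2 + n) y = gram_sq (Y := Y) u i.1 i.2 (mps_iter n y).
  by apply: ae_forall_count => i; exact: gram_sq_shift.
apply: filterS => y e; rewrite /form big_map; apply: eq_bigr => p _.
by rewrite big_map; apply: eq_bigr => q _ /=; rewrite (e (p.2, q.2)).
Qed.

Lemma kernel_op_sub s t f x : op (kernel_sub s t) f x = op s f x - op t f x.
Proof.
rewrite /kernel_op big_cat big_map; congr (_ + _).
by rewrite -sumrN; apply: eq_bigr => p _ /=; rewrite !mulN1r mulNr.
Qed.

Lemma kernel_op_shift n s f : bm f -> \forall x \ae mu,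
  op (shift_kernel n s) (fun x => f (mps_iter n x)) x = op s f (mps_iter n x).
Proof.
move=> bf.
have bj j : bm (fun x => u j x * f x) by bmt; exact: bu.
have : \forall x \ae mu, forall j : int,
    lift (E (fun x => u (j + n) x * f (mps_iter n x))) x =
    lift (E (fun x => u j x * f x)) (mps_iter n x).
  have : forall j : int, \forall x \ae mu,
      lift (E (fun x => u (j + n) x * f (mps_iter n x))) x =
      lift (E (fun x => u j x * f x)) (mps_iter n x).
    move=> j; have bE := bm_condexp Y (bj j).
    have bE' : bm (E (fun x => u (j + n) x * f (mps_iter n x))).
      by apply: bm_condexp; bmt; [exact: bu | exact: bm_iter].
    have e := lift_ext bE' (bm_iter n bE).
    apply: filterS2 (lift_iter n bE) (e _) => [x <- <- //|].
    apply: filterS (condexp_iter Y n (bj j)) => y <-.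
    by congr (E _ y); apply/funext => x; rewrite orbit_iter.
  by move=> hj; apply: ae_forall_count.
apply: filterS => x e; rewrite /kernel_op big_map; apply: eq_bigr => p _ /=.
by rewrite e orbit_iter.
Qed.

Definition hs_sq s : R := Rintegral nu setT (Q s).

Lemma hs_sq_ge0 s : 0 <= hs_sq s.
Proof. exact: int_ge0_ae (bm_kernel_sq Y s bu) (kernel_sq_ge0 Y s bu). Qed.

Lemma hs_sq_shift n s : hs_sq (shift_kernel n s) = hs_sq s.
Proof.
have bQ := bm_kernel_sq Y s bu.
rewrite /hs_sq -[RHS](int_iter n bQ); apply: int_ae_eq.
- exact: (bm_kernel_sq Y _ bu).
- exact: bm_iter.
- exact: form_shift.
Qed.

Lemma hs_sq_parallelogram s t :
  hs_sq (kernel_sub s t) = 2 * hs_sq s + 2 * hs_sq t - 4 * hs_sq (kernel_mid s t).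
Proof.
rewrite /hs_sq -!intZ; try exact: (bm_kernel_sq Y _ bu).
have b r := bm_kernel_sq Y r bu.
rewrite -intD -?intB; bmt; try exact: b.
apply: eq_Rintegral => y _; apply: form_parallelogram => i j; exact: gram_sqC.
Qed.

Lemma kernel_sq_sub_trans s r t : \forall y \ae nu,
  Q (kernel_sub s t) y <= 2 * Q (kernel_sub s r) y + 2 * Q (kernel_sub r t) y.
Proof.
apply: filterS (kernel_sq_ge0 Y (s ++ t ++ scale_weights (-2) r) bu) => y.
by rewrite /kernel_sq -form_sub_trans ?subr_ge0 // => i j; exact: gram_sqC.
Qed.

Lemma int_kernel_op_sq_le s f : bm f -> (forall x, `|f x| <= 1) ->
  Rintegral mu setT (fun x => op s f x ^+ 2) <= hs_sq s.
Proof.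
move=> bf f1; have bo : bm (fun x => op s f x ^+ 2).
  by bmt; apply: bm_kernel_op => //; exact: bu.
rewrite -(int_condexp Y bo); apply: le_int_ae.
- exact: bm_condexp.
- exact: (bm_kernel_sq Y _ bu).
- exact: (kernel_op_sq_le Y s bu).
Qed.

Definition hs_inf : R := inf [set hs_sq s | s in @convex_weights R int].

Lemma hs_inf_le s : convex_weights s -> hs_inf <= hs_sq s.
Proof.
move=> cs; apply: ge_inf; last by exists s.
by exists 0 => _ [t _ <-]; exact: hs_sq_ge0.
Qed.

Lemma hs_inf_approx (e : R) : 0 < e ->
  exists s, convex_weights s /\ hs_sq s <= hs_inf + e.
Proof.
move=> e0; have [] := @inf_adherent _ [set hs_sq s | s in @convex_weights R int] e e0.
  split; last by exists 0 => _ [t _ <-]; exact: hs_sq_ge0.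
  exists (hs_sq [:: (1, 0)]), [:: (1, 0)] => //; split; last by rewrite big_seq1.
  by move=> p [<- /=|[]].
move=> _ [s cs <-] hs; exists s; split => //; exact: ltW.
Qed.

(** The midpoint of two convex combinations is one again, so its norm is at least the infimum, and
    the parallelogram law bounds the difference. *)
Lemma hs_sq_sub_le s t : convex_weights s -> convex_weights t ->
  hs_sq (kernel_sub s t) <= 2 * (hs_sq s - hs_inf) + 2 * (hs_sq t - hs_inf).
Proof.
move=> cs ct; have := hs_inf_le (convex_weights_mid cs ct).
rewrite hs_sq_parallelogram; lra.
Qed.

(* The rate is chosen so that the bad sets of consecutive differences, cut at
   level 8^-m, have summable measure by Markov's inequality. *)
Lemma near_minimizers : exists a : nat -> seq (R * int),
  (forall m, convex_weights (a m)) /\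
  (forall m, hs_sq (a m) <= hs_inf + (64^-1) ^+ m).
Proof.
have h0 m : 0 < (64^-1) ^+ m :> R by rewrite exprn_gt0.
have /choice [a ha] := fun m => hs_inf_approx (h0 m).
by exists a; split => m; have [] := ha m.
Qed.

Lemma kernel_op_le1 s f x : convex_weights s -> bm f -> (forall x, `|f x| <= 1) ->
  `|op s f x| <= 1.
Proof.
move=> cs bf f1; apply: le_trans (ler_norm_sum _ _ _) _.
have step j : `|u j x * lift (E (fun x => u j x * f x)) x| <= 1.
  rewrite normrM mulr_ile1 //; first exact: orbit_le1.
  have b : bm (fun x => u j x * f x) by bmt; exact: bu.
  apply: lift_bound; first exact: bm_condexp.
  apply: condexp_bound => // z; rewrite normrM mulr_ile1 //; exact: orbit_le1.
apply: le_trans (sum_weights_le cs step).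
case: cs => ps _; elim: s ps => [|p s IH] ps; first by rewrite !big_nil.
rewrite !big_cons; apply: lerD.
  by rewrite normrM ler_wpM2r // ger0_norm //; apply: ps; left.
by apply: IH => q qs; apply: ps; right.
Qed.

End orbit_kernels.

Lemma nneseries_geometric (R : realType) (K z : R) : 0 <= z < 1 ->
  (\sum_(n <oo) (K * z ^+ n)%:E = (K / (1 - z))%:E)%E.
Proof.
move=> /andP[z0 z1]; apply/cvg_lim => //.
rewrite (_ : (fun n => _) = EFin \o series (fun n => K * z ^+ n)).
  apply: cvg_EFin; first exact: nearW.
  by apply: cvg_geometric_series; rewrite ger0_norm.
by apply/funext => n /=; rewrite /series /= -sumEFin.
Qed.

(** * Gluing along a partition of the factor *)

Section glueing.
Context d (T : measurableType d) (R : realType) (P : probability T R).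

(** The sums over the first n sets are eventually constant at every point, so they converge, to 0
    off the union. *)
Lemma glue_bounded (B : nat -> set T) (v : nat -> T -> R) (K : R) :
  (forall i, measurable (B i)) -> trivIset setT B -> (forall i, bm (v i)) ->
  (forall i x, `|v i x| <= K) ->
  exists w, [/\ bm w, forall x, `|w x| <= K &
    forall i, \forall x \ae P, B i x -> w x = v i x].
Proof.
move=> mB tB bv vK; pose g n x := \sum_(i < n) \1_(B i) x * v i x.
have g0 n x : (forall i : nat, (i < n)%N -> ~ B i x) -> g n x = 0.
  move=> nB; rewrite /g big1 // => i _; rewrite indicE memNset ?mul0r //.
  exact: nB.
have gE n x i : (i < n)%N -> B i x -> g n x = v i x.
  move=> lin Bix; rewrite /g (bigD1 (Ordinal lin)) //= indicE mem_set // mul1r.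
  rewrite big1 ?addr0 // => j /eqP ji; rewrite indicE memNset ?mul0r // => Bjx.
  by apply: ji; apply: val_inj; apply: (tB j i) => //; exists x.
have bg n : bm (g n) by apply: bm_sum => i; apply: bmM; [apply: bm_indic; exact: mB | exact: bv].
have gK n x : `|g n x| <= K.
  have [[i [lin Bix]]|nB] := pselect (exists i, (i < n)%N /\ B i x).
    by rewrite (gE n x i).
  rewrite g0 ?normr0 ?(le_trans _ (vK 0%N x)) // => i lin Bix.
  by apply: nB; exists i.
have cg x : cvgn (g ^~ x).
  have [[i Bix]|nB] := pselect (exists i, B i x); apply/cvg_ex.
    exists (v i x); apply: cvg_near_cst; near=> n; apply: gE => //.
    near: n; exact: nbhs_infty_gt.
  exists 0; apply: cvg_near_cst; apply: nearW => n; apply: g0 => i _ Bix.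
  by apply: nB; exists i.
have [w [bw wK gw]] := bounded_limit bg gK (aeW P cg).
exists w; split => // i; apply: filterS gw => x gx Bix.
have : g ^~ x @ \oo --> v i x.
  apply: cvg_near_cst; near=> n; apply: gE => //.
  near: n; exact: nbhs_infty_gt.
by move=> /cvg_lim <- //; rewrite (cvg_lim _ gx).
Unshelve. all: by end_near. Qed.

End glueing.

Section lifted_sets.
Context (R : realType) (X : mpsystem R) (Y : markov_factor X).
Local Notation mu := (mps_mu X).
Local Notation nu := (mps_mu Y).
Local Notation lift := (@lift R X Y).

(** [J] is multiplicative, so the image of an indicator is idempotent. *)
Lemma lift_indic01 (A : set Y) : measurable A ->
  \forall x \ae mu, lift \1_A x = 0 \/ lift \1_A x = 1.
Proof.
move=> mA; have bA : bm (\1_A : Y -> R) by exact: bm_indic.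
apply: filterS (liftM bA bA) => x.
rewrite (_ : (fun y => _) = \1_A); last first.
  by apply/funext => y; rewrite indicE; case: (_ \in _); rewrite ?mulr1 ?mulr0.
move=> h; have : lift \1_A x * (1 - lift \1_A x) = 0.
  by rewrite mulrBr mulr1 -h subrr.
move=> /eqP; rewrite mulf_eq0 subr_eq0 => /orP[/eqP|/eqP]; first by left.
by move=> <-; right.
Qed.

Lemma lift_disjoint (A B : set Y) : measurable A -> measurable B ->
  A `&` B = set0 -> \forall x \ae mu, lift \1_A x * lift \1_B x = 0.
Proof.
move=> mA mB AB; have bA : bm (\1_A : Y -> R) by exact: bm_indic.
have bB : bm (\1_B : Y -> R) by exact: bm_indic.
apply: filterS2 (liftM bA bB) (lift_cst Y 0) => x <-.
rewrite (_ : (fun y => _ * _) = fun=> 0) //; apply/funext => y.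
rewrite !indicE; case: (boolP (y \in A)) => [|_]; last by rewrite mul0r.
case: (boolP (y \in B)) => [|_]; last by rewrite mulr0.
by rewrite !inE => By Ay; exfalso; have : (A `&` B) y by []; rewrite AB.
Qed.

(** There is no point map to pull the partition back along, so the sets where the lifted indicators
    equal 1 take its place. They are disjoint only up to null sets, hence the passage to [seqDU]. *)
Lemma glue_lift (C : nat -> set Y) (v : nat -> X -> R) (K : R) :
  (forall i, measurable (C i)) -> trivIset setT C -> (forall i, bm (v i)) ->
  (forall i x, `|v i x| <= K) ->
  exists w, [/\ bm w, forall x, `|w x| <= K &
    forall i, \forall x \ae mu, lift \1_(C i) x * w x = lift \1_(C i) x * v i x].
Proof.
move=> mC tC bv vK.
pose B i := [set x | lift \1_(C i) x = 1].
have mB i : measurable (B i).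
  have [ml _] : bm (lift \1_(C i)) by apply: bm_lift; exact: bm_indic.
  have -> : B i = lift \1_(C i) @^-1` [set 1] by [].
  by rewrite -[X in measurable X]setTI; apply: ml => //; exact: measurable_set1.
have [w [bw wK wE]] := glue_bounded mu (seqDU_measurable mB)
  (trivIset_seqDU B) bv vK.
exists w; split => // i.
have dis : \forall x \ae mu, forall k, k <> i ->
    lift \1_(C i) x * lift \1_(C k) x = 0.
  apply: ae_foralln => k; have [->|ki] := eqVneq k i; first exact: nearW.
  have CC : C i `&` C k = set0.
    apply/seteqP; split => // y [Ci Ck]; move/eqP: ki; apply.
    by apply: (tC k i) => //; exists y.
  by apply: filterS (lift_disjoint (mC i) (mC k) CC).
apply: filterS3 dis (wE i) (lift_indic01 (mC i)) => x dx wx [->|li].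
  by rewrite !mul0r.
suff Bx : seqDU B i x by rewrite (wx Bx).
rewrite /seqDU -bigcup_mkord; split => // -[k /= ki Bk].
have := dx k; rewrite li mul1r Bk => /(_ _) h.
have : (1 : R) = 0 by apply: h => e; rewrite e ltnn in ki.
by move/eqP; rewrite oner_eq0.
Qed.

End lifted_sets.

(** * Recurrence in the factor *)

Section hitting.
Context (R : realType) (X : mpsystem R) (Y : markov_factor X) (hX : ergodic X).
Local Notation mu := (mps_mu X).
Local Notation nu := (mps_mu Y).
Local Notation lift := (@lift R X Y).

(** The union of all shifts of [A] is invariant, and its indicator lifts to that of a set which is
    invariant up to a null set and has the same measure; ergodicity of [X] makes this measure 1. *)
Lemma ergodic_hitting (A : set Y) : measurable A -> (0 < nu A)%E ->
  \forall y \ae nu, exists t : int, A (mps_iter t y).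
Proof.
move=> mA A0.
pose S (k : nat) : set Y := if unpickle k is Some t then mps_iter t @^-1` A else set0.
have mS k : measurable (S k).
  by rewrite /S; case: unpickle => // t; exact: mps_iter_preimage_measurable.
pose B := \bigcup_k S k; have mB : measurable B by exact: bigcup_measurable.
have BP y : B y <-> exists t : int, A (mps_iter t y).
  split=> [[k _]|[t At]]; first by rewrite /S; case: unpickle => // t; exists t.
  by exists (pickle t); [exact: I | rewrite /S pickleK].
have Binv y : B (mps_iter 1 y) <-> B y.
  rewrite !BP; split=> -[t At]; first by exists (t + 1); rewrite mps_iterD.
  by exists (t - 1); rewrite -mps_iterD subrK.
have bB : bm (\1_B : Y -> R) by exact: bm_indic.
pose B' := [set x | lift \1_B x = 1].
have mB' : measurable B'.
  have [ml _] := bm_lift bB.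
  have -> : B' = lift \1_B @^-1` [set 1] by [].
  by rewrite -[X in measurable X]setTI; apply: ml => //; exact: measurable_set1.
have muB' : mu B' = nu B.
  have : fine (mu B') = fine (nu B).
    rewrite -!int_indic // -(int_lift bB); apply: int_ae_eq.
    - exact: bm_indic.
    - exact: bm_lift.
    apply: filterS (lift_indic01 mB) => x.
    rewrite indicE; case: (boolP (x \in B')) => [|xB]; first by rewrite inE /B' /= => ->.
    by move=> [->|] // l1; move: xB; rewrite notin_setE.
  by move=> e; rewrite -[LHS]fineK ?fin_num_measure // e fineK ?fin_num_measure.
have nuB0 : (0 < nu B)%E.
  apply: lt_le_trans A0 _; apply: le_measure; rewrite ?inE // => y Ay.
  by apply/BP; exists 0.
have inv0 : mu (@mps_map R X @^-1` B' `\` B') = 0%E.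
  have : \forall x \ae mu, lift \1_B (mps_iter 1 x) = lift \1_B x.
    apply: filterS (lift_iter 1 bB) => x <-; congr (lift _ x).
    apply/funext => y; rewrite !indicE; congr (_%:R); congr nat_of_bool.
    by apply/idP/idP; rewrite !inE; apply Binv.
  move=> [N [mN N0 NB]]; apply: (subset_measure0 _ mN _ N0).
    apply: measurableD => //.
    by rewrite -[X in measurable X]setTI; exact: mps_map_measurable.
  by move=> x [/= Bx nBx]; apply: NB => /= e; apply: nBx; rewrite /B' /= -e.
have nuB : nu B = 1%E.
  rewrite -muB'; case: (hX mB' inv0) => // e.
  by move: nuB0; rewrite -muB' e ltxx.
exists (~` B); split; first exact: measurableC.
  by rewrite probability_setC // nuB subee.
by move=> y /= ny By; apply: ny; apply/BP.
Qed.

End hitting.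

(** * Comparison with the complex conditional norm *)

Section complex_factor.
Context (R : realType) (X : mpsystem R) (Y : markov_factor X).
Local Notation mu := (mps_mu X).
Local Notation nu := (mps_mu Y).
Local Notation J := (@mf_op R X Y).
Local Notation E := (@condexp R X Y).
Local Notation lift := (@lift R X Y).

Lemma Rint_ae_eq (Z : mpsystem R) (f g : Z -> R) : measurable_fun setT f ->
  measurable_fun setT g -> (\forall x \ae mps_mu Z, f x = g x) ->
  Rintegral (mps_mu Z) setT f = Rintegral (mps_mu Z) setT g.
Proof.
move=> mf mg fg; congr fine; apply: ae_eq_integral => //.
- exact/measurable_EFinP.
- exact/measurable_EFinP.
- by apply: filterS fg => x -> _.
Qed.

Lemma mf_op_cbm (c : Y -> R[i]) : cbm c -> \forall x \ae mu,
  J c x = Complex (lift (fun y => complex.Re (c y)) x)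
                  (lift (fun y => complex.Im (c y)) x).
Proof.
move=> [br bi].
have h := @mf_linear _ _ Y (Complex 0 1) _ _ (rc_cLp1 bi) (rc_cLp1 br).
apply: filterS3 h (liftE br) (liftE bi) => x h e1 e2; move: h; rewrite e1 e2.
rewrite (_ : (fun y => _) = c); last first.
  by apply/funext => y; rewrite /rc; case: (c y) => a b; simpc.
by move=> ->; simpc.
Qed.

Lemma cLnormy_le (Z : mpsystem R) (G : Z -> R[i]) (K : R) :
  (\forall x \ae mps_mu Z, cabs G x <= K) -> (cLnorm +oo%E G <= K%:E)%E.
Proof.
move=> GK; rewrite /cLnorm unlock mps_mu_gt0; apply/ess_supP.
by apply: filterS GK => x h /=; rewrite ger0_norm ?cabs_ge0 // lee_fin.
Qed.

(** Test functions in the definition are bounded only almost everywhere. Exchanging each for a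
    bounded representative [c'] turns the complex duality into two real integrals involving
    [lift]. *)
Lemma is_cond_expectation_rc (f : X -> R[i]) (w : X -> R) : cmeasurable f ->
  bm w -> (\forall x \ae mu, cabs f x ^+ 2 = w x) ->
  forall g, is_cond_expectation (Y := Y) (fun x => ((cabs f x) ^+ 2)%:C%C) g <->
    (cLp 1%:E g /\ forall c : Y -> R[i], cLp +oo%E c -> forall c', cbm c' -> cae_eq c c' ->
      cintegral (fun y => c y * g y) =
      Complex (Rintegral mu setT (fun x => lift (fun y => complex.Re (c' y)) x * w x))
              (Rintegral mu setT (fun x => lift (fun y => complex.Im (c' y)) x * w x))).
Proof.
move=> mf bw fw g.
have mc : measurable_fun setT (fun x => cabs f x ^+ 2).
  by apply: measurable_funX; exact: measurable_cabs.
have key (c c' : Y -> R[i]) : cLp +oo%E c -> cbm c' -> cae_eq c c' ->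
    cintegral (fun x => J c x * ((cabs f x) ^+ 2)%:C%C) =
    Complex (Rintegral mu setT (fun x => lift (fun y => complex.Re (c' y)) x * w x))
              (Rintegral mu setT (fun x => lift (fun y => complex.Im (c' y)) x * w x)).
  move=> Lc bc' cc'.
  have c'1 : cLp 1%:E c' by exact: cbm_cLp.
  have c1 : cLp 1%:E c.
    split; first by case: Lc.
    rewrite (_ : cLnorm 1 c = cLnorm 1 c'); first by case: c'1.
    rewrite /cLnorm !Lnorm1; apply: ae_eq_integral => //.
    - do 2 apply: measurableT_comp => //; apply: measurable_cabs; by case: Lc.
    - do 2 apply: measurableT_comp => //; apply: measurable_cabs; by case: c'1.
    - by apply: filterS cc' => x; rewrite /cabs /= => ->.
  have [[mJr mJi] _] := mf_L1 c1.
  have Jc := mf_ae c1 c'1 cc'.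
  have [bl1 bl2] := (bm_lift bc'.1, bm_lift bc'.2).
  have bw1 := bmM bl1 bw; have bw2 := bmM bl2 bw.
  have Jw : \forall x \ae mu, J c x * ((cabs f x) ^+ 2)%:C%C =
    Complex (lift (fun y => complex.Re (c' y)) x * w x)
            (lift (fun y => complex.Im (c' y)) x * w x).
    by apply: filterS3 Jc (mf_op_cbm bc') fw => x -> -> ->; simpc.
  congr Complex; apply: Rint_ae_eq.
  - rewrite (_ : (fun x => _) = (fun x => complex.Re (J c x) * cabs f x ^+ 2)).
      exact: measurable_funM.
    by apply/funext => x; case: (J c x) => a b; simpc.
  - exact: bw1.1.
  - by apply: filterS Jw => x ->.
  - rewrite (_ : (fun x => _) = (fun x => complex.Im (J c x) * cabs f x ^+ 2)).
      exact: measurable_funM.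
    by apply/funext => x; case: (J c x) => a b; simpc.
  - exact: bw2.1.
  - by apply: filterS Jw => x ->.
split=> -[Lg gE]; split => // c Lc.
  by move=> c' bc' cc'; rewrite gE // (key c c').
have [c' bc' cc'] := cLpy_cbm Lc.
by rewrite (gE c Lc c' bc' cc') (key c c').
Qed.

(** [cond_expectation] is an arbitrary choice among the functions satisfying the duality. [rc (E w)]
    is one of them, so the choice satisfies it too, and testing with indicators identifies its real
    part. *)
Lemma cond_expectation_ae (f : X -> R[i]) (w : X -> R) : cmeasurable f ->
  bm w -> (\forall x \ae mu, cabs f x ^+ 2 = w x) ->
  let g : Y -> R[i] := cond_expectation (fun x => ((cabs f x) ^+ 2)%:C%C) in
  cmeasurable g /\ \forall y \ae nu, complex.Re (g y) = E w y.
Proof.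
move=> mf bw fw g; have iff := is_cond_expectation_rc mf bw fw.
have bE := bm_condexp Y bw.
have : is_cond_expectation (Y := Y) (fun x => ((cabs f x) ^+ 2)%:C%C) (rc (E w)).
  apply/iff; split; first exact: rc_cLp1.
  move=> c Lc c' bc' cc'; have [[mr mi] _] := Lc.
  rewrite !int_condexpM //; last 2 first.
  - by case: bc'.
  - by case: bc'.
  congr Complex; apply: Rint_ae_eq.
  - rewrite (_ : (fun y => _) = (fun y => complex.Re (c y) * E w y)).
      by apply: measurable_funM => //; case: bE.
    by apply/funext => y; rewrite /rc; case: (c y) => a b; simpc.
  - by apply: measurable_funM; [case: bc'.1 | case: bE].
  - by apply: filterS cc' => y ->; rewrite /rc; case: (c' y) => a b; simpc.
  - rewrite (_ : (fun y => _) = (fun y => complex.Im (c y) * E w y)).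
      by apply: measurable_funM => //; case: bE.
    by apply/funext => y; rewrite /rc; case: (c y) => a b; simpc.
  - by apply: measurable_funM; [case: bc'.2 | case: bE].
  - by apply: filterS cc' => y ->; rewrite /rc; case: (c' y) => a b; simpc.
move=> /(xgetI (fun=> 0)) /iff [Lg gE]; split; first by case: Lg.
have [ig _] := cLp1_integrable Lg.
have mg : measurable_fun setT (fun y => complex.Re (g y)) by case: Lg => -[].
suff : ae_eq nu setT (EFin \o (fun y => complex.Re (g y))) (EFin \o E w).
  by apply: filterS => y /(_ I) [].
apply: integral_ae_eq => //; first by apply/measurable_EFinP; case: bE.
move=> A _ mA; have bA : bm (\1_A : Y -> R) by exact: bm_indic.
have := gE (rc \1_A) (cbm_cLp (leey _) (cbm_rc bA)) (rc \1_A) (cbm_rc bA)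
  (aeW _ (fun=> erefl)).
move=> /(congr1 (@complex.Re R)) /=; rewrite int_condexpM //.
rewrite (_ : Rintegral nu setT (fun y => complex.Re (rc \1_A y * g y)) =
  fine (\int[nu]_(y in A) (complex.Re (g y))%:E)%E); last first.
  rewrite [in RHS]integral_mkcond /Rintegral; congr fine.
  apply: eq_integral => y _; rewrite patchE /rc indicE.
  by case: (g y) => a b; case: (y \in A); simpc; rewrite ?mul1r ?mul0r.
rewrite (_ : Rintegral nu setT (fun y => \1_A y * E w y) =
  fine (\int[nu]_(y in A) (E w y)%:E)%E); last first.
  rewrite [in RHS]integral_mkcond /Rintegral; congr fine.
  apply: eq_integral => y _; rewrite patchE indicE.
  by case: (y \in A); rewrite ?mul1r ?mul0r.
have f1 : (\int[nu]_(y in A) (complex.Re (g y))%:E)%E \is a fin_num.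
  by apply: integrable_fin_num => //; apply: integrableS ig.
have f2 : (\int[nu]_(y in A) (E w y)%:E)%E \is a fin_num.
  by apply: integrable_fin_num => //; apply: integrableS (bm_integrable nu bE).
by move=> e; rewrite -[LHS]fineK // e fineK.
Qed.

Lemma cond_norm_ae (f : X -> R[i]) (w : X -> R) : cmeasurable f ->
  bm w -> (\forall x \ae mu, cabs f x ^+ 2 = w x) ->
  cmeasurable (@cond_norm R X Y f) /\
  \forall y \ae nu, cabs (@cond_norm R X Y f) y = Num.sqrt (E w y).
Proof.
move=> mf bw fw; have [[mg _] gE] := cond_expectation_ae mf bw fw; split.
  split; last exact: measurable_cst.
  have : measurable_fun setT (fun y => Num.sqrt (complex.Re (cond_expectation
      (Y := Y) (fun x => ((cabs f x) ^+ 2)%:C%C) y))).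
    apply: measurableT_comp; last exact: mg.
    by apply: continuous_measurable_fun; exact: sqrt_continuous.
  by [].
apply: filterS gE => y e; rewrite cabsE /= expr0n addr0 sqrtr_sqr.
by rewrite ger0_norm ?sqrtr_ge0 // e.
Qed.

Lemma cbm_cond_L2 (f : X -> R) : bm f -> cond_L2 Y (rc f).
Proof.
move=> bf; split; first by apply: cbm_cLp; [rewrite lee1n | exact: cbm_rc].
have mf : cmeasurable (rc f).
  by case: (cbm_rc bf) => -[m1 _] [m2 _].
have bw : bm (fun x => f x ^+ 2) by bmt.
have [] := cond_norm_ae mf bw (aeW _ (fun x => _)).
  by move=> fE; rewrite cabs_rc real_normK // num_real.
move=> mn nE; split => //; case: (bm_condexp Y bw) => _ [K EK].
apply: le_lt_trans (ltry (Num.sqrt K)); apply: cLnormy_le.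
apply: filterS nE => y ->; apply: ler_wsqrtr.
exact: le_trans (ler_norm _) (EK y).
Qed.

Lemma complex_ReB (p q : R[i]) : complex.Re (p - q) = complex.Re p - complex.Re q.
Proof. by case: p q => [a b] [c e]. Qed.

Lemma complex_ImB (p q : R[i]) : complex.Im (p - q) = complex.Im p - complex.Im q.
Proof. by case: p q => [a b] [c e]. Qed.

Lemma Re_sum (I : Type) (s : seq I) (F : I -> R[i]) :
  complex.Re (\sum_(i <- s) F i) = \sum_(i <- s) complex.Re (F i).
Proof. by apply: (big_morph (@complex.Re R)) => // -[a b] [c e]. Qed.

Lemma Im_sum (I : Type) (s : seq I) (F : I -> R[i]) :
  complex.Im (\sum_(i <- s) F i) = \sum_(i <- s) complex.Im (F i).
Proof. by apply: (big_morph (@complex.Im R)) => // -[a b] [c e]. Qed.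

(** For bounded real data the conditional norm is the square root of the real [condexp] of a square,
    so the condition can be checked without complex functions or essential suprema. *)
Lemma cond_ap_rc (F : X -> R) : bm F ->
  (forall e : R, 0 < e -> exists (m : nat) (v : 'I_m -> X -> R),
     (forall j, bm (v j)) /\ forall n : int, exists c : 'I_m -> Y -> R,
       (forall j, bm (c j) /\ forall y, `|c j y| <= 1) /\
       \forall y \ae nu, E (fun x => (F (mps_iter n x) -
          \sum_(j < m) lift (c j) x * v j x) ^+ 2) y <= e ^+ 2) ->
  cond_ap Y (rc F).
Proof.
move=> bF hF; split; first exact: cbm_cond_L2.
(* The criterion yields [<=] while the definition asks for a strict inequality, whence the half. *)
move=> e e0; have e20 : 0 < e / 2 by rewrite divr_gt0.
have [m [v [bv vE]]] := hF _ e20.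
exists m, (fun j => rc (v j)); split; first by move=> j; exact: cbm_cond_L2.
move=> n; have [c [bc cE]] := vE n.
exists (fun j => rc (c j)); split.
  move=> j; have [bcj cj1] := bc j; split.
    by apply: cbm_cLp; [exact: leey | exact: cbm_rc].
  by apply: cLnormy_le; apply: nearW => y; rewrite cabs_rc.
set G := (fun x => _ - _).
have mJ j : cmeasurable (J (rc (c j))).
  by have [] := mf_L1 (rc_cLp1 (proj1 (bc j))).
have ReG x : complex.Re (G x) = F (mps_iter n x) -
    \sum_(j < m) complex.Re (J (rc (c j)) x) * v j x.
  rewrite /G complex_ReB Re_sum; congr (_ - _); apply: eq_bigr => j _.
  by rewrite /rc; case: (J _ x) => a b; simpc.
have ImG x : complex.Im (G x) = 0 -
    \sum_(j < m) complex.Im (J (rc (c j)) x) * v j x.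
  rewrite /G complex_ImB Im_sum; congr (_ - _); apply: eq_bigr => j _.
  by rewrite /rc; case: (J _ x) => a b; simpc.
have mG : cmeasurable G.
  split.
    rewrite (_ : (fun x => _) = (fun x => F (mps_iter n x) -
       \sum_(j < m) complex.Re (J (rc (c j)) x) * v j x)); last exact/funext.
    apply: measurable_funB; first by case: (bm_iter n bF).
    apply: measurable_sum => j; apply: measurable_funM; last by case: (bv j).
    by case: (mJ j).
  rewrite (_ : (fun x => _) = (fun x => 0 -
     \sum_(j < m) complex.Im (J (rc (c j)) x) * v j x)); last exact/funext.
  apply: measurable_funB; first exact: measurable_cst.
  apply: measurable_sum => j; apply: measurable_funM; last by case: (bv j).
  by case: (mJ j).
have bW : bm (fun x => (F (mps_iter n x) -
    \sum_(j < m) lift (c j) x * v j x) ^+ 2).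
  bmt; first exact: bm_iter.
  by apply: bm_sum => j; apply: bmM; [apply: bm_lift; case: (bc j) | exact: bv].
have GW : \forall x \ae mu, cabs G x ^+ 2 = (F (mps_iter n x) -
    \sum_(j < m) lift (c j) x * v j x) ^+ 2.
  have : \forall x \ae mu, forall j : 'I_m, J (rc (c j)) x = (lift (c j) x)%:C%C.
    by apply: ae_forall_count => j; apply: liftE; case: (bc j).
  apply: filterS => x h'; rewrite sqr_cabs ReG ImG.
  rewrite [X in _ + (0 - X) ^+ 2]big1 ?subrr ?expr0n ?addr0; last first.
    by move=> j _; rewrite h' mul0r.
  by congr ((_ - _) ^+ 2); apply: eq_bigr => j _; rewrite h'.
have [mn nE] := cond_norm_ae mG bW GW.
apply: (@le_lt_trans _ _ (e / 2)%:E); last by rewrite lte_fin; lra.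
apply: cLnormy_le; apply: filterS2 nE cE => y -> h.
by rewrite -[leRHS](ger0_norm (ltW e20)) -sqrtr_sqr; apply: ler_wsqrtr.
Qed.

End complex_factor.

(** * Limits of near-minimal kernels are almost periodic *)

Section almost_periodic_limit.
Context (R : realType) (X : mpsystem R) (Y : markov_factor X).
Context (h : X -> R) (bh : bm h) (h1 : forall x, `|h x| <= 1).
Context (f : X -> R) (bf : bm f) (f1 : forall x, `|f x| <= 1).
Local Notation mu := (mps_mu X).
Local Notation nu := (mps_mu Y).
Local Notation E := (@condexp R X Y).
Local Notation lift := (@lift R X Y).
Local Notation u := (orbit_fun h).
Local Notation Q := (@kernel_sq R X Y int u).
Local Notation op := (kernel_op Y u).
Local Notation hs := (@hs_sq R X Y h).
Local Notation bu := (bm_orbit bh).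

Context (a : nat -> seq (R * int)) (ca : forall m, convex_weights (a m)).
Context (ma : forall m, hs (a m) <= hs_inf Y h + (64^-1) ^+ m).

Definition near_step (i : nat) (y : Y) : R := Q (kernel_sub (a i) (a i.+1)) y.

(** The fibres over which the kernels from [a m] on converge at a uniform geometric rate. *)
Definition near_set (m : nat) : set Y :=
  \bigcap_i [set y | near_step (m + i) y <= (8^-1) ^+ (m + i)].

(** A shifted near-minimiser is again a convex combination with the same norm, hence a
    near-minimiser; the bound is uniform in [n]. *)
Lemma hs_sub_shift_le n m :
  hs (kernel_sub (shift_kernel n (a m)) (a m)) <= 4 * (64^-1) ^+ m.
Proof.
apply: le_trans (hs_sq_sub_le Y bh (convex_weights_shift n (ca m)) (ca m)) _.
by rewrite hs_sq_shift //; have := ma m; lra.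
Qed.

Lemma hs_step_le i : hs (kernel_sub (a i) (a i.+1)) <= 4 * (64^-1) ^+ i.
Proof.
apply: le_trans (hs_sq_sub_le Y bh (ca i) (ca i.+1)) _.
have h0 : 0 <= (64^-1) ^+ i :> R by rewrite exprn_ge0.
have := ma i; have := ma i.+1; rewrite exprS; lra.
Qed.

Lemma bm_near_step i : bm (near_step i).
Proof. exact: (bm_kernel_sq Y _ bu). Qed.

Lemma measurable_near_set m : measurable (near_set m).
Proof.
apply: bigcap_measurable => [|i _]; first by exists 0%N.
have [mf _] := bm_near_step (m + i).
have -> : [set y | near_step (m + i) y <= (8^-1) ^+ (m + i)] =
    near_step (m + i) @^-1` `]-oo, (8^-1) ^+ (m + i)].
  by apply/seteqP; split => y /=; rewrite in_itv.
by rewrite -[X in measurable X]setTI; apply: mf.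
Qed.

Lemma near_setS m y : near_set m y -> near_set m.+1 y.
Proof. by move=> hy i _; have := hy i.+1 I; rewrite addnS addSn. Qed.

(** Markov's inequality at level 8^-(m+i) and [hs_step_le] give the i-th bad set measure at most 4 *
    8^-(m+i). The sum 32/7 * 8^-m is at most 4/7 as soon as [m] is positive, but exceeds 1 for
    [m = 0]. *)
Lemma near_set_gt0 m : (0 < m)%N -> (0 < nu (near_set m))%E.
Proof.
move=> m0.
have mA := measurable_near_set m.
pose B i := [set y | (8^-1) ^+ (m + i) < near_step (m + i) y].
have mB i : measurable (B i).
  have [mf _] := bm_near_step (m + i).
  have -> : B i = near_step (m + i) @^-1` `]((8^-1) ^+ (m + i)), +oo[.
    by apply/seteqP; split => y /=; rewrite in_itv /= andbT.
  by rewrite -[X in measurable X]setTI; apply: mf.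
have AB : ~` near_set m = \bigcup_i B i.
  rewrite /near_set setC_bigcap; apply: eq_bigcupr => i _.
  by apply/seteqP; split => y; rewrite /B /= ltNge => /negP.
have nuB i : (nu (B i) <= (4 * (8^-1) ^+ m * (8^-1) ^+ i)%:E)%E.
  rewrite -[nu (B i)]fineK ?fin_num_measure // lee_fin.
  have t0 : 0 < (8^-1) ^+ (m + i) :> R by rewrite exprn_gt0.
  have := int_markov (bm_near_step (m + i))
    (kernel_sq_ge0 Y (kernel_sub (a (m + i)) (a (m + i).+1)) bu) t0.
  move=> /le_trans; apply.
  apply: (@le_trans _ _ (((8^-1) ^+ (m + i))^-1 * (4 * (64^-1) ^+ (m + i)))).
    by rewrite ler_pM2l ?invr_gt0 //; exact: hs_step_le.
  rewrite (_ : 64^-1 = 8^-1 * 8^-1 :> R); last by field.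
  by rewrite exprMn mulrCA mulKf ?lt0r_neq0 // exprD mulrA.
have nuU : (nu (\bigcup_i B i) <= (4 / 7)%:E)%E.
  apply: (@le_trans _ _ (\sum_(i <oo) nu (B i))%E).
    apply: generalized_Boole_inequality => //; exact: bigcup_measurable.
  apply: (@le_trans _ _ (\sum_(i <oo) (4 * (8^-1) ^+ m * (8^-1) ^+ i)%:E)%E).
    by apply: lee_nneseries => i _ //; exact: nuB.
  rewrite nneseries_geometric; last by apply/andP; split; lra.
  rewrite lee_fin; case: (m) m0 => // k _; rewrite exprS.
  have : (8^-1) ^+ k <= 1 :> R by rewrite exprn_ile1 //; lra.
  have -> : 4 * (8^-1 * 8^-1 ^+ k) / (1 - 8^-1) = 4 / 7 * 8^-1 ^+ k :> R by field.
  lra.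
rewrite -[near_set m]setCK probability_setC; last exact: measurableC.
rewrite AB sube_gt0; apply: le_lt_trans nuU _; rewrite lte_fin; lra.
Qed.

(** Between [m] and [M] each step costs a factor 2 in the triangle inequality, which the ratio 1/8
    absorbs: [2 * (4 / 8) + 2 <= 4] in units of 8^-m. *)
Lemma near_set_dist m : \forall y \ae nu, near_set m y -> forall M, (m <= M)%N ->
  Q (kernel_sub (a M) (a m)) y <= 4 * (8^-1) ^+ m.
Proof.
have : \forall y \ae nu, forall ij : nat * nat,
    Q (kernel_sub (a ij.2) (a ij.1)) y <=
    2 * Q (kernel_sub (a ij.2) (a ij.1.+1)) y +
    2 * Q (kernel_sub (a ij.1.+1) (a ij.1)) y.
  by apply: ae_forall_count => ij; apply: kernel_sq_sub_trans.
apply: filterS => y tr ny M mM.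
have C s t : Q (kernel_sub s t) y = Q (kernel_sub t s) y.
  rewrite /kernel_sq /kernel_sub !(form_catl, form_catr, form_scalel, form_scaler).
  ring.
rewrite -(subnK mM); move: (M - m)%N => k {M mM}.
elim: k m ny => [|k IH] m ny.
  rewrite add0n /kernel_sq /kernel_sub !(form_catl, form_catr, form_scalel, form_scaler).
  rewrite (_ : _ + _ = 0); last by ring.
  by rewrite mulr_ge0 // exprn_ge0.
apply: le_trans (tr (m, (k.+1 + m)%N)) _ => /=.
have := IH _ (near_setS ny); rewrite addnS -addSn.
rewrite (C (a m.+1)); have := ny 0%N I; rewrite addn0 /near_step /= => h2 h3.
have h0 : 0 <= (8^-1) ^+ m :> R by rewrite exprn_ge0.
by move: h3; rewrite exprS; lra.
Qed.

Context (F : X -> R) (bF : bm F).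
Context (aF : \forall x \ae mu, (fun m => op (a m) f x) @ \oo --> F x).

Definition defect (m : nat) (n : int) (x : X) : R :=
  F (mps_iter n x) - op (a m) (fun x => f (mps_iter n x)) x.

Lemma bm_defect m n : bm (defect m n).
Proof.
apply: bmD; first exact: bm_iter.
by apply: bmN; apply: bm_kernel_op; [exact: bu | exact: bm_iter].
Qed.

(** T^n F is the limit over [M] of (T^n K_M)(T^n f), so the defect is governed by T^n K_M - K_m.
    This splits into T^n K_M - K_M, whose norm tends to 0 uniformly in [n], and K_M - K_m, which is
    small over [near_set m]. The first part is small only in the mean over Y, so the bound is tested
    against functions supported on [near_set m]. *)
Lemma near_set_defect m n : \forall y \ae nu, near_set m y ->
  E (fun x => defect m n x ^+ 2) y <= 8 * (8^-1) ^+ m.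
Proof.
have bfn := bm_iter n bf.
have fn1 x : `|f (mps_iter n x)| <= 1 by exact: f1.
have mA := measurable_near_set m.
have bA : bm (\1_(near_set m) : Y -> R) by exact: bm_indic.
have bd := bm_defect m n.
have bd2 : bm (fun x => defect m n x ^+ 2) by bmt.
have bE := bm_condexp Y bd2.
pose K : R := 8 * (8^-1) ^+ m.
suff : \forall y \ae nu, \1_(near_set m) y * E (fun x => defect m n x ^+ 2) y <=
    \1_(near_set m) y * K.
  by apply: filterS => y + Ay; rewrite indicE mem_set // !mul1r.
apply: ae_le_test; [bmt | bmt |] => c bc c0.
pose e y := c y * \1_(near_set m) y.
have be : bm e by rewrite /e; bmt.
have e0 y : 0 <= e y by rewrite /e mulr_ge0 // indicE.
have [_ [C cC]] := bc.
have eC y : e y <= C.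
  rewrite /e indicE; have := cC y; rewrite ger0_norm // => cy.
  by case: (_ \in _); rewrite ?mulr1 // mulr0 (le_trans (c0 y)).
have eC' y : `|e y| <= C by rewrite ger0_norm.
have C0 : 0 <= C by have [y0 _] := mps_inhabited Y; exact: le_trans (e0 y0) (eC y0).
rewrite (_ : (fun y => c y * (_ * E _ y)) = (fun y => e y * E (fun x => defect m n x ^+ 2) y));
  last by apply/funext => y; rewrite /e mulrA.
rewrite (_ : (fun y => c y * (_ * K)) = (fun y => e y * K)); last first.
  by apply/funext => y; rewrite /e mulrA.
rewrite -int_condexpM //.
have ble := bm_lift be.
pose G M x := op (a M) f (mps_iter n x) - op (a m) (fun x => f (mps_iter n x)) x.
have bop s := bm_kernel_op Y s bu bf.
have bopn s := bm_kernel_op Y s bu bfn.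
have bG M : bm (G M).
  by apply: bmD; [exact: (bm_iter n (bop (a M))) | apply: bmN; exact: bopn].
have limG : (fun M => Rintegral mu setT (fun x => lift e x * G M x ^+ 2)) @ \oo -->
    Rintegral mu setT (fun x => lift e x * defect m n x ^+ 2).
  apply: (@int_dominated _ _ _ _ _ _ (C * 2 ^+ 2)).
  - by move=> M; bmt; exact: bG.
  - by bmt.
  - move=> M x; rewrite normrM ler_pM //; first exact: lift_bound.
    rewrite normrX lerXn2r ?nnegrE // /G; apply: le_trans (ler_normB _ _) _.
    have k1 := kernel_op_le1 Y bh h1 (mps_iter n x) (ca M) bf f1.
    have k2 := kernel_op_le1 Y bh h1 x (ca m) bfn fn1.
    lra.
  - apply: filterS (ae_iter n aF) => x Fx; apply: cvgM; first exact: cvg_cst.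
    rewrite /defect expr2; under eq_fun do rewrite expr2.
    by apply: cvgM; apply: cvgB => //; exact: cvg_cst.
(* The first term is [2 * C] times the near-invariance bound [4 * 64^-M]. *)
pose v M : R := 8 * C * (64^-1) ^+ M + Rintegral nu setT (fun y => e y * K).
have limv : v @ \oo --> Rintegral nu setT (fun y => e y * K).
  rewrite -[X in _ --> X]add0r; apply: cvgD; last exact: cvg_cst.
  rewrite -(mulr0 (8 * C)); apply: cvgM; first exact: cvg_cst.
  by apply: cvg_expr; rewrite ger0_norm //; lra.
apply: (ler_cvg_to limG limv); near=> M.
have mM : (m <= M)%N by near: M; exact: nbhs_infty_ge.
pose s := kernel_sub (shift_kernel n (a M)) (a m).
pose s1 := kernel_sub (shift_kernel n (a M)) (a M).
have bo := bopn s.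
have bQ t := bm_kernel_sq Y t bu.
rewrite (_ : Rintegral mu setT _ = Rintegral mu setT
   (fun x => lift e x * op s (fun x => f (mps_iter n x)) x ^+ 2)); last first.
  apply: int_ae_eq; first by bmt; exact: bG.
    by bmt.
  by apply: filterS (kernel_op_shift Y bh n (a M) bf) => x hx; rewrite kernel_op_sub hx.
rewrite int_condexpM //; last by bmt.
have bEo : bm (E (fun x => op s (fun x => f (mps_iter n x)) x ^+ 2)).
  by apply: bm_condexp; bmt.
rewrite /v; apply: (@le_trans _ _ (2 * C * hs s1 + Rintegral nu setT (fun y => e y * K))).
  have bQ1 := bQ s1.
  rewrite -intZ // -intD; [|bmt|bmt]; apply: le_int_ae; [bmt|bmt|].
  near=> y.
  have q1 : E (fun x => op s (fun x => f (mps_iter n x)) x ^+ 2) y <= Q s y.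
    by near: y; exact: (kernel_op_sq_le Y s bu bfn fn1).
  have q2 : Q s y <= 2 * Q s1 y + 2 * Q (kernel_sub (a M) (a m)) y.
    by near: y; exact: kernel_sq_sub_trans.
  have q3 : near_set m y -> forall M, (m <= M)%N ->
      Q (kernel_sub (a M) (a m)) y <= 4 * (8^-1) ^+ m.
    by near: y; exact: near_set_dist.
  have q4 : 0 <= Q s1 y.
    near: y; exact: (kernel_sq_ge0 Y s1 bu).
  have [Ay|nAy] := pselect (near_set m y); last first.
    by rewrite /e indicE memNset // mulr0 !mul0r addr0 mulr_ge0 // mulr_ge0.
  apply: (@le_trans _ _ (e y * (2 * Q s1 y + K))).
    rewrite ler_wpM2l // (le_trans q1) // (le_trans q2) // lerD2l.
    by have := q3 Ay M mM; rewrite /K; lra.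
  rewrite mulrDr lerD2r (mulrC 2 C) -(mulrA C).
  by apply: ler_wpM2r => //; rewrite mulr_ge0.
rewrite lerD2r; have := hs_sub_shift_le n M => hle.
apply: (@le_trans _ _ (2 * C * (4 * (64^-1) ^+ M))).
  by rewrite ler_wpM2l // mulr_ge0.
by rewrite le_eqVlt; apply/orP; left; apply/eqP; ring.
Unshelve. all: by end_near. Qed.

(** [near_set_defect] for [n - t], at the iterate of [y] by [t]. Composition with T^t turns the
    kernel into its shift by [t] and T^(n-t) f into T^n f. *)
Lemma shifted_defect m (t n : int) : \forall y \ae nu, near_set m (mps_iter t y) ->
  E (fun x => (F (mps_iter n x) -
     op (shift_kernel t (a m)) (fun x => f (mps_iter n x)) x) ^+ 2) y <= 8 * (8^-1) ^+ m.
Proof.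
have bd := bm_defect m (n - t).
have bd2 : bm (fun x => defect m (n - t) x ^+ 2) by bmt.
have bnt := bm_iter (n - t) bf; have bn := bm_iter n bf.
have bdt := bm_iter t bd2.
have bV : bm (fun x => (F (mps_iter n x) -
     op (shift_kernel t (a m)) (fun x => f (mps_iter n x)) x) ^+ 2).
  apply: bmX; apply: bmD; first exact: bm_iter.
  by apply: bmN; exact: (bm_kernel_op Y _ bu bn).
have ext : \forall x \ae mu, defect m (n - t) (mps_iter t x) ^+ 2 =
   (F (mps_iter n x) -
     op (shift_kernel t (a m)) (fun x => f (mps_iter n x)) x) ^+ 2.
  apply: filterS (kernel_op_shift Y bh t (a m) bnt) => x.
  rewrite /defect -mps_iterD subrK => <-; congr ((_ - kernel_op _ _ _ _ x) ^+ 2).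
  by apply/funext => z; rewrite -mps_iterD subrK.
apply: filterS3 (ae_iter t (near_set_defect m (n - t))) (condexp_iter Y t bd2)
  (condexp_ext Y bdt bV ext) => y k1 k2 k3 ny.
by rewrite -k3 k2; exact: k1.
Qed.

(* By ergodicity almost every y has an iterate mps_iter t y in near_set m, and
   there a m already approximates F up to e.  Cutting Y along such a t(y), the
   orbit functions shifted by t(y) give the finitely many functions required,
   for all powers of T at once. *)
Lemma ap_limit (hX : ergodic X) : cond_ap Y (rc F).
Proof.
apply: cond_ap_rc => // e e0.
have [m [m0 me]] : exists m, (0 < m)%N /\ 8 * (8^-1) ^+ m <= e ^+ 2.
  have : (fun m => 8 * (8^-1 : R) ^+ m) @ \oo --> (0 : R).
    rewrite -[X in _ --> X](mulr0 8); apply: cvgM; first exact: cvg_cst.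
    by apply: cvg_expr; rewrite ger0_norm //; lra.
  move=> /cvgr0_norm_le /(_ (e ^+ 2)); rewrite exprn_gt0 // => /(_ isT) [N _ hN].
  exists N.+1; split => //; apply: le_trans (ler_norm _) _; exact: (hN N.+1 (leqnSn N)).
pose A := near_set m; have mA : measurable A by exact: measurable_near_set.
(* When [k] codes no integer, [S k] is empty and the default 0 is immaterial. *)
pose t (k : nat) : int := odflt 0 (unpickle k).
pose S (k : nat) : set Y := if unpickle k is Some t then mps_iter t @^-1` A else set0.
have mS k : measurable (S k).
  by rewrite /S; case: unpickle => // t'; exact: mps_iter_preimage_measurable.
have SA k y : S k y -> A (mps_iter (t k) y).
  by rewrite /S /t; case: unpickle.
pose C := seqDU S; have mC : forall k, measurable (C k) by exact: seqDU_measurable.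
have tC : trivIset setT C by exact: trivIset_seqDU.
have bC k : bm (\1_(C k) : Y -> R) by exact: bm_indic.
have cover : \forall y \ae nu, exists k, C k y.
  apply: filterS (ergodic_hitting hX mA (near_set_gt0 m0)) => y [t' At].
  have : (\bigcup_k S k) y by exists (pickle t'); [exact: I | rewrite /S pickleK].
  by rewrite seqDU_bigcup_eq => -[k _ Cky]; exists k.
pose p (j : 'I_(size (a m))) := nth (0, 0) (a m) j.
have p1 j : `|(p j).1| <= 1.
  apply: convex_weight_le1 (ca m) _; rewrite /p.
  by elim: (a m) (nat_of_ord j) (ltn_ord j) => [//|q s IH] [|i] /=; [left | move=> hi; right; exact: IH].
(* Over [C k] the function [v j] is an orbit function shifted by [t k]; none of this involves
   [n]. *)
have /choice [v hv] : forall j, exists w, [/\ bm w, forall x, `|w x| <= 1 &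
    forall k, \forall x \ae mu,
      lift \1_(C k) x * w x = lift \1_(C k) x * u ((p j).2 + t k) x].
  move=> j; apply: glue_lift => //; first by move=> k; exact: bu.
  by move=> k x; exact: orbit_le1.
exists (size (a m)), v; split; first by move=> j; case: (hv j).
move=> n; pose fn x := f (mps_iter n x).
have bfn : bm fn by exact: bm_iter.
have buf i : bm (fun x => u i x * fn x) by bmt; exact: bu.
(* The dependence on [n] sits in these coefficients alone. They are bounded by 1 because the
   weights, [h] and [f] are. *)
pose w j k y := (p j).1 * E (fun x => u ((p j).2 + t k) x * fn x) y.
have bw j k : bm (w j k) by apply: bmM; [exact: bm_cst | exact: bm_condexp].
have w1 j k y : `|w j k y| <= 1.
  rewrite normrM mulr_ile1 //; apply: condexp_bound => // x.
  by rewrite normrM mulr_ile1 //; [exact: orbit_le1 | exact: f1].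
have /choice [c hc] : forall j, exists c, [/\ bm c, forall y, `|c y| <= 1 &
    forall k, \forall y \ae nu, C k y -> c y = w j k y].
  by move=> j; exact: glue_bounded.
exists c; split; first by move=> j; case: (hc j).
pose W x := F (mps_iter n x) - \sum_(j < size (a m)) lift (c j) x * v j x.
have bW : bm W.
  apply: bmD; first exact: bm_iter.
  apply: bmN; apply: bm_sum => j.
  by apply: bmM; [apply: bm_lift; case: (hc j) | case: (hv j)].
have bW2 : bm (fun x => W x ^+ 2) by bmt.
have loc k : \forall y \ae nu, C k y -> E (fun x => W x ^+ 2) y <= e ^+ 2.
  pose V x := F (mps_iter n x) - op (shift_kernel (t k) (a m)) fn x.
  have bV : bm V.
    apply: bmD; first exact: bm_iter.
    by apply: bmN; exact: (bm_kernel_op Y _ bu bfn).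
  have bV2 : bm (fun x => V x ^+ 2) by bmt.
  have bl := bm_lift (bC k).
  have lcv : \forall x \ae mu, forall j, lift \1_(C k) x = 1 ->
      lift (c j) x = (p j).1 * lift (E (fun x => u ((p j).2 + t k) x * fn x)) x /\
      v j x = u ((p j).2 + t k) x.
    apply: ae_forall_count => j; have [bcj _ cw] := hc j; have [_ _ vu] := hv j.
    have b1 : bm (fun y => \1_(C k) y * c j y) by bmt.
    have bEu := bm_condexp Y (buf ((p j).2 + t k)).
    have b2 : bm (fun y => \1_(C k) y * w j k y) by exact: bmM (bC k) (bw j k).
    have e12 : \forall y \ae nu, \1_(C k) y * c j y = \1_(C k) y * w j k y.
      apply: filterS (cw k) => y hy; rewrite indicE.
      by case: (boolP (y \in C k)) => [|_]; rewrite ?mul0r // inE => /hy ->.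
    near=> x => l1.
    have k1 : lift (fun y => \1_(C k) y * c j y) x = lift \1_(C k) x * lift (c j) x.
      by near: x; exact: liftM.
    have k2 : lift (fun y => \1_(C k) y * w j k y) x = lift \1_(C k) x * lift (w j k) x.
      by near: x; exact: liftM.
    have k3 : lift (fun y => \1_(C k) y * c j y) x = lift (fun y => \1_(C k) y * w j k y) x.
      by near: x; exact: lift_ext.
    have k4 : lift (w j k) x = (p j).1 * lift (E (fun x => u ((p j).2 + t k) x * fn x)) x.
      by near: x; exact: liftZ.
    have k5 : lift \1_(C k) x * v j x = lift \1_(C k) x * u ((p j).2 + t k) x.
      by near: x; exact: vu.
    rewrite -k4; split; last by move: k5; rewrite l1 !mul1r.
    by move: k3; rewrite k1 k2 l1 !mul1r.
  have WV : \forall x \ae mu, lift \1_(C k) x * W x ^+ 2 = lift \1_(C k) x * V x ^+ 2.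
    apply: filterS2 lcv (lift_indic01 (mC k)) => x lx [->|l1]; first by rewrite !mul0r.
    congr (_ * (_ - _) ^+ 2); rewrite /kernel_op big_map (big_nth (0, 0)) big_mkord.
    by apply: eq_bigr => j _; have [-> ->] := lx j l1; rewrite /p /=; ring.
  have b3 : bm (fun x => lift \1_(C k) x * W x ^+ 2) by bmt.
  have b4 : bm (fun x => lift \1_(C k) x * V x ^+ 2) by bmt.
  near=> y => Cky.
  have g1 : E (fun x => lift \1_(C k) x * W x ^+ 2) y = \1_(C k) y * E (fun x => W x ^+ 2) y.
    by near: y; exact: condexp_lift.
  have g2 : E (fun x => lift \1_(C k) x * V x ^+ 2) y = \1_(C k) y * E (fun x => V x ^+ 2) y.
    by near: y; exact: condexp_lift.
  have g3 : E (fun x => lift \1_(C k) x * W x ^+ 2) y =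
      E (fun x => lift \1_(C k) x * V x ^+ 2) y.
    by near: y; exact: condexp_ext.
  have g4 : near_set m (mps_iter (t k) y) -> E (fun x => V x ^+ 2) y <= 8 * (8^-1) ^+ m.
    by near: y; exact: shifted_defect.
  move: g3; rewrite g1 g2 indicE mem_set // !mul1r => ->.
  by apply: le_trans me; apply: g4; apply: SA; case: Cky.
have : \forall y \ae nu, forall k, C k y -> E (fun x => W x ^+ 2) y <= e ^+ 2.
  exact: ae_foralln.
by apply: filterS2 cover => y [k Cky]; apply; exact: Cky.
Unshelve. all: by end_near. Qed.

End almost_periodic_limit.

(** * Mean correlations *)

Section convex_averages.
Context (R : realType).
Implicit Types g : int -> R.

(** Moving the window by one exchanges a single term, which lies between 0 and 1. *)
Lemma sum_shift_le g (k : int) N : (forall j, 0 <= g j <= 1) ->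
  \sum_(1 <= n < N.+1) g n <= \sum_(1 <= n < N.+1) g (k + n%:Z) + `|k|%N%:R.
Proof.
have up (f : int -> R) : (forall j, 0 <= f j <= 1) ->
    \sum_(1 <= n < N.+1) f n <= \sum_(1 <= n < N.+1) f (1 + n%:Z) + 1.
  move=> f01; case: (N) => [|N']; first by rewrite !big_geq // add0r.
  rewrite big_nat_recl // [in leRHS]big_nat_recr //= -addrA addrC.
  rewrite lerD //; last by have /andP[? ?] := f01 1; have /andP[? ?] := f01 (1 + N'.+1%:Z); lra.
have down (f : int -> R) : (forall j, 0 <= f j <= 1) ->
    \sum_(1 <= n < N.+1) f n <= \sum_(1 <= n < N.+1) f (- 1 + n%:Z) + 1.
  move=> f01; case: (N) => [|N']; first by rewrite !big_geq // add0r.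
  rewrite big_nat_recr //= [in leRHS]big_nat_recl //= [leRHS]addrAC [leRHS]addrC lerD //; last first.
    by have /andP[? ?] := f01 N'.+1; have /andP[? ?] := f01 (- 1 + 1); lra.
  rewrite le_eqVlt; apply/orP; left; apply/eqP; apply: eq_bigr => n _.
  by congr f; rewrite -[in RHS]addn1 PoszD addrC addrK.
move=> g01; elim/int_rec: k => [|k IH|k IH].
- by rewrite addr0; under [leRHS]eq_bigr do rewrite add0r.
- apply: le_trans IH _.
  have := up (fun j => g (k%:Z + j)) (fun j => g01 _).
  rewrite !absz_nat -natr1; set A := \sum_(1 <= n < N.+1) _; set B := \sum_(1 <= n < N.+1) _.
  rewrite (_ : \sum_(1 <= n < N.+1) g (k.+1%:Z + n%:Z) = B); first by rewrite /= ; lra.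
  by apply: eq_bigr => n _; rewrite addrA -addn1 PoszD.
- apply: le_trans IH _.
  have := down (fun j => g (- k%:Z + j)) (fun j => g01 _).
  rewrite !abszN !absz_nat -natr1; set A := \sum_(1 <= n < N.+1) _; set B := \sum_(1 <= n < N.+1) _.
  rewrite (_ : \sum_(1 <= n < N.+1) g (- k.+1%:Z + n%:Z) = B); first by rewrite /= ; lra.
  by apply: eq_bigr => n _; rewrite addrA -addn1 PoszD opprD.
Qed.

(** Replacing [g] by the convex combination of its shifts lowers the sum by at most the constant
    [K], whatever [N] is, so the mean is at most [e + K / N]. *)
Lemma cesaro_convex g s (e : R) : (forall j, 0 <= g j <= 1) ->
  convex_weights s -> 0 < e ->
  (forall n : nat, \sum_(p <- s) p.1 * g (p.2 + n%:Z) <= e) ->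
  exists N0, forall N, (N0 <= N)%N ->
    N%:R^-1 * \sum_(1 <= n < N.+1) g n <= 2 * e.
Proof.
move=> g01 [ps es] e0 hs.
pose K : R := \sum_(p <- s) p.1 * `|p.2|%N%:R.
have K0 : 0 <= K.
  rewrite /K; elim: s ps {es hs K} => [|p s IH] ps; first by rewrite big_nil.
  rewrite big_cons addr_ge0 ?mulr_ge0  //; first by apply: ps; left.
  by apply: IH => q hq; apply: ps; right.
have key N : \sum_(1 <= n < N.+1) g n <= N%:R * e + K.
  apply: (@le_trans _ _ (\sum_(p <- s) p.1 *
      (\sum_(1 <= n < N.+1) g (p.2 + n%:Z) + `|p.2|%N%:R))).
    rewrite -[leLHS]mul1r -[X in X * _]es mulr_suml.
    elim: s ps {es hs K K0} => [|p s IH] ps; first by rewrite !big_nil.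
    rewrite !big_cons lerD //; last by apply: IH => q hq; apply: ps; right.
    by apply: ler_wpM2l; [apply: ps; left | exact: sum_shift_le].
  under eq_bigr do rewrite mulrDr mulr_sumr.
  rewrite big_split /= lerD2r exchange_big /=.
  apply: le_trans (ler_sum _ (fun n _ => hs n)) _.
  by rewrite sumr_const_nat subn1 /= mulr_natl.
have [N0 hN0] : exists N0 : nat, K / e <= N0%:R.
  by exists (Num.truncn (K / e)).+1; rewrite ltW // truncnS_gt.
exists N0.+1 => N NN; have N1 : 0 < N%:R :> R by rewrite ltr0n (leq_trans _ NN).
rewrite ler_pdivrMl //; apply: le_trans (key N) _.
have : K <= N%:R * e.
  rewrite -ler_pdivrMr //; apply: le_trans hN0 _.
  by rewrite ler_nat (leq_trans _ NN).
lra.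
Qed.

End convex_averages.

Section mean_correlations.
Context (R : realType) (X : mpsystem R) (Y : markov_factor X).
Context (h : X -> R) (bh : bm h) (h1 : forall x, `|h x| <= 1).
Local Notation mu := (mps_mu X).
Local Notation nu := (mps_mu Y).
Local Notation E := (@condexp R X Y).
Local Notation u := (orbit_fun h).
Local Notation op := (kernel_op Y u).
Local Notation hs := (@hs_sq R X Y h).
Local Notation bu := (bm_orbit bh).

(** Written this way, weighted sums of correlations become matrix coefficients of K, which the
    Hilbert-Schmidt norm bounds. *)
Lemma int_mul_kernel_op s f w : bm f -> bm w ->
  Rintegral mu setT (fun x => w x * op s f x) = \sum_(p <- s) p.1 *
    Rintegral nu setT (fun y => E (fun x => u p.2 x * f x) y * E (fun x => u p.2 x * w x) y).
Proof.
move=> bf bw.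
have bo : bm (fun x => w x * op s f x) by bmt; exact: (bm_kernel_op Y s bu bf).
have bE j v : bm v -> bm (E (fun x => u j x * v x)).
  by move=> bv; apply: bm_condexp; bmt; exact: bu.
have bp (p : R * int) : bm (fun y => E (fun x => u p.2 x * f x) y * E (fun x => u p.2 x * w x) y).
  by bmt; exact: bE.
rewrite -(int_condexp Y bo) (@int_ae_eq _ _ _ _ _ (fun y => \sum_(p <- s)
  p.1 * (E (fun x => u p.2 x * f x) y * E (fun x => u p.2 x * w x) y))).
- rewrite int_sum; last by move=> p; apply: bmM; [exact: bm_cst | exact: bp].
  by apply: eq_bigr => p _; rewrite intZ.
- exact: bm_condexp.
- by apply: bm_sum => p; apply: bmM; [exact: bm_cst | exact: bp].
- exact: (condexp_kernel_op Y s bu bf bw).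
Qed.

Lemma sqr_int_mul_kernel_op_le s f w : bm f -> bm w ->
  (forall x, `|f x| <= 1) -> (forall x, `|w x| <= 1) ->
  (Rintegral mu setT (fun x => w x * op s f x)) ^+ 2 <= hs s.
Proof.
move=> bf bw f1 w1; have bo := bm_kernel_op Y s bu bf.
have bwo : bm (fun x => w x * op s f x) by bmt.
apply: le_trans (sqr_int_le mu bwo) _.
apply: le_trans (int_kernel_op_sq_le Y bh s bf f1).
apply: le_int; [bmt | bmt |] => x.
rewrite exprMn -[leRHS]mul1r ler_wpM2r ?sqr_ge0 //.
by rewrite -real_normK ?num_real // exprn_ile1.
Qed.

(** Invariance of the measure on Y under T^i moves the inner product of [T^i h (x) T^i h] with K to
    that of [h (x) h] with T^-i K. *)
Lemma hs_sqE s : hs s = \sum_(p <- s) p.1 *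
  Rintegral mu setT (fun x => h x * op (shift_kernel (- p.2) s) h x).
Proof.
have bg i j : bm (gram_sq u i j : Y -> R).
  by rewrite /gram_sq; apply: bmX; apply: bm_condexp; bmt; exact: bu.
rewrite /hs_sq /kernel_sq /form int_sum; last first.
  move=> p; apply: bm_sum => q; apply: bmM; [exact: bm_cst | exact: bg].
apply: eq_bigr => p _; rewrite (int_mul_kernel_op _ bh bh) big_map int_sum; last first.
  by move=> q; apply: bmM; [exact: bm_cst | exact: bg].
rewrite mulr_sumr; apply: eq_bigr => q _ /=.
have bE : bm (fun y => E (fun x => u (q.2 - p.2) x * h x) y *
                       E (fun x => u (q.2 - p.2) x * h x) y).
  by apply: bmM; apply: bm_condexp; bmt; exact: bu.
have e : Rintegral nu setT (gram_sq u p.2 q.2) =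
    Rintegral nu setT (fun y => E (fun x => u (q.2 - p.2) x * h x) y *
                                E (fun x => u (q.2 - p.2) x * h x) y).
  rewrite -(int_iter p.2 bE); apply: int_ae_eq; [exact: bg | exact: (bm_iter p.2 bE) |].
  apply: filterS (gram_sq_shift Y bh p.2 (q.2 - p.2) 0) => y.
  by rewrite subrK add0r gram_sqC => ->; rewrite /gram_sq expr2.
by rewrite (intZ nu (p.1 * q.1) (bg p.2 q.2)) e mulrA.
Qed.

(** K_m h converges to a conditionally almost periodic [F], so [int h K_m h] tends to [int h F = 0].
    By [hs_sqE] the squared norm of K_m is an average of such integrals with K_m shifted, and
    near-invariance removes the shifts. *)
Lemma hs_sq_small (hX : ergodic X)
    (hF : forall F, bm F -> cond_ap Y (rc F) -> Rintegral mu setT (fun x => h x * F x) = 0)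
    (e : R) : 0 < e ->
  exists s, convex_weights s /\ hs s <= e.
Proof.
move=> e0; have [a [ca ma]] := near_minimizers Y bh.
have bop m : bm (op (a m) h) by exact: (bm_kernel_op Y _ bu bh).
have op1 m x : `|op (a m) h x| <= 1 by exact: kernel_op_le1.
have cv : \forall x \ae mu, cvgn (fun m => op (a m) h x).
  apply: (@ae_cvg_of_summable_increments _ _ _ _ (fun m => op (a m) h) 2) => // m.
  have -> : (fun x => (op (a m.+1) h x - op (a m) h x) ^+ 2) =
      (fun x => op (kernel_sub (a m) (a m.+1)) h x ^+ 2).
    by apply/funext => x; rewrite kernel_op_sub; ring.
  apply: le_trans (int_kernel_op_sq_le Y bh _ bh h1) _.
  apply: le_trans (hs_step_le bh ca ma m) _.
  rewrite (_ : 2 ^+ 2 = 4); last by ring.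
  rewrite ler_pM2l // lerXn2r ?nnegrE //; lra.
have [F [bF F1 limF]] := bounded_limit bop op1 cv.
have apF : cond_ap Y (rc F) by exact: (ap_limit bh h1 bh h1 ca ma bF limF hX).
pose l m := Rintegral mu setT (fun x => h x * op (a m) h x).
have liml : l @ \oo --> (0 : R).
  rewrite -(hF F bF apF); apply: (@int_dominated _ _ _ _ _ _ 1).
  - by move=> m; bmt; exact: bop.
  - by bmt.
  - by move=> m x; rewrite normrM mulr_ile1.
  - by apply: filterS limF => x; apply: cvgM; exact: cvg_cst.
(* The error [2 * 8^-m] is the square root of the near-invariance bound [4 * 64^-m]. *)
have hsl m : hs (a m) <= l m + 2 * (8^-1) ^+ m.
  rewrite hs_sqE; pose c n := Rintegral mu setT (fun x => h x * op (shift_kernel (- n) (a m)) h x).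
  apply: (sum_weights_le (F := c) (ca m)) => n.
  rewrite -lerBlDl /l /c -intB; [|by bmt; exact: (bm_kernel_op Y _ bu bh)|by bmt; exact: bop].
  rewrite (_ : (fun x => _ - _) = (fun x => h x *
      op (kernel_sub (shift_kernel (- n) (a m)) (a m)) h x)); last first.
    by apply/funext => x; rewrite kernel_op_sub mulrBr.
  apply: le_trans (ler_norm _) _.
  rewrite -(@ler_pXn2r _ 2) ?nnegrE ?mulr_ge0 ?exprn_ge0 // real_normK ?num_real //.
  apply: le_trans (sqr_int_mul_kernel_op_le _ bh bh h1 h1) _.
  apply: le_trans (hs_sub_shift_le bh ca ma (- n) m) _.
  rewrite exprMn -exprM mulnC exprM (_ : 8^-1 ^+ 2 = 64^-1 :> R); last by field.
  by rewrite (_ : 2 ^+ 2 = 4) //; ring.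
have : (fun m => l m + 2 * (8^-1) ^+ m) @ \oo --> (0 : R).
  rewrite -[X in _ --> X]addr0; apply: cvgD => //.
  rewrite -[X in _ --> X](mulr0 2); apply: cvgM; first exact: cvg_cst.
  by apply: cvg_expr; rewrite ger0_norm //; lra.
move=> /cvgr0_norm_le /(_ e e0) [N _ hN].
exists (a N); split => //; apply: le_trans (hsl N) _.
apply: le_trans (ler_norm _) _; exact: (hN N (leqnn N)).
Qed.

Definition sqcorr (f : X -> R) (n : int) : R :=
  Rintegral nu setT (fun y => E (fun x => h (mps_iter n x) * f x) y ^+ 2).

(** If K has small norm, then [int f (T^n K) f] is small for all [n] together, and it equals the
    convex combination of correlations that [cesaro_convex] asks for. *)
Lemma mean_sqcorr_le1 (hX : ergodic X)
    (hF : forall F, bm F -> cond_ap Y (rc F) -> Rintegral mu setT (fun x => h x * F x) = 0)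
    (f : X -> R) (bf : bm f) (f1 : forall x, `|f x| <= 1) (e : R) : 0 < e ->
  exists N0, forall N, (N0 <= N)%N ->
    N%:R^-1 * \sum_(1 <= n < N.+1) sqcorr f n <= e.
Proof.
move=> e0; have e2 : 0 < e / 2 by rewrite divr_gt0.
have [s [cs hse]] := hs_sq_small hX hF (exprn_gt0 2 e2).
pose g := sqcorr f.
have bE j : bm (E (fun x => u j x * f x)).
  by apply: bm_condexp; bmt; exact: bu.
have E1 j y : `|E (fun x => u j x * f x) y| <= 1.
  apply: condexp_bound; first by bmt; exact: bu.
  by move=> x; rewrite normrM mulr_ile1 //; exact: orbit_le1.
have g01 j : 0 <= g j <= 1.
  rewrite int_ge0 => [|y]; last exact: sqr_ge0.
  rewrite -[leRHS](int_cst nu 1); apply: le_int; [bmt; exact: bE | exact: bm_cst |] => y.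
  have e1 : E (fun x => u j x * f x) y ^+ 2 <= 1.
    by rewrite -real_normK ?num_real // exprn_ile1.
  exact: e1.
have [|N0 hN0] := cesaro_convex g01 cs e2.
  move=> n; rewrite (_ : \sum_(p <- s) _ =
      Rintegral mu setT (fun x => f x * op (shift_kernel n s) f x)).
    apply: le_trans (ler_norm _) _.
    rewrite -(@ler_pXn2r _ 2) ?nnegrE ?(ltW e2) // real_normK ?num_real //.
    by apply: le_trans (sqr_int_mul_kernel_op_le _ bf bf f1 f1) _; rewrite hs_sq_shift.
  rewrite (int_mul_kernel_op _ bf bf) big_map; apply: eq_bigr => p _ /=.
  by congr (_ * _); apply: eq_Rintegral => y _; rewrite expr2.
by exists N0 => N /hN0; rewrite [2 * _]mulrC divfK.
Qed.

End mean_correlations.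

(** * The seminorm bound *)

Section limsup_bounds.
Context (R : realType).

Lemma limn_sup_bounds (u : nat -> R) (K C : R) : (forall n, 0 <= u n <= K) ->
  (forall e, 0 < e -> exists N0, forall N, (N0 <= N)%N -> u N <= C + e) ->
  0 <= limn_sup u <= C.
Proof.
move=> u0K uC.
have ub : has_ubound (range u) by exists K => _ [n _ <-]; case/andP: (u0K n).
have lb : has_lbound (range u) by exists 0 => _ [n _ <-]; case/andP: (u0K n).
have cv : cvgn (sups u) by apply/cvg_ex; eexists; exact: cvg_sups_inf ub lb.
apply/andP; split.
  apply: limr_ge => //; apply: nearW => n.
  have /andP[un0 _] := u0K n; apply: le_trans un0 _.
  by apply: ub_le_sup; [exact/has_ubound_sdrop | exists n => /=].
apply/ler_addgt0Pr => e e0; have [N0 hN] := uC e e0.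
apply: limr_le => //; exists N0 => // n /= Nn.
apply: ge_sup; first by exists (u n), n => /=.
by move=> _ [m /= nm <-]; apply: hN; exact: leq_trans nm.
Qed.

End limsup_bounds.

(** * Orthogonality to unbounded functions of the factor *)

Section integrable_factor.
Context (R : realType) (X : mpsystem R) (Y : markov_factor X).
Local Notation mu := (mps_mu X).
Local Notation nu := (mps_mu Y).
Local Notation J := (@mf_op R X Y).
Local Notation E := (@condexp R X Y).

Lemma integrable_mul_bm (Z : mpsystem R) (h f : Z -> R) : bm h ->
  (mps_mu Z).-integrable setT (EFin \o f) ->
  (mps_mu Z).-integrable setT (EFin \o (fun x => h x * f x)).
Proof.
move=> [mh [K hK]] intf.
have mf : measurable_fun setT f by apply/measurable_EFinP; exact: measurable_int intf.
apply: (le_integrable measurableT) (integrableZl measurableT K intf) => //.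
  by apply/measurable_EFinP; exact: measurable_funM.
move=> x _; by rewrite /= lee_fin !normrM ler_wpM2r // (le_trans (hK x)) // ler_norm.
Qed.

Lemma integrable_rc_cLp1 (Z : mpsystem R) (f : Z -> R) :
  (mps_mu Z).-integrable setT (EFin \o f) -> cLp 1%:E (rc f).
Proof.
move=> intf; have /integrableP[mf fin] := intf.
split; first by split; [exact/measurable_EFinP | exact: measurable_cst].
rewrite /cLnorm Lnorm1 (eq_integral (fun x => `|(f x)%:E|%E)) // => x _.
by rewrite /= cabs_rc normr_id.
Qed.

(** Cut [d] at height [n]. The bounded part is orthogonal to [h] by the duality defining [E h]; the
    rest is mapped by [J] to a nonnegative function of the same integral, which tends to 0. *)
Lemma mf_op_nneg_orthogonal (h : X -> R) (d : Y -> R) : bm h ->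
  (\forall y \ae nu, E h y = 0) -> (forall y, 0 <= d y) ->
  nu.-integrable setT (EFin \o d) ->
  Rintegral mu setT (fun x => h x * complex.Re (J (rc d) x)) = 0.
Proof.
move=> bh Eh0 d0 intd; have [mh [K hK]] := bh.
have md : measurable_fun setT d by apply/measurable_EFinP; exact: measurable_int intd.
have K0 : 0 <= K by have [x _] := mps_inhabited X; exact: le_trans (hK x).
pose dn (n : nat) y := Num.min (d y) n%:R.
pose rn (n : nat) y := d y - dn n y.
have bdn n : bm (dn n).
  split; first by apply: measurable_minr => //; exact: measurable_cst.
  by exists n%:R => y; rewrite ger0_norm ?le_min ?d0 //= ge_min lexx orbT.
have rn0 n y : 0 <= rn n y by rewrite subr_ge0 ge_min lexx.
have rnd n y : rn n y <= d y by rewrite gerBl le_min d0 /=.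
have mrn n : measurable_fun setT (rn n) by apply: measurable_funB => //; case: (bdn n).
have irn n : nu.-integrable setT (EFin \o rn n).
  apply: (le_integrable measurableT) intd; first exact/measurable_EFinP.
  by move=> y _; rewrite /= lee_fin !ger0_norm.
have irn0 : (fun n => Rintegral nu setT (rn n)) @ \oo --> (0 : R).
  have [] := @dominated_convergence _ _ _ nu setT measurableT
     (fun n => EFin \o rn n) (EFin \o cst 0) (EFin \o d).
  - by move=> n; exact/measurable_EFinP.
  - by apply/measurable_EFinP; exact: measurable_cst.
  - apply: nearW => y _; apply: cvg_EFin; first exact: nearW.
    have [N hN] : exists N : nat, d y <= N%:R.
      by exists (Num.truncn (d y)).+1; rewrite ltW // truncnS_gt.
    apply: cvg_near_cst; exists N => // n /= Nn.
    by rewrite /rn /dn min_l ?subrr // (le_trans hN) // ler_nat.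
  - exact: intd.
  - by apply: nearW => y n _ /=; rewrite lee_fin ger0_norm.
  move=> _ _ /= cv; rewrite -(@int_cst _ _ _ nu 0) /Rintegral.
  apply: (@fine_cvg _ _ _ _ (fun n => \int[nu]_y ((rn n y)%:E))%E).
  rewrite fineK // integral_fune_fin_num //.
  exact: bm_integrable (bm_cst _ 0).
have bound n : `|Rintegral mu setT (fun x => h x * complex.Re (J (rc d) x))| <=
    K * Rintegral nu setT (rn n).
  have Ld := integrable_rc_cLp1 intd; have Lr := integrable_rc_cLp1 (irn n).
  have Ldn := rc_cLp1 (bdn n).
  pose P x := complex.Re (J (rc (rn n)) x).
  have [iP _] := cLp1_integrable (mf_L1 Lr).
  have [[mJ _] _] := mf_L1 Ld; have [[mP _] _] := mf_L1 Lr.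
  have bl := bm_lift (bdn n).
  have blh : bm (fun x => lift (dn n) x * h x) by bmt.
  have split_ae : \forall x \ae mu, h x * complex.Re (J (rc d) x) =
      h x * P x + lift (dn n) x * h x.
    have := @mf_linear _ _ Y 1 _ _ Lr Ldn.
    rewrite (_ : (fun y => _) = rc d); last first.
      by apply/funext => y; rewrite /rc /rn mul1r; simpc; rewrite subrK.
    apply: filterS2 (liftE (bdn n)) => x e ->; rewrite e mul1r /P.
    by case: (J _ x) => a b /=; ring.
  have ihP := integrable_mul_bm bh iP.
  rewrite (Rint_ae_eq _ _ split_ae); last 2 first.
  - exact: measurable_funM.
  - by apply: measurable_funD; [exact: measurable_funM | case: blh].
  rewrite RintegralD //; last exact: bm_integrable.
  have dh0 : Rintegral nu setT (fun y => dn n y * E h y) = 0.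
    rewrite -[RHS](int_cst nu 0); apply: int_ae_eq.
    - by apply: bmM; [exact: bdn | exact: bm_condexp].
    - exact: bm_cst.
    - by apply: filterS Eh0 => y ->; rewrite mulr0.
  rewrite int_condexpM // dh0 addr0.
  apply: le_trans (le_normr_Rintegral measurableT ihP) _.
  have iaP : mu.-integrable setT (EFin \o (fun x => `|P x|)) by exact: (integrable_abse iP).
  apply: (@le_trans _ _ (Rintegral mu setT (fun x => K * `|P x|))).
    apply: le_Rintegral => //.
    - exact: (integrable_abse ihP).
    - exact: (integrableZl measurableT K iaP).
    - by move=> x _; rewrite normrM ler_wpM2r.
  rewrite RintegralZl // ler_wpM2l //.
  have Ppos : \forall x \ae mu, `|P x| = P x.
    have h0 : \forall y \ae nu, 0 <= rc (rn n) y.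
      by apply: nearW => y; rewrite /rc lecR.
    apply: filterS (mf_pos Lr h0) => x; rewrite /P; case: (J _ x) => a b.
    by rewrite lecE => /andP[_ ? /=]; rewrite ger0_norm.
  rewrite (Rint_ae_eq _ mP Ppos); last exact: measurableT_comp.
  by have /(congr1 (@complex.Re R)) /= -> := mf_int Lr.
apply/eqP; rewrite -normr_eq0 eq_le normr_ge0 andbT.
have limK : (fun n => K * Rintegral nu setT (rn n)) @ \oo --> (0 : R).
  by rewrite -[X in _ --> X](mulr0 K); apply: cvgM => //; exact: cvg_cst.
by apply: (ler_cvg_to (cvg_cst _) limK); exact: nearW.
Qed.

Lemma mf_op_real_orthogonal (h : X -> R) (d : Y -> R) : bm h ->
  (\forall y \ae nu, E h y = 0) -> nu.-integrable setT (EFin \o d) ->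
  Rintegral mu setT (fun x => h x * complex.Re (J (rc d) x)) = 0 /\
  \forall x \ae mu, complex.Im (J (rc d) x) = 0.
Proof.
move=> bh Eh0 intd.
have ip : nu.-integrable setT (EFin \o (d ^\+)) by exact: integrable_funrpos.
have im : nu.-integrable setT (EFin \o (d ^\-)) by exact: integrable_funrneg.
have Lp := integrable_rc_cLp1 ip; have Lm := integrable_rc_cLp1 im.
have p0 := mf_op_nneg_orthogonal bh Eh0 (funrpos_ge0 d) ip.
have m0 := mf_op_nneg_orthogonal bh Eh0 (funrneg_ge0 d) im.
have [iJp _] := cLp1_integrable (mf_L1 Lp); have [iJm _] := cLp1_integrable (mf_L1 Lm).
have [[mJ _] _] := mf_L1 (integrable_rc_cLp1 intd).
have [mh _] := bh; have [[mJp _] _] := mf_L1 Lp; have [[mJm _] _] := mf_L1 Lm.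
have Jd : \forall x \ae mu, J (rc d) x = J (rc d^\+) x - J (rc d^\-) x.
  have := @mf_linear _ _ Y (-1) _ _ Lm Lp.
  rewrite (_ : (fun y => _) = rc d); last first.
    apply/funext => y; rewrite /rc; simpc; congr Complex.
    by rewrite addrC; exact: (congr1 (@^~ y) (funrposBneg d)).
  by apply: filterS => x ->; rewrite mulN1r addrC.
have pos (e : Y -> R) : (forall y, 0 <= e y) -> cLp 1%:E (rc e) ->
    \forall x \ae mu, complex.Im (J (rc e) x) = 0.
  move=> e0 Le; have h0 : \forall y \ae nu, 0 <= rc e y.
    by apply: nearW => y; rewrite /rc lecR.
  apply: filterS (mf_pos Le h0) => x; case: (J _ x) => a b.
  by rewrite lecE => /andP[/eqP].
split; last first.
  apply: filterS3 Jd (pos _ (funrpos_ge0 d) Lp) (pos _ (funrneg_ge0 d) Lm) => x -> e1 e2.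
  by rewrite complex_ImB e1 e2 subrr.
rewrite (@Rint_ae_eq _ _ _ (fun x => h x * complex.Re (J (rc d^\+) x) -
    h x * complex.Re (J (rc d^\-) x))).
- rewrite RintegralB //; [by rewrite p0 m0 subrr | exact: integrable_mul_bm..].
- exact: measurable_funM.
- by apply: measurable_funB; exact: measurable_funM.
- by apply: filterS Jd => x ->; rewrite complex_ReB mulrBr.
Qed.

Lemma cLp2_cLp1 (Z : mpsystem R) (c : Z -> R[i]) : cLp 2%:E c -> cLp 1%:E c.
Proof.
move=> [mc Lc]; split => //.
have hc : (cabs c) \in Lfun (mps_mu Z) 2%:E.
  by apply/andP; split; rewrite inE //=; exact: measurable_cabs.
have muT : mps_mu Z setT \is a fin_num.
  by have -> : mps_mu Z setT = 1%E by exact: probability_setT.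
have l2 : (1 <= 2%:E :> \bar R)%E by rewrite lee_fin ler1n.
have /andP[_] := Lfun_subset (lexx 1%E) l2 muT l2 hc.
by rewrite inE.
Qed.

(** [F] is given as [J c] with [c] merely square integrable, beyond the direct reach of the duality
    for bounded functions; [c] is split into its real and imaginary part. *)
Lemma factor_space_orthogonal (h F : X -> R) : bm h -> bm F ->
  (\forall y \ae nu, E h y = 0) -> factor_space Y (rc F) ->
  Rintegral mu setT (fun x => h x * F x) = 0.
Proof.
move=> bh bF Eh0 [_ [c /cLp2_cLp1 Lc Fc]].
have [iR iI] := cLp1_integrable Lc.
have [oR _] := mf_op_real_orthogonal bh Eh0 iR.
have [_ zI] := mf_op_real_orthogonal bh Eh0 iI.
have LR := integrable_rc_cLp1 iR; have LI := integrable_rc_cLp1 iI.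
have := @mf_linear _ _ Y (Complex 0 1) _ _ LI LR.
rewrite (_ : (fun y => _) = c); last first.
  by apply/funext => y; rewrite /rc; case: (c y) => a b; simpc.
move=> Jc; have [[mJ _] _] := mf_L1 LR; have [mh _] := bh.
rewrite -oR; apply: Rint_ae_eq.
- by case: (bmM bh bF).
- exact: measurable_funM.
- apply: filterS3 Fc Jc zI => x + e1 e2; rewrite e1 /rc => /(congr1 (@complex.Re R)) /= ->.
  by move: e2; case: (J (rc (fun y => complex.Im (c y))) x) => a b /= ->; case: (J _ x) => a' b'; simpc.
Qed.

End integrable_factor.

(** * Correlations of complex functions *)

Section square_correlations.
Context (R : realType) (X : mpsystem R).
Local Notation mu := (mps_mu X).

Lemma L2_closure_sub (A : set (X -> R[i])) f : cLp 2%:E f -> A f -> L2_closure A f.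
Proof.
move=> Lf Af; split => // e e0; exists f => //.
rewrite /cLnorm (_ : _ \o _ = cst 0%E); first by rewrite Lnorm0 ?lte_fin // eqe.
by apply/funext => x; rewrite /= cabsE /= subrr expr0n addr0 sqrtr0.
Qed.

Lemma sqcorrZ (W : markov_factor X) (a : R) h f n : bm h -> bm f ->
  sqcorr W (fun x => a * h x) f n = a ^+ 2 * sqcorr W h f n.
Proof.
move=> bh bf; have bhf : bm (fun x => h (mps_iter n x) * f x).
  by apply: bmM => //; exact: bm_iter.
have bahf : bm (fun x => a * h (mps_iter n x) * f x).
  by apply: bmM => //; apply: bmM; [exact: bm_cst | exact: bm_iter].
have bE := bmX 2 (bm_condexp W bhf).
rewrite /sqcorr -(intZ _ _ bE); apply: int_ae_eq.
- exact: bmX 2 (bm_condexp W bahf).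
- exact: bmM (bm_cst _ _) bE.
- apply: filterS (condexpZ W a bhf) => y.
  by under eq_fun do rewrite mulrA; move=> ->; rewrite exprMn.
Qed.

(** Residuals such as [f - J E f] need not be bounded by 1; [sqcorr] is quadratic in [h], so
    rescaling covers them. *)
Lemma mean_sqcorr_le (W : markov_factor X) (hX : ergodic X) (h : X -> R) :
  bm h ->
  (forall F, bm F -> cond_ap W (rc F) -> Rintegral mu setT (fun x => h x * F x) = 0) ->
  forall f, bm f -> (forall x, `|f x| <= 1) -> forall e : R, 0 < e ->
  exists N0, forall N, (N0 <= N)%N ->
    N%:R^-1 * \sum_(1 <= n < N.+1) sqcorr W h f n <= e.
Proof.
move=> bh hF f bf f1 e e0.
have [K K0 hK] : exists2 K : R, 0 < K & forall x, `|h x| <= K.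
  have [_ [M hM]] := bh; exists (`|M| + 1); first by rewrite ltr_pwDr.
  by move=> x; rewrite (le_trans (hM x)) // (le_trans (ler_norm _)) // lerDl.
pose h' x := K^-1 * h x.
have bh' : bm h' by apply: bmM bh; exact: bm_cst.
have h'1 x : `|h' x| <= 1.
  by rewrite normrM normfV (gtr0_norm K0) ler_pdivrMl // mulr1.
have orth F : bm F -> cond_ap W (rc F) -> Rintegral mu setT (fun x => h' x * F x) = 0.
  move=> bF aF; under eq_Rintegral do rewrite -mulrA.
  by rewrite (intZ mu _ (bmM bh bF)) hF // mulr0.
have K2 : 0 < K^-1 ^+ 2 by rewrite exprn_gt0 // invr_gt0.
have [N0 hN] := mean_sqcorr_le1 bh' h'1 hX orth bf f1 (mulr_gt0 K2 e0).
exists N0 => N NN; have hb := hN N NN.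
have e1 : \sum_(1 <= n < N.+1) sqcorr W h' f n =
    K^-1 ^+ 2 * \sum_(1 <= n < N.+1) sqcorr W h f n.
  by rewrite mulr_sumr; apply: eq_bigr => n _; exact: sqcorrZ.
by rewrite e1 mulrCA ler_pM2l // in hb.
Qed.

(** Pointwise [(a + s b + c)^2 <= 2 a^2 + 4 b^2 + 4 c^2], with Jensen for the first term. The weight
    2 on [p] is the one that survives in the limit; those on [q] and [r] will multiply vanishing
    means. *)
Lemma int_sqr_condexp_add_le (W : markov_factor X) (p q r : X -> R) (s : R) :
  s ^+ 2 = 1 -> bm p -> bm q -> bm r ->
  Rintegral (mps_mu W) setT
    (fun y => condexp (Y := W) (fun x => p x + (s * r x + q x)) y ^+ 2) <=
  2 * Rintegral mu setT (fun x => p x ^+ 2) +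
  (4 * Rintegral (mps_mu W) setT (fun y => condexp (Y := W) q y ^+ 2) +
   4 * Rintegral (mps_mu W) setT (fun y => condexp (Y := W) r y ^+ 2)).
Proof.
move=> s1 bp bq br; pose p2 x := p x ^+ 2.
have bp2 : bm p2 by exact: bmX.
have brq : bm (fun x => s * r x + q x) by bmt.
have bs : bm (fun x => p x + (s * r x + q x)) by bmt.
have Ep2 := bm_condexp W bp2.
have Eq2 := bmX 2 (bm_condexp W bq); have Er2 := bmX 2 (bm_condexp W br).
have c2 := bmM (bm_cst _ 2) Ep2; have c4 := bmM (bm_cst _ 4) Eq2.
have c4' := bmM (bm_cst _ 4) Er2.
apply: (@le_trans _ _ (Rintegral (mps_mu W) setT (fun y => 2 * condexp (Y := W) p2 y +
    (4 * condexp (Y := W) q y ^+ 2 + 4 * condexp (Y := W) r y ^+ 2)))); last first.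
  rewrite (intD _ c2 (bmD c4 c4')) (intD _ c4 c4') (intZ _ 2 Ep2) (intZ _ 4 Eq2).
  by rewrite (intZ _ 4 Er2) (int_condexp W bp2).
apply: le_int_ae; [exact: bmX 2 (bm_condexp W bs) | exact: bmD c2 (bmD c4 c4') |].
apply: filterS3 (condexpD W bp brq) (condexp_lin W s br bq) (sqr_condexp_le W bp).
move=> y -> -> le2; rewrite /p2; move: le2.
set a := condexp _ y; set b := condexp r y; set c := condexp q y.
set d := condexp _ y => le2.
have h0 : 0 <= (a - (s * b + c)) ^+ 2 + 2 * (s * b - c) ^+ 2.
  by rewrite addr_ge0 ?sqr_ge0 // mulr_ge0 // sqr_ge0.
apply: (@le_trans _ _ (2 * a ^+ 2 + (4 * c ^+ 2 + 4 * (s ^+ 2 * b ^+ 2)))).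
  rewrite -subr_ge0; apply: le_trans h0 _.
  by rewrite le_eqVlt; apply/orP; left; apply/eqP; ring.
by rewrite s1 mul1r lerD2r ler_pM2l.
Qed.

(** Only the shifted factor of T^n f times the conjugate of f is decomposed. The part with T^n g is
    bounded in L^2 by [|f| <= 1], the part with T^n h consists of correlations; the integrals on the
    left belong to the real and the imaginary part. *)
Lemma sqcorr_complex_le (W : markov_factor X) (n : int)
    (f1 f2 g1 g2 h1 h2 : X -> R) :
  bm f1 -> bm f2 -> bm g1 -> bm g2 -> bm h1 -> bm h2 ->
  (forall x, f1 x = g1 x + h1 x) -> (forall x, f2 x = g2 x + h2 x) ->
  (forall x, f1 x ^+ 2 + f2 x ^+ 2 <= 1) ->
  Rintegral (mps_mu W) setT (fun y => condexp (Y := W)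
    (fun x => f1 (mps_iter n x) * f1 x + f2 (mps_iter n x) * f2 x) y ^+ 2) +
  Rintegral (mps_mu W) setT (fun y => condexp (Y := W)
    (fun x => f2 (mps_iter n x) * f1 x - f1 (mps_iter n x) * f2 x) y ^+ 2) <=
  2 * (Rintegral mu setT (fun x => g1 x ^+ 2) + Rintegral mu setT (fun x => g2 x ^+ 2)) +
  4 * (sqcorr W h1 f1 n + sqcorr W h2 f2 n + (sqcorr W h2 f1 n + sqcorr W h1 f2 n)).
Proof.
move=> bf1 bf2 bg1 bg2 bh1 bh2 fE1 fE2 f12.
have bTg1 := bm_iter n bg1; have bTg2 := bm_iter n bg2.
have bTh1 := bm_iter n bh1; have bTh2 := bm_iter n bh2.
pose A1 x := g1 (mps_iter n x) * f1 x + g2 (mps_iter n x) * f2 x.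
pose A2 x := g2 (mps_iter n x) * f1 x - g1 (mps_iter n x) * f2 x.
have bA1 : bm A1 by rewrite /A1; bmt.
have bA2 : bm A2 by rewrite /A2; bmt.
have b11 := bmM bTh1 bf1; have b22 := bmM bTh2 bf2.
have b21 := bmM bTh2 bf1; have b12 := bmM bTh1 bf2.
have e1 : 1 ^+ 2 = 1 :> R by rewrite expr1n.
have e2 : (-1) ^+ 2 = 1 :> R by rewrite sqrrN expr1n.
have := int_sqr_condexp_add_le W e1 bA1 b11 b22.
rewrite (_ : (fun x => A1 x + _) = (fun x => f1 (mps_iter n x) * f1 x +
  f2 (mps_iter n x) * f2 x)); last by apply/funext => x; rewrite /A1 !fE1 !fE2; ring.
have := int_sqr_condexp_add_le W e2 bA2 b21 b12.
rewrite (_ : (fun x => A2 x + _) = (fun x => f2 (mps_iter n x) * f1 x -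
  f1 (mps_iter n x) * f2 x)); last by apply/funext => x; rewrite /A2 !fE1 !fE2; ring.
have bA12 := bmX 2 bA1; have bA22 := bmX 2 bA2.
have bg12 := bmX 2 bg1; have bg22 := bmX 2 bg2.
have bT1 := bm_iter n bg12; have bT2 := bm_iter n bg22.
have : Rintegral mu setT (fun x => A1 x ^+ 2) + Rintegral mu setT (fun x => A2 x ^+ 2) <=
    Rintegral mu setT (fun x => g1 x ^+ 2) + Rintegral mu setT (fun x => g2 x ^+ 2).
  rewrite -(int_iter n bg12) -(int_iter n bg22) -(intD _ bA12 bA22) -(intD _ bT1 bT2).
  apply: le_int; [exact: bmD bA12 bA22 | exact: bmD bT1 bT2 |] => x.
  rewrite (_ : A1 x ^+ 2 + _ = (g1 (mps_iter n x) ^+ 2 + g2 (mps_iter n x) ^+ 2) *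
    (f1 x ^+ 2 + f2 x ^+ 2)); last by rewrite /A1 /A2; ring.
  by rewrite -[leRHS]mulr1 ler_wpM2l // addr_ge0 // sqr_ge0.
have arith (a1 a2 g1' g2' r1 r2 c1 c2 c3 c4 : R) : a1 + a2 <= g1' + g2' ->
    r2 <= 2 * a2 + (4 * c3 + 4 * c4) -> r1 <= 2 * a1 + (4 * c1 + 4 * c2) ->
    r1 + r2 <= 2 * (g1' + g2') + 4 * (c1 + c2 + (c3 + c4)) by lra.
exact: arith.
Qed.

End square_correlations.

Section seminorm_bound.
Context (R : realType) (X : mpsystem R).
Local Notation mu := (mps_mu X).

Lemma int_sqr_lift (Y : markov_factor X) c : bm c ->
  Rintegral mu setT (fun x => lift (Y := Y) c x ^+ 2) =
  Rintegral (mps_mu Y) setT (fun y => c y ^+ 2).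
Proof.
move=> bc; have bl := bm_lift bc; have bcc := bmM bc bc.
have e : Rintegral mu setT (lift (fun y => c y * c y)) =
    Rintegral mu setT (fun x => lift c x ^+ 2).
  apply: int_ae_eq; [exact: bm_lift | exact: bmX | ].
  by apply: filterS (liftM bc bc) => x ->; rewrite expr2.
by rewrite -e int_lift //; apply: eq_Rintegral => y _; rewrite expr2.
Qed.

Lemma condexp_resid (Y : markov_factor X) f : bm f ->
  \forall y \ae mps_mu Y, condexp (fun x => f x - lift (condexp (Y := Y) f) x) y = 0.
Proof.
move=> bf; have bE := bm_condexp Y bf; have bl := bm_lift bE.
apply: filterS2 (condexp_lin Y (-1) bl bf) (condexpK bE) => y.
rewrite (_ : (fun x => _ * _ + _) = (fun x => f x - lift (condexp (Y := Y) f) x)).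
  by move=> -> ->; rewrite mulN1r addNr.
by apply/funext => x; rewrite mulN1r addrC.
Qed.

Lemma resid_orthogonal (W Y : markov_factor X) f :
  induces Y (L2_closure (cond_ap W)) -> bm f ->
  forall F, bm F -> cond_ap W (rc F) ->
  Rintegral mu setT (fun x => (f x - lift (condexp (Y := Y) f) x) * F x) = 0.
Proof.
move=> hY bf F bF aF; have bl := bm_lift (bm_condexp Y bf).
apply: (@factor_space_orthogonal _ _ Y) => //; first by bmt.
  exact: condexp_resid.
rewrite -hY; apply: L2_closure_sub => //.
by case: aF => -[].
Qed.

Lemma condexp_sqr_le1 (W : markov_factor X) f : bm f -> (forall x, `|f x| <= 1) ->
  Rintegral (mps_mu W) setT (fun y => condexp (Y := W) f y ^+ 2) <= 1.
Proof.
move=> bf f1; have bE := bm_condexp W bf.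
rewrite -[leRHS](int_cst (mps_mu W) 1); apply: le_int; [exact: bmX | exact: bm_cst |] => y.
rewrite -real_normK ?num_real // exprn_ile1 //.
exact: condexp_bound.
Qed.

Lemma mean_sum4_le (a b c d : nat -> R) (w e : R) (N : nat) :
  w * \sum_(1 <= n < N) a n <= e -> w * \sum_(1 <= n < N) b n <= e ->
  w * \sum_(1 <= n < N) c n <= e -> w * \sum_(1 <= n < N) d n <= e ->
  w * \sum_(1 <= n < N) (a n + b n + (c n + d n)) <= 4 * e.
Proof. by rewrite !big_split /= !mulrDr; lra. Qed.

(** The base case is Jensen's inequality for [E]. In the step, the bound over [W] is
    [2^k (2 G + 4 c n)], with [G] the squared norm of the projection of [f] on [Y] and [c n] a sum
    of four correlations of mean tending to 0, so the constant doubles. *)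
Lemma ghk_seminorm_le (hX : ergodic X) k (Y : markov_factor X) : distal_factor k Y ->
  forall f : X -> R[i], cbm f -> (forall x, cabs f x <= 1) ->
  ghk_seminorm k f ^+ (2 ^ k.+1) <= (2 ^ k)%:R *
    (Rintegral (mps_mu Y) setT
       (fun y => condexp (Y := Y) (fun x => complex.Re (f x)) y ^+ 2) +
     Rintegral (mps_mu Y) setT
       (fun y => condexp (Y := Y) (fun x => complex.Im (f x)) y ^+ 2)).
Proof.
elim: k Y => [|k IH] Y.
  move=> _ f [b1 b2] _; rewrite expn0 mul1r expn1 /=.
  rewrite /cintegral /= sqr_sqrtr ?addr_ge0 ?sqr_ge0 //.
  rewrite -(int_condexp Y b1) -(int_condexp Y b2).
  by apply: lerD; apply: sqr_int_le; exact: bm_condexp.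
move=> [W dW hY] f [b1 b2] f_le1.
pose f1 x := complex.Re (f x); pose f2 x := complex.Im (f x).
have f12 x : f1 x ^+ 2 + f2 x ^+ 2 <= 1.
  by rewrite -[_ + _]/(complex.Re (f x) ^+ 2 + complex.Im (f x) ^+ 2) -sqr_cabs
    exprn_ile1 // cabs_ge0.
have f1_le1 x : `|f1 x| <= 1 by exact: le_trans (normr_Re_le_cabs f x) (f_le1 x).
have f2_le1 x : `|f2 x| <= 1 by exact: le_trans (normr_Im_le_cabs f x) (f_le1 x).
have bE1 := bm_condexp Y b1; have bE2 := bm_condexp Y b2.
pose g1 := lift (condexp (Y := Y) f1); pose g2 := lift (condexp (Y := Y) f2).
have bg1 : bm g1 by exact: bm_lift.
have bg2 : bm g2 by exact: bm_lift.
pose h1 x := f1 x - g1 x; pose h2 x := f2 x - g2 x.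
have bh1 : bm h1 by exact: bmD b1 (bmN bg1).
have bh2 : bm h2 by exact: bmD b2 (bmN bg2).
have fE1 x : f1 x = g1 x + h1 x by rewrite addrC subrK.
have fE2 x : f2 x = g2 x + h2 x by rewrite addrC subrK.
have o1 := resid_orthogonal hY b1; have o2 := resid_orthogonal hY b2.
rewrite -(int_sqr_lift bE1) -(int_sqr_lift bE2).
set G := _ + _.
have G0 : 0 <= G by rewrite addr_ge0 // int_ge0 // => x; exact: sqr_ge0.
pose phi (n : nat) (x : X) : R[i] := koopman n f x * conjc (f x).
have reM (p q : R[i]) : complex.Re (p * conjc q) =
    complex.Re p * complex.Re q + complex.Im p * complex.Im q.
  by case: p q => a b [c e] /=; ring.
have imM (p q : R[i]) : complex.Im (p * conjc q) =
    complex.Im p * complex.Re q - complex.Re p * complex.Im q.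
  by case: p q => a b [c e] /=; ring.
have rePhi n : (fun x => complex.Re (phi n x)) =
    (fun x => f1 (mps_iter n x) * f1 x + f2 (mps_iter n x) * f2 x).
  by apply/funext => x; exact: reM.
have imPhi n : (fun x => complex.Im (phi n x)) =
    (fun x => f2 (mps_iter n x) * f1 x - f1 (mps_iter n x) * f2 x).
  by apply/funext => x; exact: imM.
have bT1 n := bm_iter n b1; have bT2 n := bm_iter n b2.
have bphi n : cbm (phi n).
  split; rewrite ?rePhi ?imPhi.
    exact: bmD (bmM (bT1 n) b1) (bmM (bT2 n) b2).
  exact: bmD (bmM (bT2 n) b1) (bmN (bmM (bT1 n) b2)).
have phi_le1 n x : cabs (phi n) x <= 1.
  rewrite cabsE (congr1 (@^~ x) (rePhi n)) (congr1 (@^~ x) (imPhi n)) /=.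
  rewrite -[leRHS]sqrtr1 ler_sqrt // (_ : _ + _ =
    (f1 (mps_iter n x) ^+ 2 + f2 (mps_iter n x) ^+ 2) * (f1 x ^+ 2 + f2 x ^+ 2)).
    by rewrite mulr_ile1 ?addr_ge0 ?sqr_ge0.
  by ring.
pose c n := sqcorr W h1 f1 n + sqcorr W h2 f2 n + (sqcorr W h2 f1 n + sqcorr W h1 f2 n).
pose t n := ghk_seminorm k (phi n) ^+ (2 ^ k.+1).
pose P : R := (2 ^ k)%:R.
have P0 : 0 < P by rewrite ltr0n expn_gt0.
have t0 n : 0 <= t n by rewrite /t expnS exprM exprn_ge0 // sqr_ge0.
have tP n : t n <= P * (2 * G + 4 * c n).
  apply: le_trans (IH W dW _ (bphi n) (phi_le1 n)) _.
  rewrite ler_pM2l // rePhi imPhi.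
  exact: (sqcorr_complex_le W n b1 b2 bg1 bg2 bh1 bh2 fE1 fE2 f12).
have t2 n : t n <= P * 2.
  apply: le_trans (IH W dW _ (bphi n) (phi_le1 n)) _.
  have [bR bI] := bphi n; rewrite ler_pM2l // -[leRHS]/(1 + 1) lerD //.
    apply: condexp_sqr_le1 => // x; exact: le_trans (normr_Re_le_cabs _ _) (phi_le1 n x).
  apply: condexp_sqr_le1 => // x; exact: le_trans (normr_Im_le_cabs _ _) (phi_le1 n x).
pose u N := N%:R^-1 * \sum_(1 <= n < N.+1) t n.
have mean_cst_le (a : R) (N : nat) : 0 <= a -> N%:R^-1 * (N%:R * a) <= a.
  move=> a0; case: N => [|N]; first by rewrite invr0 mul0r.
  by rewrite mulrA mulVf ?mul1r // pnatr_eq0.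
have sum_cst (a : R) (N : nat) : \sum_(1 <= n < N.+1) a = N%:R * a.
  by rewrite sumr_const_nat subn1 mulr_natl.
have u_bnd N : 0 <= u N <= P * 2.
  rewrite mulr_ge0 ?invr_ge0 ?sumr_ge0 //=.
  apply: le_trans (mean_cst_le (P * 2) N _); last by rewrite mulr_ge0 // ltW.
  by rewrite -sum_cst ler_wpM2l ?invr_ge0 // ler_sum.
have c_small (e : R) : 0 < e -> exists N0, forall N, (N0 <= N)%N ->
    N%:R^-1 * \sum_(1 <= n < N.+1) c n <= 4 * e.
  move=> e0.
  have [N1 hN1] := mean_sqcorr_le hX bh1 o1 b1 f1_le1 e0.
  have [N2 hN2] := mean_sqcorr_le hX bh2 o2 b2 f2_le1 e0.
  have [N3 hN3] := mean_sqcorr_le hX bh2 o2 b1 f1_le1 e0.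
  have [N4 hN4] := mean_sqcorr_le hX bh1 o1 b2 f2_le1 e0.
  exists (maxn (maxn N1 N2) (maxn N3 N4)) => N.
  rewrite !geq_max => /andP[/andP[l1 l2] /andP[l3 l4]].
  exact: (mean_sum4_le (hN1 N l1) (hN2 N l2) (hN3 N l3) (hN4 N l4)).
have u_lim (e : R) : 0 < e -> exists N0, forall N, (N0 <= N)%N -> u N <= (2 ^ k.+1)%:R * G + e.
  (* Four correlations, each of mean at most [e / (P * 16)], enter with weight [4 * P], which adds
     up to [e]. *)
  move=> e0; have e' : 0 < e / (P * 16) by rewrite divr_gt0 // mulr_gt0.
  have [N0 hN0] := c_small _ e'; exists N0 => N /hN0 hc.
  apply: (@le_trans _ _ (N%:R^-1 * (N%:R * (P * 2 * G) +
      P * 4 * \sum_(1 <= n < N.+1) c n))).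
    rewrite ler_wpM2l ?invr_ge0 // -sum_cst mulr_sumr -big_split /=.
    apply: ler_sum => n _; apply: le_trans (tP n) _.
    by rewrite le_eqVlt; apply/orP; left; apply/eqP; ring.
  rewrite mulrDr lerD //.
    rewrite expnS natrM (mulrC 2%:R); apply: mean_cst_le.
    by rewrite !mulr_ge0 // ltW.
  rewrite mulrCA; apply: (@le_trans _ _ (P * 4 * (4 * (e / (P * 16))))).
    by rewrite ler_wpM2l // mulr_ge0 // ltW.
  by rewrite le_eqVlt; apply/orP; left; apply/eqP; field; rewrite lt0r_neq0.
have /andP[L0 LG] := limn_sup_bounds u_bnd u_lim.
rewrite -[ghk_seminorm _ _]/(limn_sup u `^ ((2 ^ k.+2)%:R^-1)).
by rewrite -powR_mulrn ?powR_ge0 // -powRrM mulVf ?powRr1 // pnatr_eq0.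
Qed.

End seminorm_bound.

(** * Approximation in the distal factor *)

Section square_integrable.
Context (R : realType) (X : mpsystem R).
Local Notation mu := (mps_mu X).
Implicit Types (f g : X -> R[i]).

Definition sq_int f : \bar R := (\int[mu]_x (cabs f x ^+ 2)%:E)%E.

Lemma cLnorm2_sqrt f : cLnorm 2%:E f = sqrte (sq_int f).
Proof.
have I0 : (0 <= sq_int f)%E by apply: integral_ge0 => x _; rewrite lee_fin sqr_ge0.
rewrite -poweR12_sqrt // /cLnorm unlock; congr (_ `^ _)%E.
apply: eq_integral => x _.
by rewrite /= ger0_norm ?cabs_ge0 // powR_mulrn ?cabs_ge0.
Qed.

Lemma cLnorm2_lt f (e : R) : 0 < e ->
  (cLnorm 2%:E f < e%:E)%E = (sq_int f < (e ^+ 2)%:E)%E.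
Proof.
move=> e0; rewrite cLnorm2_sqrt.
have : (0 <= sq_int f)%E by apply: integral_ge0 => x _; rewrite lee_fin sqr_ge0.
case: (sq_int f) => [r| |] //=; rewrite !(lee_fin, lte_fin) => r0.
by rewrite -[in LHS](ger0_norm (ltW e0)) -sqrtr_sqr ltr_sqrt // exprn_gt0.
Qed.

Lemma measurable_sqr_cabs f : cmeasurable f ->
  measurable_fun setT (fun x => (cabs f x ^+ 2)%:E).
Proof.
by move=> mf; apply/measurable_EFinP; apply: measurable_funX; exact: measurable_cabs.
Qed.

Lemma cLp2_integrable f : cLp 2%:E f ->
  mu.-integrable setT (EFin \o (fun x => cabs f x ^+ 2)).
Proof.
move=> [mf]; rewrite cLnorm2_sqrt => fin.
apply/integrableP; split; first exact: measurable_sqr_cabs.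
rewrite (eq_integral (fun x => (cabs f x ^+ 2)%:E)); last first.
  by move=> x _; rewrite /= ger0_norm // sqr_ge0.
by move: fin; rewrite -/(sq_int f); case: (sq_int f) => // r _; exact: ltry.
Qed.

Lemma sq_int_triangle f g h : cmeasurable f -> cmeasurable g -> cmeasurable h ->
  (sq_int (fun x => f x - h x)%R <=
   2%:E * sq_int (fun x => f x - g x)%R + 2%:E * sq_int (fun x => g x - h x)%R)%E.
Proof.
move=> mf mg mh.
have mB (a b : X -> R[i]) : cmeasurable a -> cmeasurable b ->
    cmeasurable (fun x => a x - b x).
  move=> [ar ai] [br bi]; split.
    by under eq_fun do rewrite complex_ReB; exact: measurable_funB.
  by under eq_fun do rewrite complex_ImB; exact: measurable_funB.
have m1 := measurable_sqr_cabs (mB _ _ mf mg).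
have m2 := measurable_sqr_cabs (mB _ _ mg mh).
have m3 := measurable_sqr_cabs (mB _ _ mf mh).
have p (a : X -> R[i]) (x : X) : (0 <= (cabs a x ^+ 2)%:E :> \bar R)%E by rewrite lee_fin sqr_ge0.
rewrite /sq_int -!ge0_integralZl_EFin // -ge0_integralD //.
- apply: ge0_le_integral => //.
  + by apply: emeasurable_funD; exact: measurable_funeM.
  + move=> x _; rewrite -!EFinM -EFinD lee_fin !sqr_cabs !complex_ReB !complex_ImB.
    set a := complex.Re (f x); set b := complex.Re (g x); set c := complex.Re (h x).
    set a' := complex.Im (f x); set b' := complex.Im (g x); set c' := complex.Im (h x).
    rewrite -subr_ge0 (_ : _ - _ = (a + c - 2 * b) ^+ 2 + (a' + c' - 2 * b') ^+ 2).
      by rewrite addr_ge0 // sqr_ge0.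
    by ring.
- by move=> x _; rewrite mule_ge0.
- exact: measurable_funeM.
- by move=> x _; rewrite mule_ge0.
- exact: measurable_funeM.
Qed.

(** A distal factor of positive order induces a closure, and its closedness is what keeps limits of
    approximations from the factor space inside it. *)
Lemma L2_closure_closed (A : set (X -> R[i])) f : (forall g, A g -> cmeasurable g) ->
  cLp 2%:E f ->
  (forall e : R, 0 < e -> exists2 g, L2_closure A g &
     (sq_int (fun x => f x - g x)%R <= e%:E)%E) ->
  L2_closure A f.
Proof.
move=> mA Lf hf; split => // e e0.
(* [2 * (e^2 / 8) + 2 * (e / 4)^2 = 3 / 8 * e^2], below [e^2]. *)
have [e1 e2] : 0 < e ^+ 2 / 8 /\ 0 < e / 4 by rewrite !divr_gt0 // exprn_gt0.
have [g [[mg _] Ag] fg] := hf _ e1.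
have [a Aa ga] := Ag _ e2; exists a => //.
move: ga; rewrite !cLnorm2_lt // => ga.
have [mf _] := Lf; have ma := mA a Aa.
apply: le_lt_trans (sq_int_triangle mf mg ma) _.
apply: (@le_lt_trans _ _ (2%:E * (e ^+ 2 / 8)%:E + 2%:E * ((e / 4) ^+ 2)%:E)%E).
  apply: leeD; rewrite lee_pmul2l //; exact: ltW.
rewrite -!EFinM -EFinD lte_fin -subr_gt0.
rewrite (_ : _ - _ = 5 / 8 * e ^+ 2); last by field.
by rewrite mulr_gt0 // exprn_gt0.
Qed.

Lemma truncate_cvg f (e : R) : cLp 2%:E f -> 0 < e ->
  exists K, (sq_int (fun x => f x - truncate f K x)%R <= e%:E)%E.
Proof.
move=> Lf e0; have [mf _] := Lf; have intf := cLp2_integrable Lf.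
pose r (n : nat) x := cabs (fun x => f x - truncate f n%:R x) x ^+ 2.
have rE n x : r n x = if cabs f x <= n%:R then 0 else cabs f x ^+ 2.
  rewrite /r sqr_cabs /truncate; case: ifP => _; rewrite !complex_ReB !complex_ImB.
    by rewrite !subrr expr0n addr0.
  by rewrite /= !subr0 -sqr_cabs.
have [mr mi] := mf.
have mR n : measurable_fun setT (r n).
  have [[m1 _] [m2 _]] := cbm_truncate n%:R mf.
  apply: measurable_funX; apply: measurable_cabs; split.
    by under eq_fun do rewrite complex_ReB; exact: measurable_funB.
  by under eq_fun do rewrite complex_ImB; exact: measurable_funB.
have [] := @dominated_convergence _ _ _ mu setT measurableT
   (fun n => EFin \o r n) (EFin \o cst 0) (EFin \o (fun x => cabs f x ^+ 2)).
- by move=> n; exact/measurable_EFinP.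
- by apply/measurable_EFinP; exact: measurable_cst.
- apply: nearW => x _; apply: cvg_EFin; first exact: nearW.
  have [N hN] : exists N : nat, cabs f x <= N%:R.
    by exists (Num.truncn (cabs f x)).+1; rewrite ltW // truncnS_gt.
  apply: cvg_near_cst; exists N => // n /= Nn.
  by rewrite rE (le_trans hN) // ler_nat.
- exact: intf.
- apply: nearW => x n _ /=; rewrite lee_fin ger0_norm ?rE //.
    by case: ifP => // _; exact: sqr_ge0.
  by rewrite -rE sqr_ge0.
move=> _ _ /=; rewrite integral0_eq; last by [].
move=> /fine_cvgP [fin /cvgr0_norm_le /(_ e e0)] le.
near \oo => n; exists n%:R.
have fn : (\int[mu]_x (r n x)%:E)%E \is a fin_num by near: n.
rewrite -[sq_int _]/(\int[mu]_x (r n x)%:E)%E -[X in (X <= _)%E]fineK // lee_fin.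
apply: le_trans (ler_norm _) _; near: n; exact: le.
Unshelve. all: by end_near. Qed.

End square_integrable.

Section main.
Context (R : realType) (X : mpsystem R).
Local Notation mu := (mps_mu X).

Lemma ghk_seminorm_eq0 (hX : ergodic X) k (Y : markov_factor X) :
  distal_factor k Y -> forall f : X -> R[i], cbm f -> (forall x, cabs f x <= 1) ->
  (\forall y \ae mps_mu Y, condexp (Y := Y) (fun x => complex.Re (f x)) y = 0) ->
  (\forall y \ae mps_mu Y, condexp (Y := Y) (fun x => complex.Im (f x)) y = 0) ->
  ghk_seminorm k f = 0.
Proof.
move=> dY f bf f1 E1 E2; have [b1 b2] := bf.
have z (c : Y -> R) : bm c -> (\forall y \ae mps_mu Y, c y = 0) ->
    Rintegral (mps_mu Y) setT (fun y => c y ^+ 2) = 0.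
  move=> bc c0; rewrite -[RHS](int_cst (mps_mu Y) 0); apply: int_ae_eq.
  - exact: bmX.
  - exact: bm_cst.
  - by apply: filterS c0 => y ->; rewrite expr0n.
have := ghk_seminorm_le hX dY bf f1.
rewrite (z _ (bm_condexp Y b1) E1) (z _ (bm_condexp Y b2) E2) addr0 mulr0 => le0.
apply/eqP; have n0 : (0 < 2 ^ k.+1)%N by rewrite expn_gt0.
have h0 : 0 <= ghk_seminorm k f ^+ (2 ^ k.+1) by rewrite expnS exprM exprn_ge0 // sqr_ge0.
by have := eq_le (ghk_seminorm k f ^+ (2 ^ k.+1)) 0; rewrite le0 h0 expf_eq0 n0.
Qed.

(** The function [v1 + i v2] is divided by a bound [C] so that the seminorm bound, stated on the
    unit ball, applies; the claim is the real part of the orthogonality relation. *)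
Lemma ghk_space_orthogonal (hX : ergodic X) k (Y : markov_factor X) (f : X -> R[i])
    (v1 v2 : X -> R) : distal_factor k Y -> ghk_space X k f -> bm v1 -> bm v2 ->
  (\forall y \ae mps_mu Y, condexp v1 y = 0) ->
  (\forall y \ae mps_mu Y, condexp v2 y = 0) ->
  Rintegral mu setT (fun x => v1 x * complex.Re (f x)) +
  Rintegral mu setT (fun x => v2 x * complex.Im (f x)) = 0.
Proof.
move=> dY [Lf orth] bv1 bv2 Ev1 Ev2.
have [if1 if2] := cLp1_integrable (cLp2_cLp1 Lf).
have iv1 := integrable_mul_bm bv1 if1; have iv2 := integrable_mul_bm bv2 if2.
have [C C0 hC] : exists2 C : R, 0 < C & forall x, `|v1 x| + `|v2 x| <= C.
  have [_ [M1 h1]] := bv1; have [_ [M2 h2]] := bv2.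
  exists (`|M1| + `|M2| + 1); first by rewrite ltr_pwDr // addr_ge0.
  move=> x; apply: (@le_trans _ _ (`|M1| + `|M2|)); last by rewrite lerDl.
  by apply: lerD; [exact: le_trans (h1 x) (ler_norm _) | exact: le_trans (h2 x) (ler_norm _)].
pose w x : R[i] := Complex (C^-1 * v1 x) (C^-1 * v2 x).
have bw1 : bm (fun x => C^-1 * v1 x) by apply: bmM bv1; exact: bm_cst.
have bw2 : bm (fun x => C^-1 * v2 x) by apply: bmM bv2; exact: bm_cst.
have cw : cbm w := conj bw1 bw2.
have w1 x : cabs w x <= 1.
  apply: le_trans (cabs_le w x) _; rewrite /= !normrM normfV (gtr0_norm C0) -mulrDr.
  by rewrite ler_pdivrMl // mulr1.
have zE (v : X -> R) : bm v -> (\forall y \ae mps_mu Y, condexp v y = 0) ->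
    \forall y \ae mps_mu Y, condexp (Y := Y) (fun x => C^-1 * v x) y = 0.
  by move=> bv; apply: filterS2 (condexpZ Y C^-1 bv) => y -> ->; rewrite mulr0.
have sw : ghk_seminorm k w = 0.
  exact: (ghk_seminorm_eq0 hX dY cw w1 (zE v1 bv1 Ev1) (zE v2 bv2 Ev2)).
have Lw : cLp +oo%E w by apply: cbm_cLp; [exact: leey | exact: cw].
have Uw : L2_closure [set f | cLp +oo%E f /\ ghk_seminorm k f = 0] w.
  apply: L2_closure_sub; last exact: (conj Lw sw).
  by apply: cbm_cLp; [rewrite lee_fin ler1n | exact: cw].
have /(congr1 (@complex.Re R)) := orth w Uw; rewrite /cinner /cintegral /=.
rewrite (_ : (fun x => _) = (fun x => C^-1 *
    (v1 x * complex.Re (f x) + v2 x * complex.Im (f x)))); last first.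
  by apply/funext => x; rewrite /w; case: (f x) => a b /=; ring.
have iv12 : mu.-integrable setT (EFin \o (fun x =>
    v1 x * complex.Re (f x) + v2 x * complex.Im (f x))).
  exact: (integrableD measurableT iv1 iv2).
rewrite RintegralZl // RintegralD // => /eqP.
by rewrite mulf_eq0 invr_eq0 (gt_eqF C0) => /eqP.
Qed.

(* The residual v of a truncation t of f against the factor is orthogonal to f
   and to its own projection, so |v|^2 <= |f - t|^2 + (terms of integral 0). *)
Lemma factor_approx (hX : ergodic X) k (Y : markov_factor X) (f : X -> R[i]) (e : R) :
  distal_factor k Y -> ghk_space X k f -> 0 < e ->
  exists2 g, factor_space Y g & (sq_int (fun x => f x - g x)%R <= e%:E)%E.
Proof.
move=> dY fZ e0; have [Lf _] := fZ; have [mf _] := Lf.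
(* Both [|f - t|^2] and [|t - g|^2] will integrate to at most [e / 4], and the triangle inequality
   doubles each. *)
have [K hK] := truncate_cvg Lf (divr_gt0 e0 (ltr0n R 4 : 0 < 4)).
pose t := truncate f K; have [bt1 bt2] := cbm_truncate K mf.
pose t1 x := complex.Re (t x); pose t2 x := complex.Im (t x).
pose c1 := condexp (Y := Y) t1; pose c2 := condexp (Y := Y) t2.
have bc1 : bm c1 by exact: bm_condexp.
have bc2 : bm c2 by exact: bm_condexp.
pose g x := Complex (lift c1 x) (lift c2 x).
have bg1 := bm_lift bc1; have bg2 := bm_lift bc2.
pose v1 x := t1 x - lift c1 x; pose v2 x := t2 x - lift c2 x.
have bv1 : bm v1 by exact: bmD bt1 (bmN bg1).
have bv2 : bm v2 by exact: bmD bt2 (bmN bg2).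
have Ev1 := condexp_resid Y bt1; have Ev2 := condexp_resid Y bt2.
have cg : cbm g := conj bg1 bg2.
have Lg : cLp 2%:E g by apply: cbm_cLp => //; rewrite lee_fin ler1n.
exists g.
  split => //; exists (fun y => Complex (c1 y) (c2 y)).
    by apply: cbm_cLp; [rewrite lee_fin ler1n | exact: (conj bc1 bc2)].
  by apply: filterS (mf_op_cbm (c := fun y => Complex (c1 y) (c2 y)) (conj bc1 bc2)) => x ->.
have gv (c : Y -> R) (v : X -> R) : bm c -> bm v ->
    (\forall y \ae mps_mu Y, condexp v y = 0) ->
    Rintegral mu setT (fun x => lift c x * v x) = 0.
  move=> bc bv Ev; rewrite int_condexpM // -[RHS](int_cst (mps_mu Y) 0).
  apply: int_ae_eq; [exact: bmM bc (bm_condexp Y bv) | exact: bm_cst |].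
  by apply: filterS Ev => y ->; rewrite mulr0.
have [if1 if2] := cLp1_integrable (cLp2_cLp1 Lf).
have iv1 := integrable_mul_bm bv1 if1; have iv2 := integrable_mul_bm bv2 if2.
have fv := ghk_space_orthogonal hX dY fZ bv1 bv2 Ev1 Ev2.
pose r x := cabs (fun x => f x - t x) x ^+ 2.
have mt : cmeasurable t := conj bt1.1 bt2.1.
have mg : cmeasurable g := conj bg1.1 bg2.1.
have mr : measurable_fun setT r.
  have [[m1 m2] [m3 m4]] := (mf, mt).
  apply: measurable_funX; apply: measurable_cabs; split.
    by under eq_fun do rewrite complex_ReB; exact: measurable_funB.
  by under eq_fun do rewrite complex_ImB; exact: measurable_funB.
have ir : mu.-integrable setT (EFin \o r).
  apply: (le_integrable measurableT) (cLp2_integrable Lf); first exact/measurable_EFinP.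
  move=> x _; rewrite /= lee_fin !ger0_norm ?sqr_ge0 // /r !sqr_cabs /t /truncate.
  rewrite complex_ReB complex_ImB; case: ifP => _ /=.
    by rewrite !subrr expr0n addr0 addr_ge0 // sqr_ge0.
  by rewrite !subr0.
pose s x := v1 x ^+ 2 + v2 x ^+ 2.
have bs : bm s by exact: bmD (bmX 2 bv1) (bmX 2 bv2).
have bp1 := bmM bg1 bv1; have bp2 := bmM bg2 bv2.
pose F x := v1 x * complex.Re (f x) + v2 x * complex.Im (f x).
pose G x := lift c1 x * v1 x + lift c2 x * v2 x.
have iF : mu.-integrable setT (EFin \o F) by exact: (integrableD measurableT iv1 iv2).
have iG : mu.-integrable setT (EFin \o G) by exact: bm_integrable (bmD bp1 bp2).
have IF : Rintegral mu setT F = 0 by rewrite RintegralD.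
have IG : Rintegral mu setT G = 0.
  apply: eq_trans (intD mu bp1 bp2) _.
  exact: eq_trans (congr2 +%R (gv _ _ bc1 bv1 Ev1) (gv _ _ bc2 bv2 Ev2)) (addr0 0).
have iFG : mu.-integrable setT (EFin \o (fun x => F x - G x)).
  exact: (integrableB measurableT iF iG).
have i2FG : mu.-integrable setT (EFin \o (fun x => 2 * (F x - G x))).
  exact: (integrableZl measurableT 2 iFG).
have s_le : Rintegral mu setT s <= Rintegral mu setT r.
  apply: (@le_trans _ _ (Rintegral mu setT (fun x => r x + 2 * (F x - G x)))).
    apply: le_Rintegral => //.
    - exact: bm_integrable.
    - exact: (integrableD measurableT ir i2FG).
    move=> x _; rewrite /r sqr_cabs complex_ReB complex_ImB.
    rewrite -[complex.Re (t x)]/(t1 x) -[complex.Im (t x)]/(t2 x) /s /F /G /v1 /v2.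
    move: (t1 x) (t2 x) (lift c1 x) (lift c2 x) (complex.Re (f x)) (complex.Im (f x)).
    move=> a1 a2 b1 b2 d1 d2; rewrite -subr_ge0.
    rewrite (_ : _ - _ = (d1 - b1) ^+ 2 + (d2 - b2) ^+ 2).
      by rewrite addr_ge0 // sqr_ge0.
    by ring.
  by rewrite RintegralD // RintegralZl // RintegralB // IF IG subrr mulr0 addr0.
apply: le_trans (sq_int_triangle mf mt mg) _.
have tg : (sq_int (fun x => t x - g x)%R <= sq_int (fun x => f x - t x)%R)%E.
  have -> : sq_int (fun x => t x - g x)%R = (\int[mu]_x (s x)%:E)%E.
    by apply: eq_integral => x _; rewrite sqr_cabs complex_ReB complex_ImB.
  rewrite -[X in (_ <= X)%E]/(\int[mu]_x (r x)%:E)%E.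
  rewrite -[X in (X <= _)%E]fineK; last first.
    exact: integrable_fin_num (bm_integrable mu bs).
  rewrite -[X in (_ <= X)%E]fineK ?lee_fin //.
  exact: integrable_fin_num ir.
apply: (@le_trans _ _ (2%:E * (e / 4)%:E + 2%:E * (e / 4)%:E)%E).
  by apply: leeD; rewrite lee_pmul2l //; exact: le_trans tg hK.
by rewrite -!EFinM -EFinD lee_fin le_eqVlt; apply/orP; left; apply/eqP; field.
Qed.

End main.

Theorem proposition7p1 (R : realType) (X : mpsystem R) (hX : ergodic X)
    (k : nat) (hk : (0 < k)%N) (Dk : markov_factor X)
    (hD : distal_factor k Dk) :
  ghk_space X k `<=` factor_space Dk.
Proof.
move=> f fZ; have approx := factor_approx hX hD fZ.
(* Since [k] is positive, [factor_space Dk] is the L^2-closure of the almost periodic functions over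
   the previous distal factor, hence closed. *)
case: k hk hD fZ approx => // k _ [W _ hW] fZ approx.
rewrite -hW; apply: L2_closure_closed.
- by move=> g [[[]]].
- by case: fZ.
- by move=> e /approx[g Dg fg]; exists g => //; rewrite hW.
Qed.
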